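(* (a) Let $\Gamma$ be a diagram of finite type and $\Gamma'=\mu_k(\Gamma)$ the mutation of $\Gamma$ at a vertex $k$. Then $W_{\Gamma}\cong W_{\Gamma'}$. (b) Let $\mathcal{A}$ be a cluster algebra of finite type. Then the groups $W_{\Gamma}$ associated to the diagrams $\Gamma$ arising from the seeds of $\mathcal{A}$ are all isomorphic (to the reflection group associated to the Dynkin diagram associated to $\mathcal{A}$).
   Context: Cluster algebras. Let $\mathbb{F}=\mathbb{Q}(u_1,\dots,u_n)$. An $n\times n$ integer matrix $B$ is skew-symmetrisable if $DB$ is skew-symmetric for some diagonal matrix $D$ with positive diagonal entries. Consider pairs $(\mathbf{x},B)$ with $\mathbf{x}=\{x_1,\dots,x_n\}$ a free generating set of $\mathbb{F}$ and $B$ an $n\times n$ skew-symmetrisable matrix. For $k\in[1,n]$ the mutation $\mu_k(\mathbf{x},B)=(\mathbf{x}',B')$ is given by $B'_{ij}=-B_{ij}$ if $i=k$ or $j=k$, and $B'_{ij}=B_{ij}+\frac{|B_{ik}|B_{kj}+B_{ik}|B_{kj}|}{2}$ otherwise; $\mathbf{x}'$ is obtained from $\mathbf{x}$ by replacing $x_k$ with $x_k'$ where $x_k'x_k=\prod_{B_{ik}>0}x_i^{B_{ik}}+\prod_{B_{ik}<0}x_i^{-B_{ik}}$. Write $\mu_k(B)=B'$. Fix an initial seed; the seeds are all pairs obtained from it by sequences of mutations (identified up to simultaneous relabelling by permutations of $[1,n]$). The cluster algebra $\mathcal{A}(B)$ is the $\mathbb{Q}$-subalgebra of $\mathbb{F}$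 generated by all elements $x_i$ appearing in seeds. It is of finite type if it has finitely many seeds. The Cartan counterpart $A(B)$ of $B$ has entries $2$ on the diagonal and $-|B_{ij}|$ off the diagonal. The Dynkin diagram associated to a cluster algebra of finite type is the unique $\Delta$ such that some seed has a matrix whose Cartan counterpart is the Cartan matrix of $\Delta$ (up to simultaneous permutation of rows and columns). Diagrams. The diagram $\Gamma(B)$ of $B$ is the weighted oriented graph with vertices $[1,n]$ and an arrow from $i$ to $j$ if and only if $B_{ij}>0$, with weight $|B_{ij}B_{ji}|$. A diagram $\Gamma=\Gamma(B)$ is of finite type if $\mathcal{A}(B)$ is of finite type. Its mutation is $\mu_k(\Gamma)=\Gamma(\mu_k(B))$ (in finite type this depends only on $\Gamma$ and $k$). In finite type all weights are at most $3$. A chordless cycle in $\Gamma$ is an induced subgraph of the underlying unoriented graph that is a cycle; in finite type these are always cyclically oriented in $\Gamma$, and either have all weights $1$, or are $3$-cycles with weights $1,2,2$, or $4$-cycles with weights $1,2,1,2$ in cyclic order (Fomin-Zelevinsky). The group $W_\Gamma$. For vertices $i\neq j$ of a diagram $\Gamma$ of finite type, let $m_{ij}=2$ if $i,j$ are not joined by an edge, and $m_{ij}=3,4,6$ if they are joined by an edge of weight $1,2,3$ respectively. $W_\Gamma$ is the group with generators $s_1,\dots,s_n$ subject to: (R1) $s_i^2=e$ for all $i$; (R2) $(s_is_j)^{m_{ij}}=e$ for all $i\neq j$; (R3) for each chordless cycle $C$: $i_0\to i_1\to\cdots\to i_{d-1}\to i_0$ in $\Gamma$, putting (subscripts modulo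 $d$) $r(i_a,i_{a+1})=s_{i_a}s_{i_{a+1}}\cdots s_{i_{a+d-1}}s_{i_{a+d-2}}\cdots s_{i_{a+1}}$: (a) if all weights in $C$ are $1$, then $r(i_a,i_{a+1})^2=e$ for $a=0,\dots,d-1$; (b) if $C$ has some edges of weight $2$, then $r(i_a,i_{a+1})^{4-w_a}=e$ for $a=0,\dots,d-1$, where $w_a$ is the weight of the edge between $i_{a-1}$ and $i_a$. *)

(* Defs.v *)
From HB Require Import structures.
From mathcomp Require Import all_boot all_order all_fingroup all_algebra.
From mathcomp Require Import generic_quotient mpoly.
From mathcomp Require Import boolp.

Set Implicit Arguments.
Unset Strict Implicit.
Unset Printing Implicit Defensive.

Import Order.TTheory GRing.Theory Num.Theory.
Local Open Scope ring_scope.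

(* The letter (x, false) stands for x and (x, true) for x^-1. *)
Definition word (X : Type) : Type := seq (X * bool).

Definition inv_letter (X : Type) (l : X * bool) : X * bool := (l.1, ~~ l.2).
Definition inv_word (X : Type) (w : word X) : word X :=
  rev (map (@inv_letter X) w).
Definition pow_word (X : Type) (w : word X) (m : nat) : word X :=
  flatten (nseq m w).

Inductive pres_eq (X : Type) (R : word X -> Prop) : word X -> word X -> Prop :=
| PresRefl w : pres_eq R w w
| PresSym v w : pres_eq R v w -> pres_eq R w v
| PresTrans u v w : pres_eq R u v -> pres_eq R v w -> pres_eq R u w
| PresCancel u l v : pres_eq R (u ++ l :: inv_letter l :: v) (u ++ v)
| PresRel u r v : R r -> pres_eq R (u ++ r ++ v) (u ++ v).

Section Presentation.
Context (X : choiceType) (R : word X -> Prop).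

Definition pres_eqb : rel (word X) := fun v w => `[< pres_eq R v w >].

Lemma pres_eqb_refl : reflexive pres_eqb.
Proof. by move=> w; apply/asboolP; exact: PresRefl. Qed.

Lemma pres_eqb_sym : ssrbool.symmetric pres_eqb.
Proof. by move=> v w; apply/asboolP/asboolP; exact: PresSym. Qed.

Lemma pres_eqb_trans : transitive pres_eqb.
Proof. by move=> v u w /asboolP uv /asboolP vw; apply/asboolP/(PresTrans uv). Qed.

Canonical pres_equiv :=
  EquivRel pres_eqb pres_eqb_refl pres_eqb_sym pres_eqb_trans.

Definition presented_group : Type := {eq_quot pres_equiv}%qT.

HB.instance Definition _ := Choice.on presented_group.
HB.instance Definition _ := EqQuotient.on presented_group.

Local Notation PG := presented_group.

Lemma presP v w : reflect (pres_eq R v w) (v == w %[mod PG])%qT.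
Proof. by rewrite piE; exact: asboolP. Qed.

Lemma pres_eq_cat u1 u2 v1 v2 :
  pres_eq R u1 u2 -> pres_eq R v1 v2 -> pres_eq R (u1 ++ v1) (u2 ++ v2).
Proof.
move=> hu hv; apply: (@PresTrans _ _ _ (u2 ++ v1)).
  elim: hu => {u1 u2 hv}
    [w|v w _ IH|u v w _ IH1 _ IH2|u l v|u r v Rr]; first exact: PresRefl.
  - exact: PresSym.
  - exact: PresTrans IH1 IH2.
  - by rewrite -!catA; exact: PresCancel.
  - by rewrite -!catA; exact: PresRel.
elim: hv => {v1 v2 hu}
  [w|v w _ IH|u v w _ IH1 _ IH2|u l v|u r v Rr]; first exact: PresRefl.
- exact: PresSym.
- exact: PresTrans IH1 IH2.
- by rewrite !catA; exact: PresCancel.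
- by rewrite !(catA u2); exact: PresRel.
Qed.

Lemma pres_eq_invl w : pres_eq R (inv_word w ++ w) [::].
Proof.
elim: w => [|l w IH]; first exact: PresRefl.
apply: PresTrans IH.
rewrite /inv_word /= rev_cons cat_rcons.
have {2}-> : l = inv_letter (inv_letter l).
  by case: l => x b; rewrite /inv_letter /= negbK.
exact: PresCancel.
Qed.

Lemma inv_wordK : involutive (@inv_word X).
Proof.
move=> w; rewrite /inv_word map_rev revK -map_comp -[RHS]map_id.
by apply: eq_map => -[x b]; rewrite /inv_letter /= negbK.
Qed.

Lemma pres_eq_invr w : pres_eq R (w ++ inv_word w) [::].
Proof. by rewrite -{1}(inv_wordK w); exact: pres_eq_invl. Qed.

Lemma pres_eq_inv v w : pres_eq R v w -> pres_eq R (inv_word v) (inv_word w).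
Proof.
move=> vw; apply: PresSym.
apply: (@PresTrans _ _ _ (inv_word w ++ (v ++ inv_word v))).
  rewrite -[X in pres_eq R X]cats0; apply: pres_eq_cat; first exact: PresRefl.
  exact/PresSym/pres_eq_invr.
rewrite catA -[X in pres_eq R _ X]cat0s; apply: pres_eq_cat (PresRefl _ _).
apply: PresTrans (pres_eq_invl w).
by apply: pres_eq_cat vw; exact: PresRefl.
Qed.

Definition pres_mul (a b : PG) : PG := \pi_PG%qT (repr a ++ repr b).
Definition pres_one : PG := \pi_PG%qT [::].
Definition pres_inv (a : PG) : PG := \pi_PG%qT (inv_word (repr a)).

Lemma pres_repr w : pres_eq R (repr (\pi_PG%qT w)) w.
Proof. by apply/presP; rewrite reprK. Qed.

Lemma pres_mulE v w : pres_mul (\pi_PG%qT v) (\pi_PG%qT w) = \pi_PG%qT (v ++ w).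
Proof. by apply/eqP/presP; apply: pres_eq_cat; exact: pres_repr. Qed.

Lemma pres_invE w : pres_inv (\pi_PG%qT w) = \pi_PG%qT (inv_word w).
Proof. by apply/eqP/presP; apply: pres_eq_inv; exact: pres_repr. Qed.

Lemma presW (P : PG -> Prop) : (forall w, P (\pi_PG%qT w)) -> forall a, P a.
Proof. by move=> h a; rewrite -[a]reprK. Qed.

Lemma pres_mulA : associative pres_mul.
Proof.
move=> a b c; elim/presW: a => u; elim/presW: b => v; elim/presW: c => w.
by rewrite !pres_mulE catA.
Qed.

Lemma pres_mul1 : left_id pres_one pres_mul.
Proof. by move=> a; elim/presW: a => u; rewrite /pres_one pres_mulE. Qed.

Lemma pres_mulr1 : right_id pres_one pres_mul.
Proof. by move=> a; elim/presW: a => u; rewrite /pres_one pres_mulE cats0. Qed.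

Lemma pres_mulV : left_inverse pres_one pres_inv pres_mul.
Proof.
move=> a; elim/presW: a => u; rewrite pres_invE pres_mulE; apply/eqP/presP.
exact: pres_eq_invl.
Qed.

Lemma pres_mulrV : right_inverse pres_one pres_inv pres_mul.
Proof.
move=> a; elim/presW: a => u; rewrite pres_invE pres_mulE; apply/eqP/presP.
exact: pres_eq_invr.
Qed.

HB.instance Definition _ := isGroup.Build presented_group
  pres_mulA pres_mul1 pres_mulr1 pres_mulV pres_mulrV.

End Presentation.

Definition group_isomorphic (G H : groupType) : Prop :=
  exists f : {multiplicative G -> H}, bijective f.

Definition ratfun (n : nat) : fieldType := {fraction {mpoly rat[n]}}.

Definition ratfun_eval (n : nat) (x : 'I_n -> ratfun n) (p : {mpoly rat[n]}) :
    ratfun n :=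
  mmap (@tofrac {mpoly rat[n]} \o @mpolyC n rat) x p.

(* The x_i are algebraically independent over the rationals and generate the
   field of rational functions. *)
Definition free_generating (n : nat) (x : 'I_n -> ratfun n) : Prop :=
  (forall p : {mpoly rat[n]}, ratfun_eval x p = 0 -> p = 0) /\
  (forall f : ratfun n, exists p q : {mpoly rat[n]},
     ratfun_eval x q != 0 /\ f = ratfun_eval x p / ratfun_eval x q).

Definition skew_symmetrisable (n : nat) (B : 'M[int]_n) : Prop :=
  exists d : 'rV[int]_n,
    (forall i, 0 < d 0 i) /\ (diag_mx d *m B)^T = - (diag_mx d *m B).

Record seed (n : nat) : Type := Seed {
  cluster : {ffun 'I_n -> ratfun n};
  exchange : 'M[int]_n
}.

Definition is_seed (n : nat) (s : seed n) : Prop :=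
  free_generating (cluster s) /\ skew_symmetrisable (exchange s).

(* The division by 2 is exact. *)
Definition mutate_matrix (n : nat) (k : 'I_n) (B : 'M[int]_n) : 'M[int]_n :=
  \matrix_(i, j)
    if (i == k) || (j == k) then - B i j
    else B i j + ((`|B i k| * B k j + B i k * `|B k j|) %/ 2)%Z.

Definition mutate_cluster (n : nat) (k : 'I_n) (B : 'M[int]_n)
    (x : {ffun 'I_n -> ratfun n}) : {ffun 'I_n -> ratfun n} :=
  [ffun j => if j == k then
               (\prod_(i | 0 < B i k) x i ^ B i k +
                \prod_(i | B i k < 0) x i ^ (- B i k)) / x k
             else x j].

Definition mutate (n : nat) (s : seed n) (k : 'I_n) : seed n :=
  Seed (mutate_cluster k (exchange s) (cluster s))
       (mutate_matrix k (exchange s)).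

Definition relabel (n : nat) (sigma : 'S_n) (s : seed n) : seed n :=
  Seed [ffun i => cluster s (sigma i)]
       (\matrix_(i, j) exchange s (sigma i) (sigma j)).

(* The seeds of the cluster algebra with initial seed s0, with all their
   labellings. *)
Definition seed_of (n : nat) (s0 s : seed n) : Prop :=
  exists (ks : seq 'I_n) (sigma : 'S_n),
    s = relabel sigma (foldl (@mutate n) s0 ks).

Definition finite_type (n : nat) (s0 : seed n) : Prop :=
  exists (N : nat) (t : 'I_N -> seed n),
    forall s, seed_of s0 s -> exists i sigma, s = relabel sigma (t i).

(* The weighted adjacency matrix of a weighted oriented graph: there is an
   arrow from i to j if and only if the entry (i, j) is nonzero, and this entry
   is then the weight of the arrow. *)
Definition diagram (n : nat) : Type := 'M[nat]_n.

Definition diagram_of (n : nat) (B : 'M[int]_n) : diagram n :=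
  \matrix_(i, j) if 0 < B i j then absz (B i j * B j i) else 0%N.

Definition arrow (n : nat) (G : diagram n) : rel 'I_n :=
  fun i j => (0 < G i j)%N.

Definition joined (n : nat) (G : diagram n) : rel 'I_n :=
  fun i j => arrow G i j || arrow G j i.

(* At most one of the two terms is nonzero in the diagram of a
   skew-symmetrisable matrix. *)
Definition edge_weight (n : nat) (G : diagram n) (i j : 'I_n) : nat :=
  (G i j + G j i)%N.

Definition finite_type_diagram (n : nat) (G : diagram n) : Prop :=
  exists s : seed n,
    [/\ is_seed s, G = diagram_of (exchange s) & finite_type s].

Definition diagram_mutation (n : nat) (k : 'I_n) (G G' : diagram n) : Prop :=
  exists B : 'M[int]_n,
    [/\ skew_symmetrisable B, G = diagram_of B &
        G' = diagram_of (mutate_matrix k B)].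

Definition chordless_cycle (n : nat) (G : diagram n) (c : seq 'I_n) : Prop :=
  [/\ (2 < size c)%N, uniq c, path.cycle (arrow G) c &
      {in c &, forall i j, joined G i j -> (j == next c i) || (i == next c j)}].

(* The exponent 0 for a weight greater than 3, which does not occur in finite
   type, gives a trivial relation. *)
Definition coxeter_exponent (n : nat) (G : diagram n) (i j : 'I_n) : nat :=
  match edge_weight G i j with
  | 0 => 2 | 1 => 3 | 2 => 4 | 3 => 6 | _ => 0
  end.

Definition gens (n : nat) (c : seq 'I_n) : word 'I_n :=
  [seq (i, false) | i <- c].

(* For c = [:: i_0; ...; i_(d-1)], the word r(i_a, i_(a+1)) is indexed by
   i = i_a; then next c i = i_(a+1) and prev c i = i_(a-1). *)
Definition cycle_word (n : nat) (c : seq 'I_n) (i : 'I_n) : word 'I_n :=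
  let c' := rot (index i c) c in gens (c' ++ behead (rev (behead c'))).

Inductive W_relator (n : nat) (G : diagram n) : word 'I_n -> Prop :=
| R1 i : W_relator G (pow_word (gens [:: i]) 2)
| R2 i j : i != j ->
    W_relator G (pow_word (gens [:: i; j]) (coxeter_exponent G i j))
| R3a c i : chordless_cycle G c ->
    (forall j, j \in c -> edge_weight G j (next c j) = 1%N) ->
    i \in c ->
    W_relator G (pow_word (cycle_word c i) 2)
| R3b c i : chordless_cycle G c ->
    (exists2 j, j \in c & edge_weight G j (next c j) = 2%N) ->
    i \in c ->
    W_relator G (pow_word (cycle_word c i) (4 - edge_weight G (prev c i) i)).

Definition W (n : nat) (G : diagram n) : groupType :=
  presented_group (@W_relator n G).

Inductive connected_dynkin : Type :=
| TypeA (n : nat) of (1 <= n)%N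
| TypeB (n : nat) of (2 <= n)%N
| TypeC (n : nat) of (3 <= n)%N
| TypeD (n : nat) of (4 <= n)%N
| TypeE (n : nat) of (6 <= n <= 8)%N
| TypeF4
| TypeG2.

Definition connected_rank (t : connected_dynkin) : nat :=
  match t with
  | TypeA n _ | TypeB n _ | TypeC n _ | TypeD n _ | TypeE n _ => n
  | TypeF4 => 4
  | TypeG2 => 2
  end.

Definition chain (i j : nat) : bool := (i.+1 == j) || (j.+1 == i).

(* The chain 0 - ... - (n-2) with a further vertex n-1 attached to p. *)
Definition branch (n p i j : nat) : bool :=
  if i == n.-1 then j == p else if j == n.-1 then i == p else chain i j.

(* Minus the off-diagonal Cartan entry a_ij = 2 (a_i, a_j) / (a_i, a_i), so that
   the row of the shorter root carries the larger entry: vertex n-1 is the short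
   root in B_n and the long root in C_n. *)
Definition bond (t : connected_dynkin) (i j : nat) : nat :=
  match t with
  | TypeA _ _ => chain i j
  | TypeB n _ => if (i == n.-1) && (j == n.-2) then 2 else chain i j
  | TypeC n _ => if (i == n.-2) && (j == n.-1) then 2 else chain i j
  | TypeD n _ => branch n (n - 3) i j
  | TypeE n _ => branch n 2 i j
  | TypeF4 => if (i == 2) && (j == 1) then 2 else chain i j
  | TypeG2 => if (i == 1) && (j == 0) then 3 else chain i j
  end%N.

Definition connected_cartan (t : connected_dynkin) :
    'M[int]_(connected_rank t) :=
  \matrix_(i, j) if i == j then 2 else - (bond t i j)%:Z.

Definition dynkin : Type := seq connected_dynkin.

Fixpoint dynkin_rank (D : dynkin) : nat :=
  if D is t :: D' then (connected_rank t + dynkin_rank D')%N else 0%N.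

Fixpoint cartan_matrix (D : dynkin) : 'M[int]_(dynkin_rank D) :=
  match D return 'M[int]_(dynkin_rank D) with
  | [::] => 0
  | t :: D' => block_mx (connected_cartan t) 0 0 (cartan_matrix D')
  end.

Definition cartan_counterpart (n : nat) (B : 'M[int]_n) : 'M[int]_n :=
  \matrix_(i, j) if i == j then 2 else - `|B i j|.

Definition dynkin_diagram_of (n : nat) (s0 : seed n) (D : dynkin) : Prop :=
  exists s : seed n, seed_of s0 s /\
    exists sigma : 'I_(dynkin_rank D) -> 'I_n, bijective sigma /\
      forall i j,
        cartan_counterpart (exchange s) (sigma i) (sigma j) =
        cartan_matrix D i j.

(* The matrix, in the basis of simple roots and acting on columns, of the
   reflection mapping the j-th simple root a_j to a_j - a_ij a_i. *)
Definition simple_reflection (D : dynkin) (i : 'I_(dynkin_rank D)) :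
    'M[rat]_(dynkin_rank D) :=
  \matrix_(k, j) ((k == j)%:R - (k == i)%:R * (cartan_matrix D i j)%:~R).

Inductive in_reflection_group (D : dynkin) : 'M[rat]_(dynkin_rank D) -> Prop :=
| RefGen i : in_reflection_group (simple_reflection i)
| RefOne : in_reflection_group 1%:M
| RefMul M N : in_reflection_group M -> in_reflection_group N ->
    in_reflection_group (M *m N)
| RefInv M : in_reflection_group M -> in_reflection_group (invmx M).

Section ReflectionGroup.
Context (D : dynkin).

Lemma cartan_diag i : cartan_matrix D i i = 2.
Proof.
elim: D i => [|t D' IH] /=; first by case.
move=> i; rewrite -(splitK i); case: (split i) => j /=.
  by rewrite block_mxEul mxE eqxx.
by rewrite block_mxEdr IH.
Qed.

Lemma simple_reflectionK i :
  simple_reflection i *m simple_reflection i = 1%:M :> 'M_(dynkin_rank D).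
Proof.
have E : simple_reflection i =
    1%:M - delta_mx i i *m map_mx intr (cartan_matrix D).
  apply/matrixP => k j; rewrite !mxE (bigD1 i) //= big1 => [|l li].
    by rewrite !mxE eqxx andbT addr0.
  by rewrite !mxE (negPf li) andbF mul0r.
have F : delta_mx i i *m map_mx intr (cartan_matrix D) *m delta_mx i i =
    2 *: delta_mx i i :> 'M[rat]_(dynkin_rank D).
  apply/matrixP => k j; rewrite !mxE (bigD1 i) //= big1 => [|l li]; last first.
    by rewrite !mxE (negPf li) mulr0.
  rewrite !mxE (bigD1 i) //= big1 => [|l li]; last first.
    by rewrite !mxE (negPf li) andbF mul0r.
  rewrite !mxE cartan_diag !eqxx andbT addr0 addr0 /=.
  by case: (k == i); case: (j == i); rewrite ?(mul0r, mul1r, mulr0, mulr1).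
have G : delta_mx i i *m map_mx intr (cartan_matrix D) *m
    (delta_mx i i *m map_mx intr (cartan_matrix D)) =
    (delta_mx i i *m map_mx intr (cartan_matrix D)) *+ 2
    :> 'M[rat]_(dynkin_rank D).
  by rewrite mulmxA F -scalemxAl scaler_nat.
rewrite E mulmxBl mul1mx mulmxBr mulmx1 G mulr2n.
by rewrite opprB addrK subrK.
Qed.

Lemma in_reflection_group_unit M : @in_reflection_group D M -> M \in unitmx.
Proof.
elim=> [i||M' N _ hM _ hN|M' _ hM].
- by case: (mulmx1_unit (simple_reflectionK i)).
- exact: unitmx1.
- by rewrite unitmx_mul hM.
- by rewrite unitmx_inv.
Qed.

Definition reflection_group : Type :=
  {M : 'M[rat]_(dynkin_rank D) | `[< in_reflection_group M >]}.

HB.instance Definition _ := Choice.on reflection_group.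

Definition ref_mul (M N : reflection_group) : reflection_group :=
  exist _ (val M *m val N)
    (asboolT (RefMul (asboolW (valP M)) (asboolW (valP N)))).
Definition ref_one : reflection_group :=
  exist _ 1%:M (asboolT (RefOne D)).
Definition ref_inv (M : reflection_group) : reflection_group :=
  exist _ (invmx (val M)) (asboolT (RefInv (asboolW (valP M)))).

Lemma ref_unit (M : reflection_group) : val M \in unitmx.
Proof. exact: in_reflection_group_unit (asboolW (valP M)). Qed.

Lemma ref_mulA : associative ref_mul.
Proof. by move=> M N P; apply: val_inj; rewrite /= mulmxA. Qed.
Lemma ref_mul1 : left_id ref_one ref_mul.
Proof. by move=> M; apply: val_inj; rewrite /= mul1mx. Qed.
Lemma ref_mulr1 : right_id ref_one ref_mul.
Proof. by move=> M; apply: val_inj; rewrite /= mulmx1. Qed.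
Lemma ref_mulV : left_inverse ref_one ref_inv ref_mul.
Proof. by move=> M; apply: val_inj; rewrite /= mulVmx ?ref_unit. Qed.
Lemma ref_mulrV : right_inverse ref_one ref_inv ref_mul.
Proof. by move=> M; apply: val_inj; rewrite /= mulmxV ?ref_unit. Qed.

HB.instance Definition _ := isGroup.Build reflection_group
  ref_mulA ref_mul1 ref_mulr1 ref_mulV ref_mulrV.

End ReflectionGroup.

(* Main.v *)
(* Let G' be the mutation at k of a finite type diagram G.  If elements t_i of a
   group satisfy the relations of G, then the elements t_k t_i t_k for i -> k in
   G, and t_i otherwise, satisfy those of G'.  This gives homomorphisms between
   W_G and W_G' in both directions, whose composites are conjugations by s_k.

   The relations of exponent 3 attached to a cycle follow from those of exponent
   2, which say that t_x commutes with the reflection along the rest of the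
   cycle, and any one of the latter implies the others.  So one relation has to
   be found for each chordless cycle of G'; if k lies on it, removing k gives a
   cycle (or an edge) of G, if k has two neighbours on it they are adjacent and
   inserting k gives a cycle of G, and otherwise the cycle is one of G.

   The facts on diagrams used here follow from the bound 3 on the weights of all
   mutations: a chordless cycle is shrunk by mutating at one of its vertices,
   down to a triangle, where a single mutation shows which weights are possible.
   The bound holds because, at a place where all cluster variables take the value
   1, alternating mutations at i and j with |b_ij b_ji| >= 4 produce an increasing
   sequence of values.

   For a Dynkin diagram there are no cycles, W_G is a Coxeter group, and Tits'
   argument shows that it acts faithfully on the root lattice. *)

Require Import Defs.
From mathcomp Require Import all_boot all_order all_fingroup all_algebra.
From HB Require Import structures.
From mathcomp Require Import generic_quotient mpoly boolp zify ring lra.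

Set Implicit Arguments.
Unset Strict Implicit.
Unset Printing Implicit Defensive.

Import Order.TTheory GRing.Theory Num.Theory.
Local Open Scope ring_scope.

(** * Mutation of skew-symmetrisable matrices *)

(** Finite type becomes a bound on matrices by exhibiting infinitely many cluster variables, told
    apart by their values at a place. Starting from positive values, every mutation divides by a
    positive number only, so the place stays defined along any sequence of mutations.

    A diagram does not determine its matrix, and a mutation of diagrams may be computed from another
    matrix than that of the given seed. Hence the bound is carried by matrices ([tame]) and then
    shown to depend on the diagram alone.

    The rule for the new elements copies the mutation of roots: conjugating a reflection by t_k
    moves its root by t_k. Only the vertices on one side of k are moved, and mutating back moves
    those on the other side.

    The delicate point is that the relators of one cycle have exponent 2 or 3 according to the base
    point. The base point at which the conjugations cancel may be one of exponent 3; this happens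
    for 4-cycles with weights 2, 1, 2, 1, which therefore need another base point. *)

Section SkewSymmetrisable.
Variables (n : nat) (B : 'M[int]_n).
Hypothesis skB : skew_symmetrisable B.

Lemma skew_scale :
  exists2 d : 'I_n -> int, forall i, 0 < d i
    & forall i j, d i * B i j = - (d j * B j i).
Proof.
case: skB => d [d_gt0 /matrixP dB]; exists (d 0) => // i j.
by have := dB j i; rewrite mul_diag_mx !mxE.
Qed.

Lemma skew_diag i : B i i = 0.
Proof. by have [d d_gt0 dB] := skew_scale; have := d_gt0 i; have := dB i i; nia. Qed.

Lemma skew_gt0 i j : (0 < B i j) = (B j i < 0).
Proof.
have [d d_gt0 dB] := skew_scale.
by have := d_gt0 i; have := d_gt0 j; have := dB i j; nia.
Qed.

Lemma skew_lt0 i j : (B i j < 0) = (0 < B j i).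
Proof. by rewrite skew_gt0. Qed.

Lemma skew_eq0 i j : (B i j == 0) = (B j i == 0).
Proof. by have := skew_gt0 i j; have := skew_gt0 j i; lia. Qed.

(** Up to sign, the product of the three weights of a triangle is thus a square, which excludes for
    instance the weights 1, 1, 2. *)
Lemma skew_cycle3 i j k : B i j * B j k * B k i = - (B j i * B k j * B i k).
Proof.
have [d d_gt0 dB] := skew_scale.
have /mulfI : d i * d j * d k != 0 by rewrite !mulf_neq0 // gt_eqF.
apply; rewrite [LHS](_ : _ = d i * B i j * (d j * B j k) * (d k * B k i)); last ring.
by rewrite (dB i j) (dB j k) (dB k i); ring.
Qed.

End SkewSymmetrisable.

Section MatrixMutation.
Variables (n : nat) (k : 'I_n).
Implicit Type B : 'M[int]_n.

Lemma mutate_matrixE B i j : i != k -> j != k ->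
  mutate_matrix k B i j =
  if (0 < B i k) && (0 < B k j) then B i j + B i k * B k j
  else if (B i k < 0) && (B k j < 0) then B i j - B i k * B k j else B i j.
Proof.
move=> ik jk; rewrite mxE (negPf ik) (negPf jk) /=.
have two2 (x : int) : ((x + x) %/ 2)%Z = x by lia.
case: (ltgtP 0 (B i k)) => [a|a|<-]; case: (ltgtP 0 (B k j)) => [b|b|<-] /=;
  rewrite ?(normr0, mulr0, mul0r, div0z, addr0) //.
- by rewrite !gtr0_norm // two2.
- by rewrite gtr0_norm // ltr0_norm // mulrN subrr div0z addr0.
- by rewrite ltr0_norm // gtr0_norm // mulNr addNr div0z addr0.
- by rewrite !ltr0_norm // mulNr mulrN two2.
Qed.

Lemma mutate_matrixl B j : mutate_matrix k B k j = - B k j.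
Proof. by rewrite mxE eqxx. Qed.

Lemma mutate_matrixr B i : mutate_matrix k B i k = - B i k.
Proof. by rewrite mxE eqxx orbT. Qed.

Lemma mutate_skew B :
  skew_symmetrisable B -> skew_symmetrisable (mutate_matrix k B).
Proof.
move=> skB.
have [d d_gt0 dB] := skew_scale skB.
exists (\row_i d i); split=> [i|]; first by rewrite mxE.
apply/matrixP => i j; rewrite mul_diag_mx !mxE -!/(mutate_matrix _ _ _ _).
suff: d j * mutate_matrix k B j i = - (d i * mutate_matrix k B i j).
  by rewrite !mxE.
have [->|ik] := eqVneq i k.
  by rewrite mutate_matrixl mutate_matrixr !mulrN dB.
have [->|jk] := eqVneq j k.
  by rewrite mutate_matrixl mutate_matrixr !mulrN dB.
rewrite !mutate_matrixE // (skew_gt0 skB j) (skew_gt0 skB k i).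
rewrite (skew_lt0 skB j) (skew_lt0 skB k i) [(B k j < 0) && _]andbC.
rewrite [(0 < B k j) && _]andbC.
have E : d j * (B j k * B k i) = d i * (B i k * B k j).
  by rewrite !mulrA (dB i k) (dB j k); ring.
have := dB i j.
case: ifP => [/andP[a b]|_]; last case: ifP => [/andP[a b]|_].
- by rewrite !ifF 1?lt_gtF //; move: E; rewrite !mulrDr mulrN => -> ->; ring.
- by move: E; rewrite !mulrDr !mulrN => -> ->; ring.
by move=> ->; rewrite opprK.
Qed.

Lemma mutate_matrixK B : mutate_matrix k (mutate_matrix k B) = B.
Proof.
apply/matrixP => i j.
have [->|ik] := eqVneq i k; first by rewrite !mutate_matrixl opprK.
have [->|jk] := eqVneq j k; first by rewrite !mutate_matrixr opprK.
rewrite mutate_matrixE // !mutate_matrixl !mutate_matrixr mutate_matrixE //.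
rewrite !oppr_gt0 !oppr_lt0.
case: (ltgtP 0 (B i k)) => [a|a|a]; case: (ltgtP 0 (B k j)) => [b|b|b] //=; ring.
Qed.

End MatrixMutation.

(** * Finite type bounds the weights by 3 *)

(* phi is the graph of a homomorphism from a local subring of F to the
   rationals. *)
Record is_place (F : fieldType) (phi : F -> rat -> Prop) : Prop := IsPlace {
  place_fun : forall f r r', phi f r -> phi f r' -> r = r';
  place1 : phi 1 1;
  placeD : forall f g r s, phi f r -> phi g s -> phi (f + g) (r + s);
  placeM : forall f g r s, phi f r -> phi g s -> phi (f * g) (r * s);
  placeV : forall f r, r != 0 -> phi f r -> phi f^-1 r^-1
}.

(* A consequence of algebraic independence that is easily seen to survive
   mutation, since prescribing values of the mutated cluster amounts to
   prescribing values of the original one. *)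
Definition has_places (n : nat) (x : 'I_n -> ratfun n) : Prop :=
  forall v : 'I_n -> rat, (forall i, 0 < v i) ->
    exists2 phi, is_place phi & forall i, phi (x i) (v i).

Section Places.
Variable n : nat.
Implicit Type B : 'M[int]_n.

(** The place is evaluation at [v] on fractions of polynomials in [x] whose denominator does not
    vanish at [v]. Algebraic independence makes the value well defined and keeps these denominators
    nonzero in the field. *)
Lemma free_has_places (x : 'I_n -> ratfun n) :
  (forall p : {mpoly rat[n]}, ratfun_eval x p = 0 -> p = 0) -> has_places x.
Proof.
move=> x_free v v_gt0.
pose E : {rmorphism {mpoly rat[n]} -> ratfun n} :=
  mmap (@tofrac {mpoly rat[n]} \o @mpolyC n rat) x.
have E_inj p : E p = 0 -> p = 0 by exact: x_free.
have E_neq0 p : p.@[v] != 0 -> E p != 0.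
  by apply: contra_neq => /E_inj ->; rewrite meval0.
exists (fun f r => exists p q,
  [/\ q.@[v] != 0, f = E p / E q & r = p.@[v] / q.@[v]]); last first.
  move=> i; exists 'X_i, 1.
  rewrite !rmorph1 mevalXU !divr1 oner_neq0; split=> //.
  by rewrite /= mmapX mmap1U.
split.
- move=> f r r' [p [q [q0 -> ->]]] [p' [q' [q'0 + ->]]].
  move/eqP; rewrite eqr_div ?E_neq0 // -!rmorphM -subr_eq0 -rmorphB.
  move=> /eqP/E_inj/eqP; rewrite subr_eq0 => /eqP/(congr1 (meval v)).
  by rewrite !mevalM => h; apply/eqP; rewrite eqr_div //; apply/eqP.
- by exists 1, 1; rewrite !rmorph1 !divr1 oner_neq0.
- move=> f g r s [p [q [q0 -> ->]]] [p' [q' [q'0 -> ->]]].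
  exists (p * q' + p' * q), (q * q').
  rewrite !rmorphD !rmorphM mulf_neq0 //.
  by rewrite !addf_div ?E_neq0.
- move=> f g r s [p [q [q0 -> ->]]] [p' [q' [q'0 -> ->]]].
  by exists (p * p'), (q * q'); rewrite !rmorphM mulf_neq0 // !mulf_div.
- move=> f r r0 [p [q [q0 -> rE]]].
  have p0 : p.@[v] != 0 by move: r0; rewrite rE mulf_eq0 => /norP[].
  by exists q, p; rewrite !invf_div rE invf_div.
Qed.

Section Place.
Variables (F : fieldType) (phi : F -> rat -> Prop).
Hypothesis phiP : is_place phi.

Lemma place_exp f r m : phi f r -> phi (f ^+ m) (r ^+ m).
Proof.
move=> fr; elim: m => [|m IH]; first exact: place1.
by rewrite !exprS; apply: placeM.
Qed.

Lemma place_exprz f r (m : int) : 0 <= m -> phi f r -> phi (f ^ m) (r ^ m).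
Proof. by case: m => // m _; apply: place_exp. Qed.

Lemma place_prod (P : pred 'I_n) (f : 'I_n -> F) r :
  (forall i, P i -> phi (f i) (r i)) ->
  phi (\prod_(i | P i) f i) (\prod_(i | P i) r i).
Proof.
move=> fr; elim/big_ind2: _ => //; first exact: place1.
by move=> *; apply: placeM.
Qed.

End Place.

(* The values taken by the mutated cluster at a place where the cluster takes
   the values v. *)
Definition mutate_values (F : fieldType) (k : 'I_n) (B : 'M[int]_n)
    (v : 'I_n -> F) (j : 'I_n) : F :=
  if j == k then
    (\prod_(i | 0 < B i k) v i ^ B i k +
     \prod_(i | B i k < 0) v i ^ (- B i k)) / v k
  else v j.

Lemma mutate_clusterE k B (x : {ffun 'I_n -> ratfun n}) j :
  mutate_cluster k B x j = mutate_values k B x j.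
Proof. by rewrite ffunE. Qed.

Lemma mutate_values_gt0 k B (v : 'I_n -> rat) j :
  (forall i, 0 < v i) -> 0 < mutate_values k B v j.
Proof.
move=> v0; rewrite /mutate_values; case: ifP => // _.
by rewrite divr_gt0 // addr_gt0 // prodr_gt0 // => i _; rewrite exprz_gt0.
Qed.

(** Since [B k k = 0], the exchange binomial does not involve the value at [k], so dividing it by
    that value is an involution. *)
Lemma mutate_valuesK k B (v : 'I_n -> rat) j : B k k = 0 ->
  (forall i, 0 < v i) -> mutate_values k B (mutate_values k B v) j = v j.
Proof.
move=> Bkk v0; rewrite {1}/mutate_values.
case: eqP => [->|/eqP/negPf jk]; last by rewrite /mutate_values jk.
have E (P : pred int) (e : int -> int) : P 0 = false ->
    \prod_(i | P (B i k)) mutate_values k B v i ^ e (B i k) =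
    \prod_(i | P (B i k)) v i ^ e (B i k).
  move=> P0; apply: eq_bigr => i Pi; rewrite /mutate_values.
  by case: eqP Pi => // ->; rewrite Bkk P0.
rewrite (E (fun z => 0 < z) id) // (E (fun z => z < 0) -%R) //.
rewrite /mutate_values eqxx invf_div mulrC divfK //.
rewrite gt_eqF // addr_gt0 // prodr_gt0 // => i _; rewrite exprz_gt0 //.
Qed.

Lemma place_mutate (phi : ratfun n -> rat -> Prop) k B
    (x : {ffun 'I_n -> ratfun n}) (v : 'I_n -> rat) j : is_place phi ->
  (forall i, 0 < v i) -> (forall i, phi (x i) (v i)) ->
  phi (mutate_cluster k B x j) (mutate_values k B v j).
Proof.
move=> phiP v0 xv; rewrite mutate_clusterE /mutate_values.
case: ifP => // _; apply: placeM (placeV _ _ _) => //; last by rewrite gt_eqF.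
by apply: placeD => //; apply: place_prod => // i Bi; apply: place_exprz => //;
  rewrite ?oppr_ge0 ltW.
Qed.

Lemma mutate_has_places k B (x : {ffun 'I_n -> ratfun n}) :
  B k k = 0 -> has_places x -> has_places (mutate_cluster k B x).
Proof.
move=> Bkk xP v v0.
have [i|phi phiP phix] := xP (mutate_values k B v).
  exact: mutate_values_gt0.
exists phi => // i; rewrite -[v i](@mutate_valuesK k B) //.
by apply: place_mutate => // j; apply: mutate_values_gt0.
Qed.

End Places.

Section FiniteType.
Variable n : nat.
Implicit Types (B : 'M[int]_n) (s : seed n) (ks : seq 'I_n).

Definition mutations B ks : 'M[int]_n :=
  foldl (fun B' k => mutate_matrix k B') B ks.

(** The 2-finiteness of Fomin and Zelevinsky; it is the only consequence of finite type on which the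
    rest relies. *)
Definition two_finite B : Prop :=
  forall ks i j, (absz (mutations B ks i j * mutations B ks j i)%R <= 3)%N.

Lemma mutations_skew B ks :
  skew_symmetrisable B -> skew_symmetrisable (mutations B ks).
Proof. by elim: ks B => //= k ks IH B /(@mutate_skew _ k)/IH. Qed.

Lemma exchange_foldl s ks :
  exchange (foldl (@mutate n) s ks) = mutations (exchange s) ks.
Proof. by elim: ks s => //= k ks IH s; rewrite IH. Qed.

Lemma foldl_has_places s ks : skew_symmetrisable (exchange s) ->
  has_places (cluster s) -> has_places (cluster (foldl (@mutate n) s ks)).
Proof.
elim: ks s => //= k ks IH s skB sP; apply: IH; first exact: mutate_skew.
by apply: mutate_has_places => //; apply: skew_diag.
Qed.

Lemma relabel1 s : relabel 1 s = s.
Proof.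
case: s => x B; congr Seed; first by apply/ffunP => i; rewrite ffunE perm1.
by apply/matrixP => i j; rewrite mxE !perm1.
Qed.

(** With all other values equal to 1 the exchange binomial sees only [j], and the sign of [B j i]
    merely swaps its two terms. *)
Lemma mutate_values_rank2 B (v : 'I_n -> rat) i j : skew_symmetrisable B ->
  B j i != 0 -> (forall l, l != i -> l != j -> v l = 1) ->
  mutate_values i B v i = (v j ^+ absz (B j i) + 1) / v i.
Proof.
move=> skB Bji vl; rewrite /mutate_values eqxx; congr (_ / _).
have ji : j != i by apply: contra Bji => /eqP->; rewrite (skew_diag skB).
have E (P : pred int) (e : int -> int) : P 0 = false ->
    \prod_(l | P (B l i)) v l ^ e (B l i) =
    if P (B j i) then v j ^ e (B j i) else 1.
  move=> P0; rewrite (bigID (pred1 j)) /=.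
  rewrite [X in _ * X]big1 ?mulr1 => [|l /andP[Pl lj]]; last first.
    rewrite vl ?exp1rz //; apply: contraTneq Pl => ->.
    by rewrite (skew_diag skB) P0.
  case: ifP => Pj.
    by rewrite (big_pred1 j) // => l /=; rewrite andbC; case: eqP => //= ->; rewrite Pj.
  by rewrite big_pred0 // => l /=; rewrite andbC; case: eqP => //= ->; rewrite Pj.
rewrite (E (fun z => 0 < z) id) // (E (fun z => z < 0) -%R) //.
case: (ltgtP (B j i) 0) Bji => // b _.
  by rewrite /= addrC; case: (B j i) b => // m _.
by rewrite /=; case: (B j i) b => // m _.
Qed.

(* Here y, z are the values of two cluster variables and y', z' those after
   mutating at the first and then at the second.  The hypothesis on z ^ b says
   that y < y', and y' ^ 4 <= (z' z) ^ b makes it persist. *)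
Lemma rank2_growth (y z y' z' : rat) (b c : nat) :
  1 <= y -> 0 < z -> (4 <= b * c)%N -> y ^+ 2 < z ^+ b + 1 ->
  y' = (z ^+ b + 1) / y -> z' = (y' ^+ c + 1) / z ->
  [/\ y < y', 0 < z' & y' ^+ 2 < z' ^+ b + 1].
Proof.
move=> y1 z0 bc inv y'E z'E.
have y0 : 0 < y by apply: lt_le_trans y1.
have E1 : y' * y = z ^+ b + 1 by rewrite y'E divfK ?gt_eqF.
have E2 : z' * z = y' ^+ c + 1 by rewrite z'E divfK ?gt_eqF.
have yy' : y < y' by rewrite -(ltr_pM2r y0) E1 -expr2.
have y'1 : 1 <= y' by apply: le_trans y1 (ltW yy').
have z'0 : 0 < z'.
  by rewrite z'E divr_gt0 // addr_gt0 // exprn_gt0 // (lt_trans y0).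
split=> //.
have zb : z ^+ b < y' ^+ 2.
  apply: (@lt_le_trans _ _ (y' * y)); first by rewrite E1 ltrDl.
  by rewrite expr2 ler_pM2l ?(lt_trans y0) // ltW.
have : y' ^+ 4 <= (z' * z) ^+ b.
  apply: le_trans (_ : y' ^+ (b * c) <= _); first exact: ler_weXn2l.
  rewrite mulnC exprM E2; apply: lerXn2r; rewrite ?nnegrE.
  - by rewrite exprn_ge0 // (le_trans _ y'1).
  - by rewrite addr_ge0 // exprn_ge0 // (le_trans _ y'1).
  - by rewrite lerDl.
rewrite exprMn => h; apply: (@lt_trans _ _ (z' ^+ b)); last by rewrite ltrDl.
have y'20 : 0 < y' ^+ 2 by rewrite exprn_gt0 // (lt_le_trans _ y'1).
rewrite -(ltr_pM2r y'20) -exprD /=; apply: le_lt_trans h _.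
by rewrite ltr_pM2l // exprn_gt0.
Qed.

Lemma rank2_unbounded s i j : has_places (cluster s) ->
  skew_symmetrisable (exchange s) ->
  (4 <= absz (exchange s i j * exchange s j i)%R)%N ->
  exists kss : nat -> seq 'I_n,
    injective (fun m => cluster (foldl (@mutate n) s (kss m)) i).
Proof.
move=> sP skB b4.
have [//|phi phiP phi1] := sP (fun=> 1).
pose step (s : seed n) := mutate (mutate s i) j.
pose kss m := flatten (nseq m [:: i; j]).
have kssE m : foldl (@mutate n) s (kss m) = iter m step s.
  elim: m {sP skB b4 phi1} s => // m IH s.
  by rewrite iterSr -IH.
have Bij : exchange s i j != 0 by apply: contraTneq b4 => ->; rewrite mul0r.
have Bji : exchange s j i != 0 by apply: contraTneq b4 => ->; rewrite mulr0.
have ij : i != j by apply: contraNneq Bij => ->; rewrite (skew_diag skB).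
have ji : j != i by rewrite eq_sym.
pose b := absz (exchange s j i); pose c := absz (exchange s i j).
have bc : (4 <= b * c)%N by move: b4; rewrite abszM mulnC.
(* Mutations at [i] and [j] only change the signs of these two entries, so their absolute values are
   kept; the last inequality is the invariant of [rank2_growth], which at the all-ones point reads 1
   < 2. *)
pose good (s : seed n) v :=
  [/\ [/\ skew_symmetrisable (exchange s), absz (exchange s j i) = b &
       absz (exchange s i j) = c], (forall l, phi (cluster s l) (v l)),
     (forall l, l != i -> l != j -> v l = 1) &
     [/\ 1 <= v i, 0 < v j & v i ^+ 2 < v j ^+ b + 1]].
have stepP s1 v : good s1 v -> exists2 v', good (step s1) v' & v i < v' i.
  case=> [[sk1 bE cE] phiv v1 [vi vj inv]].
  have v0 l : 0 < v l.
    have [->|li] := eqVneq l i; first exact: lt_le_trans vi.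
    by have [->|lj] := eqVneq l j => //; rewrite v1.
  have Bji1 : exchange s1 j i != 0 by rewrite -absz_eq0 bE absz_eq0.
  have Bij1 : exchange s1 i j != 0 by rewrite -absz_eq0 cE absz_eq0.
  set B1 := mutate_matrix i (exchange s1).
  pose v' := mutate_values i (exchange s1) v; pose v2 := mutate_values j B1 v'.
  have v'0 l : 0 < v' l by apply: mutate_values_gt0.
  have v'E l : l != i -> v' l = v l by rewrite /v' /mutate_values => /negPf->.
  have v2E l : l != j -> v2 l = v' l by rewrite /v2 /mutate_values => /negPf->.
  have sk2 : skew_symmetrisable B1 by apply: mutate_skew.
  have v'i : v' i = (v j ^+ b + 1) / v i.
    by rewrite /v' (@mutate_values_rank2 _ _ i j) // bE.
  have v2j : v2 j = (v' i ^+ c + 1) / v j.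
    rewrite /v2 (@mutate_values_rank2 _ _ j i) //.
    - by rewrite (v'E j) // /B1 mutate_matrixl abszN cE.
    - by rewrite /B1 mutate_matrixl oppr_eq0.
    - by move=> l lj li; rewrite v'E // v1.
  have [g1 g2 g3] := rank2_growth vi vj bc inv v'i v2j.
  exists v2; last by rewrite v2E.
  split.
  - split; first exact: mutate_skew.
      rewrite -[exchange _]/(mutate_matrix j B1).
      by rewrite mutate_matrixl abszN mutate_matrixr abszN.
    rewrite -[exchange _]/(mutate_matrix j B1).
    by rewrite mutate_matrixr abszN mutate_matrixl abszN.
  - move=> l; apply: place_mutate => // m.
    exact: place_mutate.
  - by move=> l li lj; rewrite v2E // v'E // v1.
  by rewrite v2E //; split=> //; rewrite (le_trans vi) // ltW.
have good0 : good s (fun=> 1).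
  by split=> //; split; rewrite ?expr1n //; lra.
have goodm m : {v | good (iter m step s) v}.
  elim: m => [|m [v gv]]; first by exists (fun=> 1).
  by apply: cid; have [v' gv' _] := stepP _ _ gv; exists v'.
have incr m m' : (m < m')%N -> sval (goodm m) i < sval (goodm m') i.
  have iterP p : sval (goodm p) i < sval (goodm p.+1) i.
    case: (goodm p) => v gv /=; have [v' gv' lt_v] := stepP _ _ gv.
    case: (goodm p.+1) => v2 /= gv2.
    case: gv' gv2 => _ phiv' _ _ [_ phiv2 _ _].
    (* The values chosen for [p.+1] need not be those built by [stepP], but the place is
       single-valued. *)
    by rewrite -(place_fun phiP (phiv' i) (phiv2 i)).
  exact: (homo_ltn lt_trans iterP).
exists kss => m m'; rewrite !kssE => E.
have [_ h _ _] := svalP (goodm m); have [_ h' _ _] := svalP (goodm m').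
have V : sval (goodm m) i = sval (goodm m') i.
  by apply: (place_fun phiP (h i)); rewrite E.
by case: (ltngtP m m') => // /incr; rewrite V ltxx.
Qed.

Lemma finite_type_two_finite s :
  is_seed s -> finite_type s -> two_finite (exchange s).
Proof.
move=> [[s_free _] skB] [N [t tP]] ks i j.
rewrite leqNgt; apply/negP; rewrite -exchange_foldl => b4.
have [||//|kss kss_inj] := @rank2_unbounded (foldl (@mutate n) s ks) i j.
- exact/foldl_has_places/free_has_places.
- by rewrite exchange_foldl; apply: mutations_skew.
(* Finitely many seeds up to relabelling contain at most [N * n] cluster variables, so one more than
   that already contradicts injectivity. *)
have idx m : {p : 'I_N * 'I_n |
    cluster (foldl (@mutate n) (foldl (@mutate n) s ks) (kss m)) i =
    cluster (t p.1) p.2}.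
  apply: cid; have [|a [sigma ->]] := tP
    (foldl (@mutate n) (foldl (@mutate n) s ks) (kss m)).
    by exists (ks ++ kss m), 1%g; rewrite relabel1 foldl_cat.
  by exists (a, sigma i); rewrite ffunE.
pose M := #|{: 'I_N * 'I_n}|.+1.
have /leq_card : injective (fun m : 'I_M => sval (idx m)).
  move=> m m' E; apply/val_inj/kss_inj.
  by rewrite /= (svalP (idx m)) (svalP (idx m')) E.
by rewrite card_ord ltnn.
Qed.

End FiniteType.

(** * Mutation of diagrams *)

Lemma weight123 (x y : int) : 0 < x -> y < 0 -> (absz (x * y)%R <= 3)%N ->
  x = 1 /\ y = -1 \/ x = 1 /\ y = -2 \/ x = 2 /\ y = -1 \/ x = 1 /\ y = -3 \/
  x = 3 /\ y = -1.
Proof.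
move=> x0 y0 w; have {}w : x * - y <= 3 by lia.
have x3 : x <= 3 by apply: le_trans w; rewrite ler_peMr //; lia.
have : x = 1 \/ x = 2 \/ x = 3 by lia.
by move=> [?|[?|?]]; subst x; lia.
Qed.

Section DiagramOfMatrix.
Variable n : nat.
Implicit Types (B : 'M[int]_n) (i j k : 'I_n).

Lemma diagram_ofE B i j :
  diagram_of B i j = if 0 < B i j then absz (B i j * B j i) else 0%N.
Proof. by rewrite mxE. Qed.

Lemma arrowE B i j : skew_symmetrisable B ->
  arrow (diagram_of B) i j = (0 < B i j).
Proof.
move=> skB; rewrite /arrow mxE; case: ifP => // Bij.
have := skew_gt0 skB i j; rewrite Bij; nia.
Qed.

Lemma edge_weightE B i j : skew_symmetrisable B ->
  edge_weight (diagram_of B) i j = absz (B i j * B j i).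
Proof.
move=> skB; rewrite /edge_weight !mxE [B j i * _]mulrC.
have := skew_gt0 skB i j; have := skew_gt0 skB j i.
by case: (ltgtP 0 (B i j)) => Bij; case: (ltgtP 0 (B j i)) => Bji; lia.
Qed.

Lemma joinedE B i j : skew_symmetrisable B ->
  joined (diagram_of B) i j = (B i j != 0).
Proof.
by move=> skB; rewrite /joined !arrowE //; have := skew_gt0 skB j i; lia.
Qed.

Lemma joined_sym (G : diagram n) i j : joined G i j = joined G j i.
Proof. by rewrite /joined orbC. Qed.

Lemma arrow_asym B i j : skew_symmetrisable B ->
  arrow (diagram_of B) i j -> arrow (diagram_of B) j i = false.
Proof.
by move=> skB; rewrite !arrowE //; have := skew_gt0 skB j i; lia.
Qed.

Lemma diagram_asym B i j : skew_symmetrisable B ->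
  arrow (diagram_of B) i j -> diagram_of B j i = 0%N.
Proof.
move=> skB /(arrow_asym skB); rewrite /arrow.
by case: (diagram_of B j i).
Qed.

Lemma joined_irr B i : skew_symmetrisable B -> joined (diagram_of B) i i = false.
Proof. by move=> skB; rewrite joinedE // (skew_diag skB) eqxx. Qed.

Lemma diagram_gt0 B i j : skew_symmetrisable B -> 0 < B i j ->
  diagram_of B i j = absz (B i j * B j i).
Proof. by move=> skB Bij; rewrite mxE Bij. Qed.

Lemma diagram_le0 B i j : B i j <= 0 -> diagram_of B i j = 0%N.
Proof. by move=> Bij; rewrite mxE ltNge Bij. Qed.

Lemma mutate_diagraml B k j : skew_symmetrisable B ->
  diagram_of (mutate_matrix k B) k j = diagram_of B j k.
Proof.
move=> skB; rewrite !diagram_ofE mutate_matrixl mutate_matrixr.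
by rewrite mulrNN oppr_gt0 (skew_lt0 skB) mulrC.
Qed.

Lemma mutate_diagramr B k i : skew_symmetrisable B ->
  diagram_of (mutate_matrix k B) i k = diagram_of B k i.
Proof.
move=> skB; rewrite !diagram_ofE mutate_matrixl mutate_matrixr.
by rewrite mulrNN oppr_gt0 (skew_lt0 skB) mulrC.
Qed.

Lemma mutate_diagram_id B i j k : skew_symmetrisable B -> i != k -> j != k ->
  ~~ (arrow (diagram_of B) i k && arrow (diagram_of B) k j) ->
  ~~ (arrow (diagram_of B) j k && arrow (diagram_of B) k i) ->
  diagram_of (mutate_matrix k B) i j = diagram_of B i j.
Proof.
move=> skB ik jk; rewrite !arrowE // => h h'.
have E a b : a != k -> b != k -> ~~ ((0 < B a k) && (0 < B k b)) ->
    ~~ ((0 < B b k) && (0 < B k a)) -> mutate_matrix k B a b = B a b.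
  move=> ak bk g g'; rewrite mutate_matrixE //.
  rewrite (negPf g) (skew_lt0 skB a) (skew_lt0 skB k) andbC.
  by rewrite (negPf g').
by rewrite !diagram_ofE !E.
Qed.

Lemma mutate_diagram_disjoint B i j k : skew_symmetrisable B ->
  i != k -> j != k ->
  ~~ (joined (diagram_of B) k i && joined (diagram_of B) k j) ->
  diagram_of (mutate_matrix k B) i j = diagram_of B i j.
Proof.
move=> skB ik jk; rewrite /joined => h.
apply: mutate_diagram_id => //; apply: contra h => /andP[-> ->];
  by rewrite !orbT.
Qed.

Section PassThrough.
Variables (B : 'M[int]_n) (i j k : 'I_n).
Hypotheses (skB : skew_symmetrisable B).
Local Notation G := (diagram_of B).
Local Notation G' := (diagram_of (mutate_matrix k B)).
Hypotheses (ik : arrow G i k) (kj : arrow G k j).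

Let Bik : 0 < B i k. Proof. by rewrite -arrowE. Qed.
Let Bkj : 0 < B k j. Proof. by rewrite -arrowE. Qed.
Let Bki : B k i < 0. Proof. by rewrite -(skew_gt0 skB). Qed.
Let Bjk : B j k < 0. Proof. by rewrite -(skew_gt0 skB). Qed.
Let ik' : i != k. Proof. by apply: contraTneq Bik => ->; rewrite (skew_diag skB). Qed.
Let jk' : j != k. Proof. by apply: contraTneq Bjk => ->; rewrite (skew_diag skB). Qed.

Let mutij : mutate_matrix k B i j = B i j + B i k * B k j.
Proof. by rewrite mutate_matrixE // Bik Bkj. Qed.

Let mutji : mutate_matrix k B j i = B j i - B j k * B k i.
Proof. by rewrite mutate_matrixE // (lt_gtF Bjk) Bjk Bki. Qed.

Lemma mutate_diagram_unjoined : ~~ joined G i j ->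
  G' i j = (G i k * G k j)%N /\ G' j i = 0%N.
Proof.
rewrite joinedE // negbK => /eqP Bij.
have /eqP Bji : B j i == 0 by rewrite (skew_eq0 skB) Bij.
have sk' := mutate_skew k skB.
have m : 0 < mutate_matrix k B i j by rewrite mutij Bij add0r mulr_gt0.
split; last by apply: diagram_asym; rewrite ?arrowE.
by rewrite !diagram_gt0 // mutij mutji Bij Bji; nia.
Qed.

(** The path through [k] adds to the existing arrow, so both entries reach absolute value 2. In
    finite type every triangle is therefore cyclically oriented. *)
Lemma mutate_diagram_parallel : arrow G i j ->
  (4 <= edge_weight G' i j)%N.
Proof.
rewrite arrowE // => Bij; have := skew_gt0 skB i j; rewrite Bij => /esym Bji.
rewrite edge_weightE; last exact: mutate_skew.
rewrite mutij mutji.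
have a : 2 <= B i j + B i k * B k j by nia.
have b : B j i - B j k * B k i <= - 2 by nia.
have: 4 <= - ((B i j + B i k * B k j) * (B j i - B j k * B k i)) by nia.
lia.
Qed.

Definition triangle_weights : seq (seq nat) :=
  [:: [:: 1; 1; 1]; [:: 1; 2; 2]; [:: 2; 1; 2]; [:: 2; 2; 1]]%N.

Hypothesis ji : arrow G j i.
Let Bji : 0 < B j i. Proof. by rewrite -arrowE. Qed.
Let Bij : B i j < 0. Proof. by rewrite -(skew_gt0 skB). Qed.

(** The path through [k] cancels the arrow [j -> i], except for the weights 2, 2, 1, where it
    outweighs it and leaves an arrow of weight 1 in the other direction. *)
Lemma mutate_diagram_triangle : [:: G i k; G k j; G j i] \in triangle_weights ->
  G' i j = [&& G i k == 2, G k j == 2 & G j i == 1]%N /\ G' j i = 0%N.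
Proof.
have cyc := skew_cycle3 skB i k j.
rewrite !(diagram_gt0 skB) // /triangle_weights !inE !eqseq_cons !andbT.
rewrite !diagram_ofE mutij mutji.
move: Bik Bkj Bki Bjk Bji Bij cyc.
move: (B i k) (B k j) (B k i) (B j k) (B j i) (B i j) => x y x' y' z z'.
move=> x0 y0 x'0 y'0 z0 z'0 cyc.
move=> abc.
have xw : (absz (x * x')%R <= 3)%N by lia.
have yw : (absz (y * y')%R <= 3)%N by lia.
have zw : (absz (z * z')%R <= 3)%N by lia.
case: (weight123 x0 x'0 xw) => [|[|[|[]]]] [? ?];
case: (weight123 y0 y'0 yw) => [|[|[|[]]]] [? ?];
case: (weight123 z0 z'0 zw) => [|[|[|[]]]] [? ?]; subst; by move: cyc abc.
Qed.

(** Mutation at each vertex changes the opposite edge. There are five pairs of entries per edge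
    ([weight123]); the bound 3 on the new weights together with [skew_cycle3] rejects all
    combinations but those listed. *)
Lemma triangle_weightsP : (forall a b, edge_weight G a b <= 3)%N ->
  (forall l a b, edge_weight (diagram_of (mutate_matrix l B)) a b <= 3)%N ->
  [:: G i k; G k j; G j i] \in triangle_weights.
Proof.
have cyc := skew_cycle3 skB i k j.
move=> le3; have := le3 i k; have := le3 k j; have := le3 j i.
rewrite !(diagram_gt0 skB) // /triangle_weights !inE !eqseq_cons !andbT.
have ij' : i != j by apply: contraTneq Bij => ->; rewrite (skew_diag skB).
move=> iw kw jw le3'; have := le3' k i j; have := le3' i j k; have := le3' j k i.
move: iw kw jw; rewrite !edge_weightE //; try exact: mutate_skew.
rewrite mutij mutji !(mutate_matrixE B) // 1?eq_sym //.
rewrite Bji Bik (lt_gtF Bki) Bki Bij (lt_gtF Bjk) Bkj Bjk /=.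
move: Bik Bkj Bki Bjk Bji Bij cyc.
move: (B i k) (B k j) (B k i) (B j k) (B j i) (B i j) => x y x' y' z z'.
move=> x0 y0 x'0 y'0 z0 z'0 cyc zw yw xw w1 w2 w3.
case: (weight123 x0 x'0 xw) => [|[|[|[]]]] [? ?];
case: (weight123 y0 y'0 yw) => [|[|[|[]]]] [? ?];
case: (weight123 z0 z'0 zw) => [|[|[|[]]]] [? ?]; subst; move: cyc w1 w2 w3 => //.
Qed.

End PassThrough.

End DiagramOfMatrix.

(** * Diagrams whose mutations all have weights at most 3 *)

Section FiniteDiagrams.
Variable n : nat.
Implicit Types (B : 'M[int]_n) (i j k : 'I_n) (c p : seq 'I_n).

Definition tame B : Prop := skew_symmetrisable B /\ two_finite B.

Lemma tame_mutate B k : tame B -> tame (mutate_matrix k B).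
Proof. by move=> [skB fB]; split=> [|ks]; [apply: mutate_skew | apply: (fB (k :: ks))]. Qed.

Lemma tame_mutations B ks : tame B -> tame (mutations B ks).
Proof. by elim: ks B => //= k ks IH B /(@tame_mutate _ k)/IH. Qed.

Lemma tame_le3 B i j : tame B -> (edge_weight (diagram_of B) i j <= 3)%N.
Proof. by move=> [skB fB]; rewrite edge_weightE //; apply: (fB [::]). Qed.

Lemma tame_triangle B i j k : tame B -> arrow (diagram_of B) i k ->
  arrow (diagram_of B) k j -> arrow (diagram_of B) j i ->
  [:: diagram_of B i k; diagram_of B k j; diagram_of B j i]
    \in triangle_weights.
Proof.
move=> tB ik kj ji; have [skB _] := tB.
by apply: triangle_weightsP => // *; apply: tame_le3 => //; apply: tame_mutate.
Qed.

Lemma tame_parallel B i j k : tame B -> arrow (diagram_of B) i k ->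
  arrow (diagram_of B) k j -> arrow (diagram_of B) i j = false.
Proof.
move=> tB ik kj; apply/negP => ij; have [skB _] := tB.
have := mutate_diagram_parallel skB ik kj ij.
by rewrite leqNgt ltnS tame_le3 //; apply: tame_mutate.
Qed.

Lemma mutate_diagram_passE B i j k : tame B -> arrow (diagram_of B) i k ->
  arrow (diagram_of B) k j ->
  diagram_of (mutate_matrix k B) i j =
    (if arrow (diagram_of B) j i then
      nat_of_bool [&& diagram_of B i k == 2, diagram_of B k j == 2
                     & diagram_of B j i == 1]
     else diagram_of B i k * diagram_of B k j)%N /\
  diagram_of (mutate_matrix k B) j i = 0%N.
Proof.
move=> tB ik kj; have [skB _] := tB; case: ifPn => ji.
  by apply: mutate_diagram_triangle => //; apply: tame_triangle.
apply: mutate_diagram_unjoined => //.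
by rewrite /joined (tame_parallel tB ik).
Qed.

(** Entries without a path through [k] do not change. The others follow formulas whose hypotheses,
    no parallel arrow and an allowed triangle, concern the diagram only, so that [B] supplies them
    for [B1]. *)
Lemma diagram_mutate_eq B B1 k : tame B -> skew_symmetrisable B1 ->
  diagram_of B = diagram_of B1 ->
  diagram_of (mutate_matrix k B) = diagram_of (mutate_matrix k B1).
Proof.
move=> tB sk1 E; have [skB _] := tB.
apply/matrixP => i j.
have [->|ik] := eqVneq i k; first by rewrite !mutate_diagraml // E.
have [->|jk] := eqVneq j k; first by rewrite !mutate_diagramr // E.
have pass a b : arrow (diagram_of B) a k -> arrow (diagram_of B) k b ->
    diagram_of (mutate_matrix k B1) a b = diagram_of (mutate_matrix k B) a b /\
    diagram_of (mutate_matrix k B1) b a = diagram_of (mutate_matrix k B) b a.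
  move=> ak kb; have [-> ->] := mutate_diagram_passE tB ak kb.
  have ab := tame_parallel tB ak kb; move: ab.
  case: ifPn => ba; first have tr := tame_triangle tB ak kb ba.
    by move: ak kb ba tr; rewrite E => ak kb ba tr _; apply: mutate_diagram_triangle.
  move: ak kb ba; rewrite E => ak kb ba ab; apply: mutate_diagram_unjoined => //.
  by rewrite /joined ab.
case: (boolP (arrow (diagram_of B) i k && arrow (diagram_of B) k j)).
  by case/andP=> a b; have [-> _] := pass _ _ a b.
case: (boolP (arrow (diagram_of B) j k && arrow (diagram_of B) k i)).
  by case/andP=> a b; have [_ ->] := pass _ _ a b.
move=> h h'; rewrite (mutate_diagram_id skB) //.
by move: h h'; rewrite E => h h'; rewrite mutate_diagram_id.
Qed.

(** This covers mutations of a finite type diagram that are computed from a matrix other than that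
    of the seed. *)
Lemma tame_eq B B1 : tame B -> skew_symmetrisable B1 ->
  diagram_of B = diagram_of B1 -> tame B1.
Proof.
move=> tB sk1 E; split=> // ks.
elim: ks B B1 tB sk1 E => [|k ks IH] B B1 tB sk1 E i j /=.
  by rewrite -edge_weightE // -E tame_le3.
apply: (IH (mutate_matrix k B)); [exact: tame_mutate|exact: mutate_skew|].
exact: diagram_mutate_eq.
Qed.

End FiniteDiagrams.

(** * Chordless cycles *)

Section InducedCycles.
Variables (n : nat) (G : diagram n).
Implicit Types (x y : 'I_n) (c p : seq 'I_n).

(* Chordless cycles of the underlying unoriented graph. *)
Definition induced_cycle c : Prop :=
  [/\ (2 < size c)%N, uniq c & forall x0 i j, (i < j < size c)%N ->
     joined G (nth x0 c i) (nth x0 c j) =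
     (i.+1 == j) || (i == 0%N) && (j.+1 == size c)].

Lemma induced_cycle_rot1 c : induced_cycle c -> induced_cycle (rot 1 c).
Proof.
case: c => [[]//|x p] [s2 Uc adj]; split; rewrite ?size_rot ?rot_uniq //.
move=> x0 i j; rewrite rot1_cons !nth_rcons /=.
case/andP=> ij; rewrite ltnS leq_eqVlt; case/orP=> [/eqP E|jp].
  rewrite E ltnn eqxx -E ij joined_sym; have := adj x0 0%N i.+1.
  by rewrite /= => ->; move: s2 => /=; lia.
rewrite jp (ltn_trans ij jp); have := adj x0 i.+1 j.+1.
by rewrite /= => ->; lia.
Qed.

Lemma induced_cycle_rot m c : induced_cycle c -> induced_cycle (rot m c).
Proof.
move=> cc; elim: m => [|m IH]; first by rewrite rot0.
case: (leqP (size c) m) => [le|lt]; first by rewrite rot_oversize // leqW.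
by rewrite rotS //; apply: induced_cycle_rot1.
Qed.

Lemma induced_cycle_rev c : induced_cycle c -> induced_cycle (rev c).
Proof.
move=> [s2 Uc adj]; split; rewrite ?size_rev ?rev_uniq //.
move=> x0 i j /andP[ij jc]; rewrite !nth_rev ?(ltn_trans ij) //.
by rewrite joined_sym adj; lia.
Qed.

Lemma nth_next x0 c i : uniq c -> (i < size c)%N ->
  next c (nth x0 c i) = nth x0 c (if i.+1 == size c then 0%N else i.+1).
Proof.
case: c => // x p Uc; rewrite ltnS => ip.
rewrite next_nth mem_nth // index_uniq //.
case: eqP => [[->]|/eqP] /=; first by rewrite nth_default.
by rewrite eqSS => ne; rewrite (set_nth_default x) // ltn_neqAle ne.
Qed.

(** Separates the orientation, which is part of [chordless_cycle], from the shape. Adjacency by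
    position turns rotations, reversals and contractions into index computations. *)
Lemma chordless_cycleE c : (forall x, joined G x x = false) ->
  chordless_cycle G c <-> induced_cycle c /\ path.cycle (arrow G) c.
Proof.
move=> irr; split=> [[s2 Uc cyc adj]|[[s2 Uc adj] cyc]]; split=> //.
  split=> // x0 i j /andP[ij jc]; have ic := ltn_trans ij jc.
  have next_adj l : (l < size c)%N ->
      joined G (nth x0 c l) (nth x0 c (if l.+1 == size c then 0%N else l.+1)).
    by move=> lc; rewrite -nth_next // /joined (next_cycle cyc) // mem_nth.
  apply/idP/idP => [/adj|].
    rewrite !mem_nth // !nth_next // => /(_ isT isT).
    have lt l : (l < size c)%N -> ((if l.+1 == size c then 0%N else l.+1) < size c)%N.
      by case: eqP; lia.
    by rewrite !nth_uniq ?lt //; do !case: eqP; lia.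
  case/orP=> [/eqP<-|/andP[/eqP-> /eqP jE]].
    by have := next_adj i ic; rewrite ifF //; lia.
  by have := next_adj j jc; rewrite jE eqxx joined_sym.
suff adj_lt x0 i j : (i < j < size c)%N ->
    joined G (nth x0 c i) (nth x0 c j) -> (nth x0 c j == next c (nth x0 c i)) ||
    (nth x0 c i == next c (nth x0 c j)).
  move=> u v uc vc; rewrite -(nth_index u uc) -(nth_index u vc).
  case: (ltngtP (index u c) (index v c)) => [lt|gt|->]; last by rewrite irr.
    by apply: adj_lt; rewrite lt index_mem.
  by rewrite joined_sym orbC; apply: adj_lt; rewrite gt index_mem.
move=> /andP[ij jc]; have ic := ltn_trans ij jc.
have lt l : (l < size c)%N -> ((if l.+1 == size c then 0%N else l.+1) < size c)%N.
  by case: eqP; lia.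
by rewrite adj ?ij // !nth_next // !nth_uniq ?lt //; do !case: eqP; lia.
Qed.

End InducedCycles.

(* The weights allowed, up to rotation, on the chordless cycles of a diagram of
   finite type. *)
Definition cycle_weights (ws : seq nat) : bool :=
  all (pred1 1%N) ws ||
  (ws \in [:: [:: 1; 2; 2]; [:: 2; 1; 2]; [:: 2; 2; 1];
              [:: 1; 2; 1; 2]; [:: 2; 1; 2; 1]]%N).

Lemma cycle_weights_rot m ws : cycle_weights (rot m ws) = cycle_weights ws.
Proof.
have rot1 vs : cycle_weights vs -> cycle_weights (rot 1 vs).
  case/orP=> [h|]; first by rewrite /cycle_weights (eq_all_r (mem_rot 1 vs)) h.
  by rewrite !inE => /or4P[/eqP->|/eqP->|/eqP->|/orP[]/eqP->].
have rotm l vs : cycle_weights vs -> cycle_weights (rot l vs).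
  move=> h; elim: l => [|l IH]; first by rewrite rot0.
  case: (leqP (size vs) l) => [le|lt]; first by rewrite rot_oversize // leqW.
  by rewrite rotS //; apply: rot1.
apply/idP/idP => [h|]; last exact: rotm.
by rewrite -(rotK m ws); apply: rotm.
Qed.

Lemma cycle_weights_gt0 ws : cycle_weights ws -> all (ltn 0) ws.
Proof.
case/orP=> [|]; first by apply: sub_all => w /eqP->.
by rewrite !inE => /or4P[/eqP->|/eqP->|/eqP->|/orP[]/eqP->].
Qed.

Lemma all_le3P (P : pred nat) :
  reflect (forall w, (0 < w <= 3)%N -> P w) (all P [:: 1; 2; 3]%N).
Proof.
apply: (iffP allP) => h w.
  by move=> w3; apply: h; rewrite !inE; lia.
by rewrite !inE => w3; apply: h; lia.
Qed.

Lemma cycle_weights_contract ws :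
  (3 < size ws)%N -> all (fun w => 0 < w <= 3)%N ws ->
  (forall m a t e, rot m ws = a :: rcons t e ->
     cycle_weights (rcons t (e * a)%N)) -> cycle_weights ws.
Proof.
case: ws => [|a [|b [|c [|d ws]]]] // _.
case: ws => [|e ws].
  move=> /= /and5P[a3 b3 c3 d3 _] h; have {h} : [&& cycle_weights [:: b; c; d * a],
      cycle_weights [:: c; d; a * b], cycle_weights [:: d; a; b * c]
    & cycle_weights [:: a; b; c * d]]%N.
    by rewrite (h 0 a [:: b; c] d) ?(h 1 b [:: c; d] a) ?(h 2 c [:: d; a] b)
      ?(h 3 d [:: a; b] c)%N.
  apply/implyP.
  move: d d3; apply/all_le3P; move: c c3; apply/all_le3P.
  move: b b3; apply/all_le3P; move: a a3; apply/all_le3P.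
  by vm_compute.
case: ws => [|f ws].
  move=> /= /and5P[a3 b3 c3 d3 /andP[e3 _]] h.
  have {h} : [&& cycle_weights [:: b; c; d; e * a],
      cycle_weights [:: c; d; e; a * b], cycle_weights [:: d; e; a; b * c]
    & cycle_weights [:: e; a; b; c * d]]%N.
    by rewrite (h 0 a [:: b; c; d] e) ?(h 1 b [:: c; d; e] a)
      ?(h 2 c [:: d; e; a] b) ?(h 3 d [:: e; a; b] c)%N.
  apply/implyP.
  move: e e3; apply/all_le3P; move: d d3; apply/all_le3P; move: c c3.
  apply/all_le3P; move: b b3; apply/all_le3P; move: a a3; apply/all_le3P.
  by vm_compute.
move=> _ h; have := h 0 a (belast b [:: c, d, e, f & ws])%N
  (last b [:: c, d, e, f & ws]).
rewrite rot0 -lastI => /(_ erefl).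
have big v : (4 < size v)%N -> cycle_weights v = all (pred1 1%N) v.
  move=> sv; rewrite /cycle_weights [X in _ || X](_ : _ = false) ?orbF //.
  by apply/negP; rewrite !inE => /or4P[/eqP E|/eqP E|/eqP E|/orP[]/eqP E];
    rewrite E in sv.
rewrite !big //; last by rewrite size_rcons size_belast.
have -> : [:: a, b, c, d, e, f & ws] =
    a :: rcons (belast b [:: c, d, e, f & ws]) (last b [:: c, d, e, f & ws]).
  by rewrite -lastI.
move: (belast b _) (last b _) => t l.
rewrite /= !all_rcons => /andP[/= la ->]; rewrite andbT.
by move: la; rewrite muln_eq1 => /andP[-> ->].
Qed.

Section CycleWeights.
Variables (n : nat).
Implicit Types (G : diagram n) (x y z : 'I_n) (c p q : seq 'I_n).

(** A step against the orientation has weight 0, so positivity of all entries says that the cycle is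
    oriented. The last entry belongs to the closing edge. *)
Definition weights_along G c : seq nat :=
  if c is x :: p then pairmap (fun_of_matrix G) x (rcons p x) else [::].

Lemma weights_along_rot1 G c :
  weights_along G (rot 1 c) = rot 1 (weights_along G c).
Proof.
case: c => // x [|y p]; first by rewrite /= rot1_cons.
by rewrite rot1_cons /= rot1_cons -[rcons _ y]cats1 pairmap_cat last_rcons cats1.
Qed.

Lemma size_weights_along G c : size (weights_along G c) = size c.
Proof. by case: c => // x p; rewrite size_pairmap size_rcons. Qed.

Lemma weights_along_rot G m c :
  weights_along G (rot m c) = rot m (weights_along G c).
Proof.
elim: m => [|m IH]; first by rewrite !rot0.
case: (leqP (size c) m) => [le|lt].
  by rewrite !rot_oversize ?size_weights_along ?leqW.
by rewrite (rotS lt) weights_along_rot1 IH -rotS ?size_weights_along.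
Qed.

Lemma weights_along_gt0 G c :
  all (ltn 0%N) (weights_along G c) = path.cycle (arrow G) c.
Proof.
case: c => // x p /=; move: (rcons p x) => s; elim: s x => //= y s IH x.
by rewrite IH.
Qed.

Lemma weights_along_cons G x y q z :
  weights_along G (x :: y :: rcons q z) =
  G x y :: rcons (pairmap (fun_of_matrix G) y (rcons q z)) (G z x).
Proof. by rewrite /= -cats1 pairmap_cat last_rcons cats1. Qed.

Lemma nth_weights_along x0 G c i : (i < size c)%N ->
  nth 0%N (weights_along G c) i =
  G (nth x0 c i) (nth x0 c (if i.+1 == size c then 0%N else i.+1)).
Proof.
case: c => // x p ip; rewrite (nth_pairmap x0) ?size_rcons //.
rewrite -rcons_cons !nth_rcons ip.
rewrite /= eqSS; congr (G _ _); move: ip => /=; rewrite ltnS.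
by case: ltngtP => //.
Qed.

End CycleWeights.

(** * Shrinking a chordless cycle by mutation at one of its vertices *)

Section CycleTheorem.
Variable n : nat.
Implicit Types (B : 'M[int]_n) (G : diagram n) (x y z : 'I_n) (c p q : seq 'I_n).

Lemma eq_induced_cycle G1 G2 c :
  {in c &, forall u v, joined G1 u v = joined G2 u v} ->
  induced_cycle G1 c -> induced_cycle G2 c.
Proof.
move=> E [s2 Uc adj]; split=> // x0 i j /andP[ij jc].
by rewrite -E ?adj ?ij ?jc // mem_nth // (ltn_trans ij).
Qed.

Lemma eq_weights_along G1 G2 c :
  {in c &, G1 =2 G2} -> weights_along G1 c = weights_along G2 c.
Proof.
case: c => // x p E; apply: (@eq_from_nth _ 0%N).
  by rewrite !size_weights_along.
move=> i; rewrite size_weights_along => ip.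
rewrite !(nth_weights_along x) // E // mem_nth //.
by case: eqP ip => //= ne; rewrite !ltnS leq_eqVlt; case: eqP => // ip; case: ne; rewrite ip.
Qed.

Lemma induced_cycle_joined G x p u : induced_cycle G (x :: p) -> u \in p ->
  joined G x u = (u == head x p) || (u == last x p).
Proof.
move=> [s2 /= /andP[xp Up] adj] up.
have ip : (index u p < size p)%N by rewrite index_mem.
have := adj x 0%N (index u p).+1; rewrite /= ltnS ip nth_index // => -> //.
have -> : (u == head x p) = (index u p == 0%N).
  by rewrite -{1}(nth_index x up) -nth0 nth_uniq // (leq_ltn_trans _ ip).
have -> : (u == last x p) = (index u p == (size p).-1).
  by rewrite -{1}(nth_index x up) -nth_last nth_uniq // ltn_predL (leq_ltn_trans _ ip).
by rewrite !eqSS [(0 == _)%N]eq_sym; case: (p) ip => //= ? ? _; rewrite eqSS.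
Qed.

Lemma induced_cycle_neq G x p u : induced_cycle G (x :: p) -> u \in p -> u != x.
Proof. by move=> [_ /= /andP[xp _] _] up; apply: contraNneq xp => <-. Qed.

Section Contract.
Variables (B : 'M[int]_n) (x y z : 'I_n) (q : seq 'I_n).
Hypothesis tB : tame B.
Local Notation G := (diagram_of B).
Local Notation G' := (diagram_of (mutate_matrix x B)).
Hypothesis cG : induced_cycle G (x :: y :: rcons q z).
Hypothesis q_gt0 : (0 < size q)%N.

Let skB : skew_symmetrisable B. Proof. by case: tB. Qed.

(** On the cycle [x] is joined only to [y] and [z], so this is the only pair that the mutation can
    change. *)
Lemma contract_agree u v : u \in y :: rcons q z -> v \in y :: rcons q z ->
  ~~ ((u == y) && (v == z)) -> ~~ ((u == z) && (v == y)) -> G' u v = G u v.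
Proof.
move=> up vp uv vu; have ux := induced_cycle_neq cG up.
have vx := induced_cycle_neq cG vp.
have [->|ne] := eqVneq u v.
  by rewrite !diagram_le0 ?(skew_diag skB) ?(skew_diag (mutate_skew x skB)).
apply: mutate_diagram_disjoint => //.
rewrite !(induced_cycle_joined cG) //= last_rcons.
by move: uv vu ne; do 4!case: eqP => // ?; subst; rewrite ?eqxx.
Qed.

Lemma contract_pairmap :
  pairmap (fun_of_matrix G') y (rcons q z) = pairmap (fun_of_matrix G) y (rcons q z).
Proof.
apply: (@eq_from_nth _ 0%N) => [|i]; rewrite !size_pairmap // size_rcons => iq.
have [_ /= /andP[_ Up] _] := cG.
have Up' : uniq (y :: rcons q z) by [].
rewrite !(nth_pairmap x) ?size_rcons // contract_agree //.
- by apply: mem_nth; rewrite /= size_rcons ltnW.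
- by rewrite inE mem_nth ?size_rcons ?orbT.
- rewrite -[X in _ == X]/(nth x (y :: rcons q z) 0) nth_uniq //=; last first.
    by rewrite size_rcons ltnW.
  have zE : z = nth x (rcons q z) (size q) by rewrite nth_rcons ltnn eqxx.
  rewrite [X in _ && (_ == X)]zE.
  by rewrite nth_uniq ?size_rcons //; last (by case/andP: Up); lia.
by apply/negP => /andP[_ /eqP E]; move: Up' => /= /andP[/negP[]]; rewrite -E mem_nth ?size_rcons.
Qed.

Hypotheses (zx : arrow G z x) (xy : arrow G x y).

Let zy : ~~ joined G z y.
Proof.
have [_ _ adj] := cG; rewrite joined_sym.
have := adj x 1%N (size q).+2; rewrite /= size_rcons nth_rcons ltnn eqxx => ->; lia.
Qed.

Lemma contract_last : G' z y = (G z x * G x y)%N /\ G' y z = 0%N.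
Proof. exact: mutate_diagram_unjoined. Qed.

Lemma contract_induced_cycle : induced_cycle G' (y :: rcons q z).
Proof.
have [E1 E2] := contract_last; have [s2 /= /andP[xp Up] adj] := cG.
split=> [||x0 i j /andP[ij jp]] //; first by rewrite /= size_rcons; lia.
have ip := ltn_trans ij jp.
have [/andP[/eqP i0 /eqP jE]|ne] := boolP ((i == 0%N) && (j.+1 == size (y :: rcons q z))).
  rewrite i0 (_ : j = size (rcons q z)); last by move: jE => /= [].
  rewrite [nth _ _ (size _)]nth_last /= last_rcons /joined /arrow E1 E2.
  by move: zx xy; rewrite /arrow size_rcons => ? ?; rewrite muln_gt0; lia.
have Up' : uniq (y :: rcons q z) by [].
have ny l : (l < size (y :: rcons q z))%N ->
    (nth x0 (y :: rcons q z) l == y) = (l == 0%N).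
  by move=> ls; rewrite -[X in _ == X]/(nth x0 (y :: rcons q z) 0) nth_uniq.
have nz l : (l < size (y :: rcons q z))%N ->
    (nth x0 (y :: rcons q z) l == z) = (l.+1 == size (y :: rcons q z)).
  move=> ls; have zE : z = nth x0 (y :: rcons q z) (size (rcons q z)).
    by rewrite nth_last /= last_rcons.
  by rewrite [X in _ == X]zE nth_uniq.
have := adj x0 i.+1 j.+1; rewrite /= ltnS ij ltnS jp => /(_ isT) E.
rewrite -eqSS -E /joined /arrow.
by rewrite !contract_agree ?mem_nth // !ny // !nz //; lia.
Qed.

Lemma contract_weights : weights_along G' (y :: rcons q z) =
  rcons (pairmap (fun_of_matrix G) y (rcons q z)) (G z x * G x y)%N.
Proof.
have [E1 E2] := contract_last.
by rewrite /= -[rcons (rcons _ _) _]cats1 pairmap_cat /= last_rcons E1 cats1 contract_pairmap.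
Qed.

End Contract.

End CycleTheorem.

Section TameCycles.
Variable n : nat.
Implicit Types (B : 'M[int]_n) (x y z : 'I_n) (c p q : seq 'I_n).

Lemma triangle_weights_cycle ws : ws \in triangle_weights -> cycle_weights ws.
Proof. by rewrite !inE => /or4P[] /eqP->. Qed.

Lemma weights_along_le3 B c : tame B ->
  all (fun w => w <= 3)%N (weights_along (diagram_of B) c).
Proof.
move=> tB; apply/(all_nthP 0%N) => i; rewrite size_weights_along => ic.
case: c ic => // x p ic; rewrite (nth_weights_along x) //.
by apply: leq_trans (tame_le3 _ _ tB); apply: leq_addr.
Qed.

Lemma tame_cycle3 B x y z : tame B ->
  induced_cycle (diagram_of B) [:: x; y; z] ->
  cycle_weights (weights_along (diagram_of B) [:: x; y; z]) \/
  cycle_weights (weights_along (diagram_of B) [:: z; y; x]).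
Proof.
move=> tB [_ _ adj]; have [skB _] := tB.
move: (adj x 0 1 isT)%N (adj x 0 2 isT)%N (adj x 1 2 isT)%N => /=.
set G := diagram_of B; have par := tame_parallel tB.
case/orP=> xy; case/orP=> xz; case/orP=> yz.
- by rewrite (par _ _ _ xy yz) in xz.
- by rewrite (par _ _ _ xz yz) in xy.
- by left; apply/triangle_weights_cycle/tame_triangle.
- by rewrite (par _ _ _ xz xy) in yz.
- by rewrite (par _ _ _ xy xz) in yz.
- by right; apply/triangle_weights_cycle/tame_triangle.
- by rewrite (par _ _ _ yz xz) in xy.
- by rewrite (par _ _ _ yz xy) in xz.
Qed.

(** The contracted cycle has the arrow [z -> y], so the induction hypothesis can only hold in that
    direction. All its other arrows, which are those of the original cycle, then point the same way
    as the two at [x]. *)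
Lemma tame_cycle_pass B x y z q : tame B ->
  (forall B' c, size c = (size q).+2 -> tame B' -> induced_cycle (diagram_of B') c ->
     cycle_weights (weights_along (diagram_of B') c) \/
     cycle_weights (weights_along (diagram_of B') (rev c))) ->
  (0 < size q)%N -> induced_cycle (diagram_of B) (x :: y :: rcons q z) ->
  arrow (diagram_of B) z x -> arrow (diagram_of B) x y ->
  path.cycle (arrow (diagram_of B)) (x :: y :: rcons q z) /\
  cycle_weights (rcons (pairmap (fun_of_matrix (diagram_of B)) y (rcons q z))
    (diagram_of B z x * diagram_of B x y)%N).
Proof.
move=> tB IH q0 cG zx xy.
have cG' := contract_induced_cycle tB cG q0 zx xy.
have [_ yz0] := contract_last tB cG q0 zx xy.
have [||] := IH _ (y :: rcons q z) _ (tame_mutate x tB) cG'.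
- by rewrite /= size_rcons.
- rewrite (contract_weights tB cG q0 zx xy) => gw; split=> //.
  have := cycle_weights_gt0 gw; rewrite all_rcons => /andP[_ h].
  rewrite -weights_along_gt0 weights_along_cons /= all_rcons h.
  by rewrite !andbT; apply/andP.
move/cycle_weights_gt0; rewrite rev_cons rev_rcons rcons_cons.
by rewrite /= -[rcons (rcons _ _) z]cats1 pairmap_cat last_rcons /= yz0 all_cat
  /= andbF.
Qed.

Lemma cycle_weights_rev_rot B m c :
  cycle_weights (weights_along (diagram_of B) (rev (rot m c))) =
  cycle_weights (weights_along (diagram_of B) (rev c)).
Proof. by rewrite rev_rot /rotr weights_along_rot cycle_weights_rot. Qed.

(** In an oriented cycle every vertex can be contracted, as [cycle_weights_contract] requires. *)
Lemma oriented_cycle_weights B c : tame B ->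
  (forall B' c', (size c').+1 = size c -> tame B' ->
     induced_cycle (diagram_of B') c' ->
     cycle_weights (weights_along (diagram_of B') c') \/
     cycle_weights (weights_along (diagram_of B') (rev c'))) ->
  (3 < size c)%N -> induced_cycle (diagram_of B) c ->
  path.cycle (arrow (diagram_of B)) c ->
  cycle_weights (weights_along (diagram_of B) c).
Proof.
move=> tB IH s3 cG or.
apply: cycle_weights_contract; first by rewrite size_weights_along.
  have := weights_along_le3 c tB; move: or; rewrite -weights_along_gt0.
  by move=> h h'; apply/allP => w wc; rewrite (allP h' _ wc) andbT; apply: (allP h).
move=> m a t e; rewrite -weights_along_rot.
have := induced_cycle_rot m cG; move: or; rewrite -(rot_cycle m).
move: s3 IH; rewrite -(size_rot m c).
case: (rot m c) => [|x [|y p]] //; case/lastP: p => // q z s3 IH or cG'.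
rewrite weights_along_cons => -[<-] /rcons_inj[<- <-].
move: or => /=; rewrite rcons_path last_rcons => /and3P[xy _ zx].
have [||] // := tame_cycle_pass tB _ _ cG' zx xy.
  by move=> B' c' sc'; apply: IH; rewrite sc' /= size_rcons.
by move: s3; rewrite /= size_rcons.
Qed.

Lemma induced_cycle_split G c : @induced_cycle n G c ->
  exists x y q z, c = x :: y :: rcons q z.
Proof.
case: c => [|x [|y p]] [] //; case/lastP: p => // q z _ _ _.
by exists x, y, q, z.
Qed.

Theorem tame_cycle B c : tame B -> induced_cycle (diagram_of B) c ->
  cycle_weights (weights_along (diagram_of B) c) \/
  cycle_weights (weights_along (diagram_of B) (rev c)).
Proof.
have [d] := ubnP (size c); elim: d => // d IHd in B c *; rewrite ltnS => cd tB cG.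
have [s3|s3] := ltnP 3 (size c); last first.
  have [s2 _ _] := cG; have sc : size c = 3 by apply/eqP; rewrite eqn_leq s3.
  case: c sc cG {cd s2 s3} => [|x [|y [|z []]]] // _ cG.
  exact: tame_cycle3.
have {IHd} IH B' c' : (size c').+1 = size c -> tame B' ->
    induced_cycle (diagram_of B') c' ->
    cycle_weights (weights_along (diagram_of B') c') \/
    cycle_weights (weights_along (diagram_of B') (rev c')).
  by move=> E; apply: IHd; rewrite E.
have [skB _] := tB.
have pass (B' : 'M[int]_n) m x y z q : tame B' -> induced_cycle (diagram_of B') c ->
    rot m c = x :: y :: rcons q z ->
    (arrow (diagram_of B') z x && arrow (diagram_of B') x y) ||
    (arrow (diagram_of B') y x && arrow (diagram_of B') x z) ->
    cycle_weights (weights_along (diagram_of B') c) \/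
    cycle_weights (weights_along (diagram_of B') (rev c)).
  move=> tB' cG' mc.
  have sq : (size q).+3 = size c.
    by rewrite -(size_rot m c) mc /= size_rcons.
  have IH' B1 c1 : size c1 = (size q).+2 -> tame B1 ->
      induced_cycle (diagram_of B1) c1 ->
      cycle_weights (weights_along (diagram_of B1) c1) \/
      cycle_weights (weights_along (diagram_of B1) (rev c1)).
    by move=> s1; apply: IH; rewrite s1.
  have q0 : (0 < size q)%N by rewrite -sq in s3.
  case/orP=> /andP[a b].
    left; apply: oriented_cycle_weights => //.
    rewrite -(rot_cycle m) mc.
    by apply: (tame_cycle_pass tB' IH' q0 _ a b).1; rewrite -mc; apply: induced_cycle_rot.
  right.
  (* Reversal sends [x] to the end; rotating by one less than the length brings it back to the
     front. *)
  have revc : rot (size c).-1 (rev (rot m c)) = x :: z :: rcons (rev q) y.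
    rewrite mc rev_cons rev_cons rev_rcons.
    rewrite -cats1 /= (_ : (size c).-1 = size (z :: rcons (rev q) y)) ?rot_size_cat //.
    by rewrite /= size_rcons size_rev -sq.
  have cG1 : induced_cycle (diagram_of B') (x :: z :: rcons (rev q) y).
    by rewrite -revc; apply/induced_cycle_rot/induced_cycle_rev/induced_cycle_rot.
  rewrite -(cycle_weights_rev_rot _ m) -(cycle_weights_rot (size c).-1).
  rewrite -weights_along_rot revc; apply: oriented_cycle_weights => //.
  - by move=> B1 c1 s1; apply: IH; rewrite s1 -sq /= size_rcons size_rev.
  - by rewrite /= size_rcons size_rev sq.
  apply: (tame_cycle_pass tB' _ _ cG1 _ _).1; rewrite ?size_rev //.
have [x [y [q [z cE]]]] := induced_cycle_split cG.
have [//|h] := boolP ((arrow (diagram_of B) z x && arrow (diagram_of B) x y) ||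
    (arrow (diagram_of B) y x && arrow (diagram_of B) x z)).
  by apply: (pass B 0%N x y z q); rewrite ?rot0.
(* x is a source or a sink of the cycle: mutating there only reverses its two
   edges, so that y becomes a pass-through vertex, unless it already was. *)
have adj_x u : u \in y :: rcons q z ->
    joined (diagram_of B) x u = (u == y) || (u == z).
  move: cG; rewrite cE => cG' up.
  by rewrite (induced_cycle_joined cG' up) /= last_rcons.
have xy : joined (diagram_of B) x y by rewrite adj_x ?mem_head // eqxx.
have xz : joined (diagram_of B) x z.
  by rewrite adj_x ?inE ?mem_rcons ?mem_head ?eqxx ?orbT.
have asym u v := arrow_asym (i := u) (j := v) skB.
have inout : (forall u, u \in y :: rcons q z -> ~~ arrow (diagram_of B) u x) \/
    (forall u, u \in y :: rcons q z -> ~~ arrow (diagram_of B) x u).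
  move: h; case/orP: xy => [|] a; case/orP: xz => [|] b; rewrite a b /= ?orbT // => _.
    left=> u up; apply/negP => ux.
    have : joined (diagram_of B) x u by rewrite /joined ux orbT.
    by rewrite adj_x // => /orP[] /eqP E; move: ux; rewrite E asym.
  right=> u up; apply/negP => ux.
  have : joined (diagram_of B) x u by rewrite /joined ux.
  by rewrite adj_x // => /orP[] /eqP E; move: ux; rewrite E asym.
pose B1 := mutate_matrix x B; have tB1 : tame B1 by apply: tame_mutate.
have neq_x u : u \in y :: rcons q z -> u != x.
  by move: cG; rewrite cE => cG'; apply: induced_cycle_neq cG'.
have agree : {in y :: rcons q z &, diagram_of B1 =2 diagram_of B}.
  move=> u v up vp; rewrite mutate_diagram_id ?neq_x //; apply/negP => /andP[a b].
    by case: inout => [/(_ u up)|/(_ v vp)]; rewrite ?a ?b.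
  by case: inout => [/(_ v vp)|/(_ u up)]; rewrite ?a ?b.
have flip u : diagram_of B1 x u = diagram_of B u x by rewrite mutate_diagraml.
have flip' u : diagram_of B1 u x = diagram_of B x u by rewrite mutate_diagramr.
have cG1 : induced_cycle (diagram_of B1) c.
  apply: eq_induced_cycle cG; rewrite cE => u v.
  rewrite inE => /orP[/eqP->|up]; rewrite inE => /orP[/eqP->|vp].
  - by rewrite !joined_irr //; case: tB1.
  - by rewrite /joined /arrow flip flip' orbC.
  - by rewrite /joined /arrow flip flip' orbC.
  - by rewrite /joined /arrow !agree.
have [w [r qE]] : exists w r, q = w :: r.
  by case: (q) s3 cE => [s3 E|w r]; [rewrite E in s3|exists w, r].
have c1 : rot 1 c = y :: w :: rcons (rcons r z) x by rewrite cE rot1_cons qE.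
have wp : w \in y :: rcons q z by rewrite qE !inE eqxx orbT.
have yp : y \in y :: rcons q z by rewrite mem_head.
have yw : joined (diagram_of B) y w.
  have [_ _ /(_ y 1 2)%N] := cG.
  by rewrite cE qE /= => ->.
have [py|npy] := boolP
    ((arrow (diagram_of B) x y && arrow (diagram_of B) y w) ||
     (arrow (diagram_of B) w y && arrow (diagram_of B) y x)).
  by apply: pass c1 _ => //; rewrite [X in _ || X]andbC.
(* Now [y] is passed through in [B1], so the cycle is oriented there. Then [x] is passed through in
   [B1], and in [B] too since both its edges were reversed, against [h]. *)
have [|/cycle_weights_gt0|/cycle_weights_gt0] :=
  pass B1 1%N y w x (rcons r z) tB1 cG1 c1.
- rewrite /arrow flip flip' !agree // -!/(arrow _ _ _).
  move: npy; case/orP: xy => a; case/orP: yw => b; rewrite a b ?orbT //=.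
- rewrite weights_along_gt0 cE /= rcons_path last_rcons /arrow flip flip'.
  by move=> /and3P[a _ b]; case/negP: h; rewrite /arrow a b orbT.
rewrite weights_along_gt0 rev_cycle cE /= rcons_path last_rcons /arrow flip flip'.
by move=> /and3P[a _ b]; case/negP: h; rewrite /arrow a b.
Qed.

End TameCycles.

(** * Relations between involutions *)

Section GroupLemmas.
Local Open Scope group_scope.
Variable H : groupType.
Implicit Types (a b c x y : H).

Lemma commuteJ a x y : commute (x ^ a) (y ^ a) <-> commute x y.
Proof.
by rewrite /commute -!conjMg; split=> [/conjg_inj|->].
Qed.

Lemma involV a : a * a = 1 -> a^-1 = a.
Proof. by move/mulg1_eq. Qed.

Lemma conj_invol a x : a * a = 1 -> (x ^ a) ^ a = x.
Proof. by move=> aa; rewrite -conjgM aa conjg1. Qed.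

Lemma involJ a x : a * a = 1 -> a ^ x * a ^ x = 1.
Proof. by move=> aa; rewrite -conjMg aa conj1g. Qed.

Lemma commuteJl a x y : a * a = 1 -> commute (x ^ a) y <-> commute x (y ^ a).
Proof. by move=> aa; rewrite -(commuteJ a) conj_invol. Qed.

Lemma conj_commute x a : commute x a -> x ^ a = x.
Proof. by move=> xa; rewrite conjgE xa mulKg. Qed.

Lemma conjg_comm x a b : commute a b -> (x ^ a) ^ b = (x ^ b) ^ a.
Proof. by move=> ab; rewrite -!conjgM ab. Qed.

Lemma conj_conj x a b : b * b = 1 -> x ^ (a ^ b) = ((x ^ b) ^ a) ^ b.
Proof. by move=> bb; rewrite -!conjgM [a ^ b]conjgE involV // !mulgA. Qed.

Lemma expgJ_eq1 a x m : ((x ^ a) ^+ m = 1) <-> (x ^+ m = 1).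
Proof.
by rewrite -conjXg; split=> [/eqP|->]; [rewrite conjg_eq1 => /eqP | rewrite conj1g].
Qed.

Lemma mulC_order x y m : (x * y) ^+ m = 1 -> (y * x) ^+ m = 1.
Proof.
by move=> xy; apply/(expgJ_eq1 y); rewrite conjgE !mulgA mulVg mul1g.
Qed.

Lemma order2P a b : a * a = 1 -> b * b = 1 ->
  (a * b) ^+ 2 = 1 <-> commute a b.
Proof.
move=> aa bb; rewrite expg2; split=> [/mulg1_eq|ab]; last first.
  by rewrite {2}ab mulgA -[a * b * b]mulgA bb mulg1 aa.
by rewrite invgM !involV // => /esym.
Qed.

Lemma braid3 a b : a * a = 1 -> b * b = 1 -> (a * b) ^+ 3 = 1 -> a ^ b = b ^ a.
Proof.
move=> aa bb ab3; rewrite !conjgE !involV //.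
have /mulg1_eq : (a * (b * a)) * (b * (a * b)) = 1.
  by rewrite -[RHS]ab3 !expgS expg0 mulg1 !mulgA.
by rewrite !invgM !involV // -mulgA.
Qed.

Lemma braid4 a b : a * a = 1 -> b * b = 1 -> (a * b) ^+ 4 = 1 ->
  commute a (a ^ b).
Proof.
move=> aa bb ab4; rewrite /commute conjgE involV //.
have /mulg1_eq : (a * (b * (a * b))) * (a * (b * (a * b))) = 1.
  by rewrite -[RHS]ab4 !expgS expg0 mulg1 !mulgA.
by rewrite !invgM !involV // => <-; rewrite !mulgA.
Qed.

(** Since [b] commutes with [b ^ c] and [c] with [a ^ b], conjugating by [b] and then by [c] turns
    [a * b ^ c] into [b * a]. This is how relators of exponent 3 follow from commuting ones. *)
Lemma order3_triangle a b c : a * a = 1 -> b * b = 1 -> c * c = 1 ->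
  (a * b) ^+ 3 = 1 -> (b * c) ^+ 4 = 1 -> commute c (a ^ b) ->
  (a * b ^ c) ^+ 3 = 1.
Proof.
move=> aa bb cc ab3 bc4 cab.
apply/(expgJ_eq1 b); rewrite conjMg.
have -> : (b ^ c) ^ b = b ^ c.
  by apply: conj_commute; apply: commute_sym; apply: braid4.
apply/(expgJ_eq1 c); rewrite conjMg conj_invol // conj_commute //.
by rewrite conjgE involV // -!mulgA bb mulg1; apply: mulC_order.
Qed.

End GroupLemmas.


Section Words.
Local Open Scope group_scope.
Variables (X : Type) (H : groupType) (t : X -> H).

Definition eval_word (w : word X) : H :=
  foldr (fun l g => (if l.2 then (t l.1)^-1 else t l.1) * g) 1 w.

Lemma eval_word_cat u v : eval_word (u ++ v) = eval_word u * eval_word v.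
Proof. by elim: u => [|l u /= ->]; rewrite ?mul1g ?mulgA. Qed.

Lemma eval_word_pow w m : eval_word (pow_word w m) = eval_word w ^+ m.
Proof.
rewrite /pow_word; elim: m => //= m IH.
by rewrite eval_word_cat IH expgS.
Qed.

(* The reflection t_x1 ... t_x(m-1) t_xm t_x(m-1) ... t_x1. *)
Fixpoint palindrome (s : seq X) : H :=
  if s is x :: s' then
    if s' is _ :: _ then palindrome s' ^ t x else t x
  else 1.

Lemma palindrome_cons x s : (0 < size s)%N ->
  palindrome (x :: s) = palindrome s ^ t x.
Proof. by case: s. Qed.

Hypothesis tt : forall x, t x * t x = 1.

Lemma palindrome_invol s : palindrome s * palindrome s = 1.
Proof.
elim: s => [|x [|y s] IH]; [exact: mulg1|exact: tt|].
by rewrite palindrome_cons //; apply: involJ.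
Qed.

Lemma palindrome_rcons s z :
  palindrome (rcons s z) = t z ^ (\prod_(x <- rev s) t x).
Proof.
elim: s => [|x s IH]; first by rewrite big_nil conjg1.
rewrite rcons_cons palindrome_cons ?size_rcons // IH rev_cons -cats1 big_cat.
by rewrite big_seq1 conjgM.
Qed.

Lemma prod_rev_invol s : \prod_(x <- rev s) t x = (\prod_(x <- s) t x)^-1.
Proof.
elim: s => [|x s IH]; first by rewrite big_nil invg1.
by rewrite rev_cons -cats1 big_cat big_seq1 big_cons invgM IH (involV (tt x)).
Qed.

(** For involutions this is the relation of exponent 2 of the cycle based at its first vertex. *)
Definition commutes_around (c : seq X) : Prop :=
  if c is x :: p then commute (t x) (palindrome p) else True.

(** The relations of type A along a path; for involutions [a ^ b = b ^ a] is the braid relation. *)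
Definition braided (s : seq X) : Prop :=
  forall x0 i j, (i < j < size s)%N ->
    let a := t (nth x0 s i) in let b := t (nth x0 s j) in
    if i.+1 == j then a ^ b = b ^ a else commute a b.

Lemma braided_behead x s : braided (x :: s) -> braided s.
Proof. by move=> br x0 i j ij; have := br x0 i.+1 j.+1 ij. Qed.

Lemma braided_rcons s z : braided (rcons s z) -> braided s.
Proof.
move=> br x0 i j /andP[ij js]; have := br x0 i j.
rewrite size_rcons !nth_rcons js (ltn_trans ij js) ij /=.
by rewrite ltnW // => /(_ isT).
Qed.

(* Both sides are the reflection in the same root: with y, z the two ends and q
   the rest, conjugating by y and by z commute. *)
Lemma palindrome_rev s : braided s -> palindrome (rev s) = palindrome s.
Proof.
have [m] := ubnP (size s); elim: m s => // m IH.
case=> // y s; case/lastP: s => // q z; rewrite -rcons_cons size_rcons ltnS => qm br.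
case: q qm br => [|w q] qm br.
  have /= -> := br y 0%N 1%N isT; by [].
have yz : commute (t y) (t z).
  have := br y 0%N (size q).+2; rewrite /= size_rcons nth_rcons ltnn eqxx.
  by rewrite ltnS leqnn => /(_ isT).
have br1 : braided (rcons (w :: q) z) by apply: braided_behead br.
have br2 := braided_rcons br1.
rewrite rev_rcons [in RHS]rcons_cons.
rewrite (@palindrome_cons z (rev _)) ?size_rev //.
rewrite (@palindrome_cons y (rcons _ _)) ?size_rcons //.
rewrite (IH (y :: w :: q)) //; last exact: (@braided_rcons _ z).
rewrite (@palindrome_cons y (w :: q)) //.
have -> : palindrome (rcons (w :: q) z) = palindrome (w :: q) ^ t z.
  rewrite -(IH (rcons _ z)) ?rev_rcons ?size_rcons //.
  by rewrite (@palindrome_cons z) ?size_rev // IH // ltnW.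
exact: conjg_comm.
Qed.

(** Reading the palindrome backwards shows it to be the conjugate of [t y] by the product along [p];
    in the rotated relation [t x] is conjugated by the inverse of that product. *)
Lemma commutes_around_rot1 c : (forall x p, c = x :: p -> braided p) ->
  commutes_around c -> commutes_around (rot 1 c).
Proof.
case: c => // x [|y p] br //.
rewrite rot1_cons /= -/(palindrome (y :: p)) -palindrome_rev; last exact: br.
rewrite rev_cons !palindrome_rcons revK => h.
apply/commute_sym; rewrite prod_rev_invol -(commuteJ (\prod_(z <- p) t z)).
by rewrite -conjgM mulVg conjg1.
Qed.

End Words.

(** * Families of involutions satisfying the relations of a diagram *)

Section Satisfaction.
Local Open Scope group_scope.
Variables (n : nat) (H : groupType).
Implicit Types (G : diagram n) (B : 'M[int]_n) (t : 'I_n -> H).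
Implicit Types (x y z : 'I_n) (c p q : seq 'I_n) (ws : seq nat).

Definition satisfies_relators G t : Prop :=
  forall w, W_relator G w -> eval_word t w = 1.

(* The weights of a cycle whose relator based at the first vertex has exponent
   2, and hence says that two involutions commute. *)
Definition commuting_weights ws : bool :=
  all (pred1 1%N) ws || (last 0%N ws == 2).

Record coxeter_family G t : Prop := CoxeterFamily {
  refl_invol : forall x, t x * t x = 1;
  refl_coxeter : forall x y, x != y -> (t x * t y) ^+ coxeter_exponent G x y = 1
}.

(* The relators of exponent 3 follow from those required here. *)
Record reflection_family G t : Prop := ReflectionFamily {
  refl_family : coxeter_family G t;
  refl_cycle : forall c, induced_cycle G c -> path.cycle (arrow G) c ->
    commuting_weights (weights_along G c) -> commutes_around t c
}.

Lemma noncommuting_weights ws : cycle_weights ws -> ~~ commuting_weights ws ->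
  ws = [:: 2; 2; 1]%N \/ ws = [:: 2; 1; 2; 1]%N.
Proof.
rewrite /cycle_weights negb_or => h /andP[ones l2]; move: h.
rewrite (negPf ones) orFb !inE => /or4P[|||/orP[]] /eqP E; move: l2; rewrite E //;
  by [left | right].
Qed.

Lemma oriented_weights B c : tame B -> induced_cycle (diagram_of B) c ->
  path.cycle (arrow (diagram_of B)) c ->
  cycle_weights (weights_along (diagram_of B) c).
Proof.
move=> tB cG or; case: (tame_cycle tB cG) => // /cycle_weights_gt0.
rewrite weights_along_gt0 rev_cycle; have [skB _] := tB.
case: c cG or => [[]//|x [[]//|y p]] cG /= /andP[xy _] /andP[yx _].
by rewrite (arrow_asym skB xy) in yx.
Qed.

Lemma weights_along3 G c a b d : weights_along G c = [:: a; b; d] ->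
  exists x y z, [/\ c = [:: x; y; z], G x y = a, G y z = b & G z x = d].
Proof.
case: c => [|x [|y [|z [|u p]]]] //; first by case=> <- <- <-; exists x, y, z.
by move/(congr1 size); rewrite size_weights_along.
Qed.

Lemma weights_along4 G c a b d e : weights_along G c = [:: a; b; d; e] ->
  exists x y z u, c = [:: x; y; z; u] /\
    [/\ G x y = a, G y z = b, G z u = d & G u x = e].
Proof.
case: c => [|x [|y [|z [|u [|v p]]]]] //.
  by case=> <- <- <- <-; exists x, y, z, u.
by move/(congr1 size); rewrite size_weights_along.
Qed.

Lemma last_weights_along G x p :
  last 0%N (weights_along G (x :: p)) = G (last x p) x.
Proof.
rewrite -nth_last size_weights_along (nth_weights_along x) //= eqxx.
by rewrite -[size p]/((size (x :: p)).-1) nth_last.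
Qed.

Lemma eval_gens_cons t x p : eval_word t (gens (x :: p)) = t x * eval_word t (gens p).
Proof. by []. Qed.

Lemma eval_gens_cat t p q :
  eval_word t (gens (p ++ q)) = eval_word t (gens p) * eval_word t (gens q).
Proof. by rewrite /gens map_cat eval_word_cat. Qed.

Lemma eval_cycle_word t x p : (forall x, t x * t x = 1) ->
  eval_word t (gens (x :: p ++ behead (rev p))) = t x * palindrome t p.
Proof.
move=> tt; rewrite eval_gens_cons; congr (_ * _).
elim: p => // y [|z p] IH; first by rewrite /= mulg1.
rewrite palindrome_cons // conjgE involV // -IH rev_cons.
have [a [r ->]] : exists a r, rev (z :: p) = a :: r.
  case/lastP: (p) => [|p' u]; first by exists z, [::].
  by rewrite -rcons_cons rev_rcons; exists u, (rev (z :: p')).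
rewrite rcons_cons [behead _]/= -cats1 catA !cat_cons eval_gens_cons.
by rewrite -!cat_cons eval_gens_cat eval_gens_cons mulg1.
Qed.

Section Coxeter.
Variables (B : 'M[int]_n) (t : 'I_n -> H).
Local Notation G := (diagram_of B).
Hypotheses (tB : tame B) (cox : coxeter_family G t).

Let skB : skew_symmetrisable B. Proof. by case: tB. Qed.
Let tt := refl_invol cox.

Lemma edge_weight_sym x y : edge_weight G x y = edge_weight G y x.
Proof. exact: addnC. Qed.

Lemma arrow_weight x y m : G x y = m.+1 -> edge_weight G x y = m.+1.
Proof.
move=> E; rewrite /edge_weight E (@diagram_asym _ B) ?addn0 //.
by rewrite /arrow E.
Qed.

Lemma weight_neq x y m : edge_weight G x y = m.+1 -> x != y.
Proof.
apply: contra_eq_neq => ->; have := joined_irr y skB.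
by rewrite /joined /arrow /edge_weight; case: (G y y).
Qed.

Lemma refl_commute x y : edge_weight G x y = 0%N -> commute (t x) (t y).
Proof.
move=> E; have [->//|xy] := eqVneq x y.
by have := refl_coxeter cox xy; rewrite /coxeter_exponent E => /order2P; apply.
Qed.

Lemma refl_unjoined x y : ~~ joined G x y -> commute (t x) (t y).
Proof.
by rewrite /joined /arrow => h; apply: refl_commute; rewrite /edge_weight; lia.
Qed.

Lemma refl_order3 x y : edge_weight G x y = 1%N -> (t x * t y) ^+ 3 = 1.
Proof.
by move=> E; have := refl_coxeter cox (weight_neq E); rewrite /coxeter_exponent E.
Qed.

Lemma refl_order4 x y : edge_weight G x y = 2%N -> (t x * t y) ^+ 4 = 1.
Proof.
by move=> E; have := refl_coxeter cox (weight_neq E); rewrite /coxeter_exponent E.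
Qed.

Lemma refl_braid x y : edge_weight G x y = 1%N -> t x ^ t y = t y ^ t x.
Proof. by move=> E; apply: braid3 => //; apply: refl_order3. Qed.

Lemma braided_arc x p : induced_cycle G (x :: p) ->
  all (pred1 1%N) (weights_along G (x :: p)) -> braided t p.
Proof.
move=> [_ _ adj] ones x0 i j /andP[ij jp] a b.
have := adj x0 i.+1 j.+1; rewrite /= !ltnS ij jp => /(_ isT).
rewrite eqSS orbF; case: eqP => [E|_] uv; last first.
  by apply: refl_unjoined; rewrite uv.
apply/refl_braid/arrow_weight.
have ic : (i.+1 < size (x :: p))%N by rewrite ltnS (ltn_trans ij).
have /(all_nthP 0%N)/(_ i.+1) := ones; rewrite size_weights_along ic.
move=> /(_ isT)/eqP; rewrite (nth_weights_along x0) // ifN; last first.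
  by rewrite eqSS neq_ltn E jp.
by rewrite /= E.
Qed.

(** With all weights 1 the relation moves one vertex at a time. Otherwise exactly two base points
    have exponent 2, and the braid relation [t x ^ t y = t y ^ t x] along edges of weight 1 turns
    one relation into the other. *)
Lemma commutes_around_rot m c : induced_cycle G c -> path.cycle (arrow G) c ->
  commuting_weights (weights_along G c) ->
  commuting_weights (weights_along G (rot m c)) ->
  commutes_around t c -> commutes_around t (rot m c).
Proof.
move=> cG or; have gw := oriented_weights tB cG or; move=> h.
have [ones _ cc|] := boolP (all (pred1 1%N) (weights_along G c)).
  elim: m => [|m IH]; first by rewrite rot0.
  case: (leqP (size c) m) => [le|lt]; first by rewrite rot_oversize // leqW.
  rewrite rotS //; apply: commutes_around_rot1 => // x p E.
  apply: (@braided_arc x); rewrite -E; first exact: induced_cycle_rot.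
  by rewrite weights_along_rot (eq_all_r (mem_rot _ _)).
move: gw h; rewrite /cycle_weights /commuting_weights => /orP[->//|].
have [le _ _ _ //|] := leqP (size c) m; first by rewrite rot_oversize.
rewrite weights_along_rot => mc ws; move: mc; rewrite -(size_weights_along G).
move: ws; rewrite !inE.
case/or4P=> [|||/orP[]] /eqP E; rewrite E; case: m => [|[|[|[|m]]]] //= _ _ _ _;
  rewrite ?rot0 //.
- have [x [y [z [-> xy yz zx]]]] := weights_along3 E; rewrite /commutes_around /=.
  move=> h2; apply: commute_sym; rewrite -(refl_braid (arrow_weight xy)).
  exact/commuteJl.
- have [x [y [z [-> xy yz zx]]]] := weights_along3 E; rewrite /commutes_around /=.
  rewrite -(refl_braid (arrow_weight yz)) => h2.
  by apply: commute_sym; apply/commuteJl.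
have [x [y [z [u [cE [xy yz zu ux]]]]]] := weights_along4 E.
have yu : commute (t y) (t u).
  apply: refl_unjoined; have [_ _ /(_ x 1 3)%N] := cG.
  by rewrite cE /= => ->.
rewrite cE /commutes_around /= => h2.
have {}h2 : commute (t x ^ t u) (t z ^ t y).
  apply/commuteJl => //; rewrite conjg_comm // (refl_braid (arrow_weight zu)).
  exact: h2.
apply: commute_sym; rewrite -(refl_braid (arrow_weight xy)) conjg_comm //.
exact/commuteJl.
Qed.


Lemma refl_weight2_commute x y : edge_weight G x y = 2%N ->
  commute (t x) (t x ^ t y).
Proof. by move=> E; apply: braid4 => //; apply: refl_order4. Qed.

End Coxeter.

(** The weights are 2, 2, 1, where [order3_triangle] applies directly, or 2, 1, 2, 1, where it
    applies once the last two vertices are merged into the single reflection [t u ^ t z]. *)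
Lemma refl_order3_cycle B t x p : tame B -> reflection_family (diagram_of B) t ->
  induced_cycle (diagram_of B) (x :: p) ->
  path.cycle (arrow (diagram_of B)) (x :: p) ->
  ~~ commuting_weights (weights_along (diagram_of B) (x :: p)) ->
  (t x * palindrome t p) ^+ 3 = 1.
Proof.
set G := diagram_of B => tB [cox cyc] cG or.
have tt := refl_invol cox; have [skB _] := tB.
have rotc m : commuting_weights (rot m (weights_along G (x :: p))) ->
    commutes_around t (rot m (x :: p)).
  rewrite -weights_along_rot => h.
  by apply: cyc h; [apply: induced_cycle_rot | rewrite rot_cycle].
move=> /(noncommuting_weights (oriented_weights tB cG or)) [E|E].
  have [_ [y [z [[<- pE] xy yz zx]]]] := weights_along3 E; rewrite pE /=.
  have := rotc 1%N; rewrite E pE => /(_ isT) /= yxz.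
  apply: order3_triangle => //.
  - exact: mulC_order (refl_order3 tB cox (arrow_weight tB zx)).
  - exact: mulC_order (refl_order4 tB cox (arrow_weight tB yz)).
have [_ [y [z [u [[<- pE] [xy yz zu ux]]]]]] := weights_along4 E; rewrite pE /=.
have [_ _ adj] := cG; rewrite pE in adj.
have xz : commute (t x) (t z).
  by apply: (refl_unjoined cox); have /= -> := adj x 0%N 2%N isT.
have yu : commute (t y) (t u).
  by apply: (refl_unjoined cox); have /= -> := adj x 1%N 3%N isT.
have ux3 := refl_order3 tB cox (arrow_weight tB ux).
have := rotc 1%N; rewrite E pE => /(_ isT) /= yzux.
apply: order3_triangle => //; first exact: involJ.
- apply/(expgJ_eq1 (t z)); rewrite conjMg conj_invol // conj_commute //.
  exact: mulC_order.
- apply: mulC_order; apply/(expgJ_eq1 (t z)); rewrite conjMg conj_invol //.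
  rewrite (refl_braid tB cox (arrow_weight tB yz)).
  apply/(expgJ_eq1 (t y)); rewrite conjMg conj_invol // conj_commute //.
  exact: (refl_order4 tB cox (arrow_weight tB zu)).
rewrite (@braid3 _ (t x)) //; first 1 last.
- exact: involJ.
- apply/(expgJ_eq1 (t z)); rewrite conjMg conj_invol // conj_commute //.
  exact: mulC_order.
rewrite conjg_comm; last exact: commute_sym.
by rewrite (refl_braid tB cox (arrow_weight tB ux)).
Qed.


End Satisfaction.

Section Relators.
Local Open Scope group_scope.
Variables (n : nat) (H : groupType).
Implicit Types (G : diagram n) (B : 'M[int]_n) (t : 'I_n -> H).
Implicit Types (x y z : 'I_n) (c p q : seq 'I_n).

Lemma prev_rot_head m c x p : uniq c -> rot m c = x :: p -> prev c x = last x p.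
Proof.
move=> Uc E; rewrite -(prev_rot m Uc) E.
have Up : uniq (x :: p) by rewrite -E rot_uniq.
have {2}<- : next (x :: p) (last x p) = x.
  by rewrite -[last x p](nth_last x (x :: p)) nth_next //= eqxx.
exact: prev_next.
Qed.

Lemma edge_weight_next B x0 c i : tame B ->
  path.cycle (arrow (diagram_of B)) c -> uniq c -> (i < size c)%N ->
  edge_weight (diagram_of B) (nth x0 c i) (next c (nth x0 c i)) =
  nth 0%N (weights_along (diagram_of B) c) i.
Proof.
move=> tB or Uc ic; rewrite nth_next // (nth_weights_along x0) //.
have := next_cycle or (mem_nth x0 ic); rewrite nth_next // /arrow.
case E: (diagram_of B _ _) => [//|w] _.
exact: (arrow_weight tB E).
Qed.

Lemma relators_reflection_family B t : tame B ->
  satisfies_relators (diagram_of B) t -> reflection_family (diagram_of B) t.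
Proof.
set G := diagram_of B => tB rel; have [skB _] := tB.
have tt x : t x * t x = 1.
  by have := rel _ (R1 G x); rewrite eval_word_pow /= mulg1 expg2.
split=> [|c cG or]; first split=> // x y xy.
  by have := rel _ (R2 G xy); rewrite eval_word_pow /= mulg1.
case: c cG or => // x p cG or; have [_ Uc _] := cG.
have chc : chordless_cycle G (x :: p).
  by apply/chordless_cycleE => // y; apply: joined_irr.
have rot0x : rot (index x (x :: p)) (x :: p) = x :: p by rewrite /= eqxx rot0.
have cw : eval_word t (cycle_word (x :: p) x) = t x * palindrome t p.
  by rewrite /cycle_word rot0x eval_cycle_word.
suff h : commuting_weights (weights_along G (x :: p)) ->
    (t x * palindrome t p) ^+ 2 = 1.
  by move=> /h/order2P; apply=> //; apply: palindrome_invol.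
rewrite -cw -eval_word_pow => /orP[ones|].
  apply: rel; apply: R3a; rewrite ?mem_head // => j jc.
  rewrite -(nth_index x jc) edge_weight_next ?index_mem //.
  by apply/eqP/(all_nthP 0%N ones); rewrite size_weights_along index_mem.
rewrite last_weights_along => /eqP last2.
have w2 : edge_weight G (last x p) x = 2 by apply: (arrow_weight tB).
have nx : next (x :: p) (last x p) = x.
  by rewrite -[last x p](nth_last x (x :: p)) nth_next //= eqxx.
have w2' : exists2 j, j \in x :: p & edge_weight G j (next (x :: p) j) = 2%N.
  by exists (last x p); rewrite ?mem_last // nx.
have := rel _ (R3b chc w2' (mem_head _ _)).
by rewrite (prev_rot_head Uc (rot0 _)) w2.
Qed.

Lemma reflection_family_relators B t : tame B ->
  reflection_family (diagram_of B) t -> satisfies_relators (diagram_of B) t.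
Proof.
set G := diagram_of B => tB rf; have [skB _] := tB; have [cox cyc] := rf.
have tt := refl_invol cox.
have chordless c i : chordless_cycle G c -> i \in c -> exists p,
    [/\ rot (index i c) c = i :: p, induced_cycle G (i :: p),
      path.cycle (arrow G) (i :: p) &
      eval_word t (cycle_word c i) = t i * palindrome t p].
  move=> /chordless_cycleE[y|cG or ic]; first exact: joined_irr.
  have E : rot (index i c) c = i :: behead (rot (index i c) c).
    by rewrite /rot (drop_nth i) ?index_mem // nth_index.
  exists (behead (rot (index i c) c)); rewrite -E; split=> //.
  - exact: induced_cycle_rot.
  - by rewrite rot_cycle.
  by rewrite /cycle_word {1}E eval_cycle_word.
move=> w [i|i j ij|c i chc w1 ic|c i chc w2 ic].
- by rewrite eval_word_pow /= mulg1 expg2.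
- by rewrite eval_word_pow /= mulg1; apply: refl_coxeter.
- have [p [rE pG or pE]] := chordless c i chc ic.
  rewrite eval_word_pow pE; apply/order2P => //; first exact: palindrome_invol.
  apply: (cyc (i :: p)) => //; apply/orP; left; rewrite -rE weights_along_rot.
  rewrite (eq_all_r (mem_rot _ _)); apply/(all_nthP 0%N) => j.
  have [_ Uc or' _] := chc.
  rewrite size_weights_along => jc; rewrite -(edge_weight_next i tB or' Uc jc).
  by rewrite /= w1 // mem_nth.
have [p [rE pG or pE]] := chordless c i chc ic; have [_ Uc or' _] := chc.
rewrite eval_word_pow pE (prev_rot_head Uc rE).
have := oriented_weights tB pG or.
have lastE : edge_weight G (last i p) i = last 0%N (weights_along G (i :: p)).
  rewrite last_weights_along; move: or; rewrite /= rcons_path => /andP[_].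
  rewrite /arrow; case E: (G (last i p) i) => [//|m] _.
  by rewrite (arrow_weight tB E).
have [ones _|ones] := boolP (all (pred1 1%N) (weights_along G (i :: p))).
  have [j jc w2'] := w2; case/negP: (isT); move: ones.
  rewrite -rE weights_along_rot (eq_all_r (mem_rot _ _)) => /(all_nthP 0%N).
  move/(_ (index j c)); rewrite size_weights_along index_mem jc => /(_ isT).
  by rewrite -(edge_weight_next i) ?index_mem // nth_index // w2'.
rewrite /cycle_weights (negPf ones) orFb => shape.
(* The exponent is 2 when the last weight is 2, a relation of the family, and 3 when it is 1. *)
have [l2|l2] := eqVneq (last 0%N (weights_along G (i :: p))) 2.
  rewrite lastE l2; apply/order2P => //; first exact: palindrome_invol.
  by apply: (cyc (i :: p)) => //; rewrite /commuting_weights l2 orbT.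
have l1 : last 0%N (weights_along G (i :: p)) = 1%N.
  move: shape l2; move: (weights_along _ _) => ws.
  by rewrite !inE => /or4P[|||/orP[]] /eqP->.
rewrite lastE l1; apply: refl_order3_cycle tB rf pG or _.
by rewrite /commuting_weights negb_or ones l1.
Qed.

End Relators.

(** * Invariance of the relations under mutation *)

Section MutateCoxeter.
Local Open Scope group_scope.
Variables (n : nat) (H : groupType) (B : 'M[int]_n) (t : 'I_n -> H) (k : 'I_n).
Implicit Types (i j x y z : 'I_n) (c p q : seq 'I_n).
Local Notation G := (diagram_of B).
Local Notation G' := (diagram_of (mutate_matrix k B)).
Hypotheses (tB : tame B) (rf : reflection_family G t).

Definition mutate_reflections i : H := if arrow G i k then t i ^ t k else t i.
Local Notation t' := mutate_reflections.

Let skB : skew_symmetrisable B. Proof. by case: tB. Qed.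
Let cox : coxeter_family G t. Proof. by case: rf. Qed.
Let tt := refl_invol cox.

Lemma mutate_reflections_k : t' k = t k.
Proof.
by rewrite /t'; case: ifP => // kk; have := arrow_asym skB kk; rewrite kk.
Qed.

Lemma mutate_reflections_unjoined i : ~~ joined G k i -> t' i = t i.
Proof. by rewrite joined_sym /t' /joined; case: ifP. Qed.

Lemma arrow_neq i j : arrow G i j -> i != j.
Proof.
by move=> ij; apply: contraTneq ij => ->; apply/negP => h;
  have := joined_irr j skB; rewrite /joined h.
Qed.

Lemma cycle3_induced x y z : arrow G x y -> arrow G y z -> arrow G z x ->
  induced_cycle G [:: x; y; z] /\ path.cycle (arrow G) [:: x; y; z].
Proof.
move=> xy yz zx; split; last by rewrite /= xy yz zx.
have nxy := arrow_neq xy; have nyz := arrow_neq yz.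
have nzx := arrow_neq zx.
split=> [//||x0 i j /= ij].
  by rewrite /= !inE negb_or nxy eq_sym nzx nyz.
have [[-> ->]|[[-> ->]|[-> ->]]] : (i = 0 /\ j = 1 \/ i = 0 /\ j = 2 \/
    i = 1 /\ j = 2)%N by lia.
- by rewrite /= /joined xy.
- by rewrite /= /joined zx orbT.
- by rewrite /= /joined yz.
Qed.

Lemma refl_triangle x y z : arrow G x y -> arrow G y z -> arrow G z x ->
  commuting_weights [:: G x y; G y z; G z x] -> commute (t x) (t z ^ t y).
Proof.
move=> xy yz zx cw; have [cG or] := cycle3_induced xy yz zx.
exact: (refl_cycle rf cG or cw).
Qed.

(** If [j -> i] closes a triangle of [G], its cycle relation is what is needed: exponent 3 for
    weights 2, 2, 1, where an edge of weight 1 remains, and 2 otherwise, where the edge disappears.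
    If not, [t i] and [t j] commute. *)
Lemma mutate_pass_order i j : arrow G i k -> arrow G k j ->
  (t i ^ t k * t j) ^+ coxeter_exponent G' i j = 1.
Proof.
move=> ik kj; have [E1 E2] := mutate_diagram_passE tB ik kj.
have tikk := involJ (t k) (tt i).
rewrite /coxeter_exponent /edge_weight E1 E2 addn0.
case: ifPn => ji.
  have := tame_triangle tB ik kj ji; rewrite !inE.
  case/or4P => /eqP[ikE kjE jiE]; rewrite ikE kjE jiE /=.
  4: {
    have [cG or] := cycle3_induced ik kj ji.
    have := refl_order3_cycle tB rf cG or; rewrite /= ikE kjE jiE => /(_ isT).
    move=> h; apply/(expgJ_eq1 (t k)); rewrite conjMg conj_invol //.
  }
  1-3: apply/order2P => //; apply/commuteJl => //; apply: refl_triangle => //.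
  1-3: by rewrite ikE kjE jiE.
have ij : commute (t i) (t j).
  by apply: (refl_unjoined cox); rewrite /joined negb_or ji (tame_parallel tB ik kj).
have tB' := tame_mutate k tB.
(* In [G'] the three vertices form a triangle. Its possible weights force one of the edges at [k] to
   have weight 1, and the braid relation there moves the conjugation. *)
have a1 : arrow G' k i by rewrite /arrow mutate_diagraml.
have a2 : arrow G' j k by rewrite /arrow mutate_diagramr.
have a3 : arrow G' i j.
  by move: ik kj; rewrite /arrow E1 (negPf ji) muln_gt0 => -> ->.
have := tame_triangle tB' a3 a2 a1.
rewrite E1 (negPf ji) mutate_diagraml // mutate_diagramr // !inE.
have w1 := arrow_weight tB (x := i) (y := k).
have w2 := arrow_weight tB (x := k) (y := j).
case/or4P => /eqP[prod kjE ikE]; rewrite kjE ikE //= in prod *.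
- rewrite (refl_braid tB cox (w1 _ ikE)) -(conj_commute (commute_sym ij)).
  by rewrite -conjMg; apply/expgJ_eq1; apply: (refl_order3 tB cox (w2 _ kjE)).
- apply/(expgJ_eq1 (t k)); rewrite conjMg conj_invol //.
  rewrite -(refl_braid tB cox (w2 _ kjE)) -(conj_commute ij).
  by rewrite -conjMg; apply/expgJ_eq1; apply: (refl_order4 tB cox (w1 _ ikE)).
rewrite (refl_braid tB cox (w1 _ ikE)) -(conj_commute (commute_sym ij)).
by rewrite -conjMg; apply/expgJ_eq1; apply: (refl_order4 tB cox (w2 _ kjE)).
Qed.

(** Orders are kept when both elements are conjugated by [t k], or when the one that is not
    conjugated commutes with [t k]. The remaining case is [mutate_pass_order]. *)
Lemma mutate_coxeter : coxeter_family G' t'.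
Proof.
split=> [i|i j ij]; first by rewrite /t'; case: ifP => // _; apply: involJ.
have ord x y : x != y -> (t x * t y) ^+ coxeter_exponent G x y = 1.
  exact: (refl_coxeter cox).
have same x y : joined G k x && joined G k y = false -> x != k -> y != k ->
    coxeter_exponent G' x y = coxeter_exponent G x y.
  move=> xy xk yk; rewrite /coxeter_exponent /edge_weight.
  by rewrite !mutate_diagram_disjoint ?xy // andbC xy.
have withk x : x != k -> coxeter_exponent G' x k = coxeter_exponent G x k.
  move=> xk; rewrite /coxeter_exponent /edge_weight.
  by rewrite mutate_diagraml // mutate_diagramr // addnC.
have sym' x y : coxeter_exponent G' x y = coxeter_exponent G' y x.
  by rewrite /coxeter_exponent /edge_weight addnC.
have half x y : x != y -> x != k -> y != k -> arrow G x k -> ~~ arrow G y k ->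
    (t' x * t' y) ^+ coxeter_exponent G' x y = 1.
  move=> xy xk yk ax ay; rewrite /t' ax (negPf ay).
  have [ky|ky] := boolP (arrow G k y); first exact: mutate_pass_order.
  have uy : ~~ joined G k y by rewrite /joined negb_or ky.
  have cyk : commute (t y) (t k) by apply: (refl_unjoined cox); rewrite joined_sym.
  rewrite same ?(negPf uy) ?andbF // -(conj_commute cyk).
  by rewrite -conjMg; apply/expgJ_eq1; apply: ord.
have [jE|jk] := eqVneq j k.
  have ik : i != k by rewrite -jE.
  rewrite jE withk // mutate_reflections_k /t'; case: ifP => _; last exact: ord.
  rewrite -{2}(conj_commute (commute_refl (t k))) -conjMg; apply/expgJ_eq1.
  exact: ord.
have [iE|ik] := eqVneq i k.
  rewrite iE sym' withk //; apply: mulC_order.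
  rewrite mutate_reflections_k /t'; case: ifP => _; last exact: ord.
  rewrite -{2}(conj_commute (commute_refl (t k))) -conjMg; apply/expgJ_eq1.
  exact: ord.
have [ai|ai] := boolP (arrow G i k); have [aj|aj] := boolP (arrow G j k).
- rewrite /t' ai aj -conjMg; apply/expgJ_eq1.
  rewrite /coxeter_exponent /edge_weight !mutate_diagram_id //; first exact: ord.
  1-4: by rewrite ?(arrow_asym skB ai) ?(arrow_asym skB aj) ?andbF.
- exact: half.
- by rewrite sym'; apply/mulC_order/half => //; rewrite eq_sym.
rewrite /t' (negPf ai) (negPf aj).
rewrite /coxeter_exponent /edge_weight !mutate_diagram_id ?(negPf ai) ?(negPf aj) //.
exact: ord.
Qed.

End MutateCoxeter.

Lemma rot_rot_exists (T : Type) (s : seq T) m m' :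
  exists l, rot m (rot m' s) = rot l s.
Proof.
have [m'le|m'gt] := leqP m' (size s); last first.
  by exists m; rewrite [rot m' s]rot_oversize // ltnW.
have [mle|mgt] := leqP m (size s); last first.
  by exists m'; rewrite [LHS]rot_oversize // size_rot ltnW.
by rewrite rot_add_mod //; eexists.
Qed.

Section Palindromes.
Local Open Scope group_scope.
Variables (X : eqType) (H : groupType).
Implicit Types (t : X -> H) (s : seq X).

Lemma eq_palindrome t t' s : {in s, t =1 t'} -> palindrome t s = palindrome t' s.
Proof.
elim: s => // x [|y s] IH E; first by rewrite /= E ?mem_head.
rewrite palindrome_cons // [RHS]palindrome_cons // E ?mem_head // IH // => u us.
by rewrite E // inE us orbT.
Qed.

Lemma palindrome_commute t s a : {in s, forall x, commute (t x) a} ->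
  commute (palindrome t s) a.
Proof.
elim: s => [|x [|y s] IH] E; first exact/commute_sym/commute1.
  by apply: E; rewrite mem_head.
rewrite palindrome_cons // -(conj_commute (commute_sym (E x (mem_head _ _)))).
by apply/commuteJ/IH => u us; apply: E; rewrite inE us orbT.
Qed.

Lemma palindrome_conj t s a : palindrome (fun x => t x ^ a) s = palindrome t s ^ a.
Proof.
elim: s => [|x [|y s] IH]; rewrite ?conj1g //.
by rewrite palindrome_cons // IH [in RHS]palindrome_cons // -conjJg.
Qed.

End Palindromes.

(** * Cycles of the mutated diagram through the vertex of mutation *)

Section MutateCycles.
Local Open Scope group_scope.
Variables (n : nat) (H : groupType) (B : 'M[int]_n) (t : 'I_n -> H) (k : 'I_n).
Implicit Types (i j x y z : 'I_n) (c p q : seq 'I_n).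
Local Notation G := (diagram_of B).
Local Notation G' := (diagram_of (mutate_matrix k B)).
Hypotheses (tB : tame B) (rf : reflection_family G t).
Local Notation t' := (mutate_reflections B t k).

Let skB : skew_symmetrisable B. Proof. by case: tB. Qed.
Let cox : coxeter_family G t. Proof. by case: rf. Qed.
Let tt := refl_invol cox.
Let tB' : tame (mutate_matrix k B). Proof. exact: tame_mutate. Qed.

Lemma arrow_mutate_r i : arrow G' i k = arrow G k i.
Proof. by rewrite /arrow mutate_diagramr. Qed.

Lemma arrow_mutate_l i : arrow G' k i = arrow G i k.
Proof. by rewrite /arrow mutate_diagraml. Qed.

Lemma joined_mutate i : joined G' k i = joined G k i.
Proof. by rewrite /joined arrow_mutate_l arrow_mutate_r orbC. Qed.

Definition commuting_somewhere c : Prop :=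
  exists m, commuting_weights (weights_along G' (rot m c)) /\
    commutes_around t' (rot m c).

Lemma commuting_somewhere_rot m c :
  commuting_somewhere (rot m c) -> commuting_somewhere c.
Proof.
move=> [m' h]; have [l E] := rot_rot_exists c m' m.
by exists l; rewrite -E.
Qed.

Section Through.
Variables (i j : 'I_n) (q : seq 'I_n).
Hypotheses (cG' : induced_cycle G' [:: i, k, j & q])
  (or' : path.cycle (arrow G') [:: i, k, j & q]).

Let ik' : arrow G' i k. Proof. by move: or' => /= /andP[]. Qed.
Let kj' : arrow G' k j. Proof. by move: or' => /= /and3P[]. Qed.
Let t'k : t' k = t k. Proof. exact: mutate_reflections_k. Qed.
Let t'j : t' j = t j ^ t k.
Proof. by rewrite /mutate_reflections -arrow_mutate_l kj'. Qed.
Let t'i : t' i = t i.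
Proof.
rewrite /mutate_reflections; case: ifP => // ik.
by have := arrow_asym skB ik; rewrite -arrow_mutate_r ik'.
Qed.

(** Unless the weights are 2, 2, 1, the vertices [i] and [j] are not joined in [G], and the relation
    based at [i] reduces to [t i] and [t j] commuting. *)
Lemma through_triangle : q = [::] -> commuting_somewhere [:: i; k; j].
Proof.
move=> q0; have ji' : arrow G' j i by move: or'; rewrite q0 /= andbT => /and3P[].
have := mutate_diagram_passE tB' ik' kj'; rewrite mutate_matrixK // ji'.
have := tame_triangle tB' ik' kj' ji'; rewrite !inE.
have iE : G k i = G' i k by rewrite mutate_diagramr.
have jE : G j k = G' k j by rewrite mutate_diagraml.
case/or4P => /eqP[ik kj ji]; rewrite ik kj ji /= => -[gij gji]; last first.
  (* For weights 2, 2, 1 the triangle survives in [G] with the opposite orientation. Its relation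
     and the order 4 at [j], [k] make [t k ^ t j] commute with [t i] and with [t k], hence with
     [t i ^ t k]. *)
  have ij : arrow G i j by rewrite /arrow gij.
  have jk : arrow G j k by rewrite /arrow jE kj.
  have ki : arrow G k i by rewrite /arrow iE ik.
  exists 1%N; rewrite /= ik kj ji; split=> //.
  rewrite t'k t'i t'j conj_conj // -(commuteJ (t k)) conj_invol //.
  rewrite (conj_commute (commute_refl (t k))).
  apply/commuteJl => //; apply: commute_sym.
  have c1 : commute (t i) (t k ^ t j).
    by apply: (refl_triangle tB rf ij jk ki _); rewrite iE ik /commuting_weights orbT.
  have c2 : commute (t k) (t k ^ t j).
    apply: (refl_weight2_commute tB cox); rewrite edge_weight_sym.
    by apply: (arrow_weight tB); rewrite jE kj.
  have := commuteM (commute_sym c2) (commuteM (commute_sym c1) (commute_sym c2)).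
  by rewrite [t i ^ t k]conjgE (involV (tt k)) => /commute_sym.
all: exists 0%N; rewrite rot0 /= ik kj ji; split=> //.
all: rewrite t'k t'i t'j conj_invol //; apply: (refl_unjoined cox).
all: by rewrite /joined /arrow gij gji.
Qed.

Let cG1 : induced_cycle G' (k :: j :: rcons q i).
Proof. by have := induced_cycle_rot1 cG'; rewrite rot1_cons. Qed.

Hypothesis q_gt0 : (0 < size q)%N.

Lemma through_weights : weights_along G [:: i, j & q] =
  (G' i k * G' k j)%N :: pairmap (fun_of_matrix G') j (rcons q i).
Proof.
have [gij _] := contract_last tB' cG1 q_gt0 ik' kj'.
have := contract_pairmap tB' cG1 q_gt0; rewrite !mutate_matrixK in gij *.
by rewrite /= gij => ->.
Qed.

Lemma through_induced : induced_cycle G [:: i, j & q].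
Proof.
have := contract_induced_cycle tB' cG1 q_gt0 ik' kj'; rewrite mutate_matrixK.
by move/(induced_cycle_rot (size (j :: rcons q i) - 1)); rewrite -rcons_cons -/(rotr _ _) rotr1_rcons.
Qed.

Lemma through_oriented : path.cycle (arrow G) [:: i, j & q].
Proof.
have := or'; rewrite -!weights_along_gt0 through_weights /= muln_gt0.
by case/and3P=> -> -> ->.
Qed.

Lemma through_unjoined l : l \in q -> ~~ joined G k l.
Proof.
move=> lq; have lp : l \in j :: rcons q i by rewrite inE mem_rcons inE lq !orbT.
rewrite -joined_mutate (induced_cycle_joined cG1 lp) /= last_rcons.
have [_ Uc _] := cG'; move: Uc => /= /and4P[iq _ jq _].
apply/norP; split; first by apply: contraNneq jq => <-.
by apply: contraNneq iq => <-; rewrite !inE lq !orbT.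
Qed.

Lemma through_reflections l : l \in q -> t' l = t l.
Proof. by move=> lq; apply/mutate_reflections_unjoined/through_unjoined. Qed.

(** [G] contains the cycle without [k]. As [t k] commutes with the elements at [q], all conjugations
    by [t k] cancel, and the relation at [i] becomes that of the shorter cycle. *)
Lemma through_long : commuting_somewhere [:: i, k, j & q].
Proof.
have tqk l : l \in q -> commute (t l) (t k).
  by move=> lq; apply: (refl_unjoined cox); rewrite joined_sym through_unjoined.
have [cw|ncw] := boolP (commuting_weights (weights_along G' [:: i, k, j & q])).
  exists 0%N; rewrite rot0; split=> //.
  have : commutes_around t [:: i, j & q].
    apply: (refl_cycle rf through_induced through_oriented).
    rewrite through_weights; move: cw => /=; move: q_gt0.
    case: (q) => // l r _; rewrite /commuting_weights /=.
    by case/orP=> [/and3P[/eqP-> /eqP-> ->]//|->]; rewrite orbT.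
  rewrite /commutes_around t'i (@palindrome_cons _ _ t' k) // t'k.
  rewrite !(palindrome_cons _ _ q_gt0) t'j (eq_palindrome through_reflections).
  by rewrite conj_conj // conj_invol // (conj_commute (palindrome_commute tqk)).
(* Here the relation at [i] has exponent 3. Based at [k] it has exponent 2, and follows from that of
   the shorter cycle based at [j]. *)
have E : weights_along G' [:: i, k, j & q] = [:: 2; 1; 2; 1]%N.
  have [E|//] := noncommuting_weights (oriented_weights tB' cG' or') ncw.
  have := congr1 size E; rewrite size_weights_along /= => -[qs].
  by have := q_gt0; rewrite qs.
have [_ [_ [_ [l [[<- <- <- qE] [ik kj jl li]]]]]] := weights_along4 E.
exists 1%N; rewrite weights_along_rot E qE; split=> //=.
have lq : l \in q by rewrite qE mem_head.
rewrite t'k t'i t'j (through_reflections lq).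
have jk : t j ^ t k = t k ^ t j.
  apply: (refl_braid tB cox); apply: (arrow_weight tB).
  by rewrite -kj mutate_diagraml.
have jli : commute (t j) (t i ^ t l).
  have := refl_cycle rf (induced_cycle_rot1 through_induced).
  rewrite rot_cycle weights_along_rot through_weights qE /= ik kj jl li; apply=> //.
  by have := through_oriented; rewrite qE.
apply/commuteJl; first exact: involJ.
rewrite conj_conj // (conj_commute (commute_refl (t k))) -jk conj_invol //.
Qed.

End Through.

End MutateCycles.

Lemma induced_cycle_cons n (G : diagram n) (k : 'I_n) s : (1 < size s)%N ->
  uniq (k :: s) ->
  (forall x0 i j, (i < j < size s)%N ->
     joined G (nth x0 s i) (nth x0 s j) = (i.+1 == j)) ->
  {in s, forall u, joined G k u = (u == head k s) || (u == last k s)} ->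
  induced_cycle G (k :: s).
Proof.
move=> s1 Uks adj adjk; split=> // x0 [|i] [|j] //= ijs.
  have js : (j < size s)%N by lia.
  rewrite adjk ?mem_nth // -nth0 -nth_last !(set_nth_default x0 k) //; try lia.
  have s0 := ltnW s1.
  by move: Uks => /= /andP[_ Us]; rewrite !nth_uniq ?ltn_predL //; lia.
by rewrite adj //; lia.
Qed.

(** * Cycles of the mutated diagram avoiding the vertex of mutation *)

Section MutateOutside.
Local Open Scope group_scope.
Variables (n : nat) (H : groupType) (B : 'M[int]_n) (t : 'I_n -> H) (k : 'I_n).
Implicit Types (i j x y z : 'I_n) (c p q : seq 'I_n).
Local Notation G := (diagram_of B).
Local Notation G' := (diagram_of (mutate_matrix k B)).
Hypotheses (tB : tame B) (rf : reflection_family G t).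
Local Notation t' := (mutate_reflections B t k).

Let skB : skew_symmetrisable B. Proof. by case: tB. Qed.
Let cox : coxeter_family G t. Proof. by case: rf. Qed.
Let tt := refl_invol cox.
Let tB' : tame (mutate_matrix k B). Proof. exact: tame_mutate. Qed.
Let skB' : skew_symmetrisable (mutate_matrix k B). Proof. by case: tB'. Qed.

Lemma diagram_diag i : G i i = 0%N.
Proof. by rewrite diagram_le0 // (skew_diag skB). Qed.

Lemma diagram_diag' i : G' i i = 0%N.
Proof. by rewrite diagram_le0 // (skew_diag skB'). Qed.

(** The cycle is one of [G]. Vertices other than [u0] commute with [t k], so on [c] the new elements
    are either the old ones or their simultaneous conjugates by [t k]. *)
Lemma outside_few_neighbours c u0 : k \notin c ->
  {in c, forall v, joined G k v -> v = u0} ->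
  induced_cycle G' c -> path.cycle (arrow G') c ->
  commuting_weights (weights_along G' c) -> commutes_around t' c.
Proof.
move=> kc few cG' or' cw.
have neq_k v : v \in c -> v != k by apply: contraTneq => ->.
have agree : {in c &, G' =2 G}.
  move=> u v uc vc; have [->|uv] := eqVneq u v.
    by rewrite diagram_diag diagram_diag'.
  apply: mutate_diagram_disjoint; rewrite ?neq_k //.
  apply: contraNN uv => /andP[/(few _ uc)-> /(few _ vc)->] //.
have cG : induced_cycle G c.
  by apply: eq_induced_cycle cG' => u v uc vc; rewrite /joined /arrow !agree.
have wE := eq_weights_along agree.
have : commutes_around t c.
  by apply: (refl_cycle rf cG); rewrite -?weights_along_gt0 -wE ?weights_along_gt0.
case: c {kc cG' or' cw agree cG wE} few neq_k => // x p few neq_k.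
rewrite /commutes_around; have [u0k|u0k] := boolP (arrow G u0 k).
  have t'E v : v \in x :: p -> t' v = t v ^ t k.
    move=> vc; rewrite /mutate_reflections; case: ifP => // vk.
    rewrite conj_commute //; apply: (refl_unjoined cox).
    rewrite /joined vk /=; apply/negP => kv; move: vk.
    by rewrite (few v vc) ?u0k // /joined kv.
  rewrite t'E ?mem_head // (@eq_palindrome _ _ t' (fun v => t v ^ t k)); last first.
    by move=> v vp; rewrite t'E // inE vp orbT.
  by rewrite palindrome_conj => h; apply/commuteJ.
have t'E v : v \in x :: p -> t' v = t v.
  move=> vc; rewrite /mutate_reflections; case: ifP => // vk.
  by move: u0k; rewrite -(few v vc) ?vk // /joined vk orbT.
rewrite t'E ?mem_head // (@eq_palindrome _ _ t' t) //.
by move=> v vp; rewrite t'E // inE vp orbT.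
Qed.

Lemma outside_orientation z u : arrow G' z u -> joined G' k z -> joined G' k u ->
  arrow G' k z /\ arrow G' u k.
Proof.
move=> zu; have par := tame_parallel tB'.
case/orP=> a; case/orP=> b //.
- by rewrite (par _ _ _ a zu) in b.
- by move: (par _ _ _ a b); rewrite zu.
- by rewrite (par _ _ _ zu b) in a.
Qed.

(* Two consecutive neighbours of k on the cycle close up to a chordless cycle
   through k, which has to be oriented. *)
Lemma next_neighbour u p : k \notin u :: p -> induced_cycle G' (u :: p) ->
  path.cycle (arrow G') (u :: p) -> joined G' k u -> has (joined G' k) p ->
  (exists q z, [/\ p = rcons q z, joined G' k z &
                  {in q, forall l, ~~ joined G' k l}]) \/
  arrow G' k u /\ exists y p1 p2, p = p1 ++ y :: p2 /\ arrow G' y k.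
Proof.
move=> kc cG' or' ku hasp.
set i := find (joined G' k) p; have ip : (i < size p)%N by rewrite -has_find.
pose y := nth u p i; pose p1 := take i p.
have [p2 pE] : exists p2, p = p1 ++ y :: p2.
  by exists (drop i.+1 p); rewrite -drop_nth // cat_take_drop.
have ky : joined G' k y by apply: nth_find.
have p1n : {in p1, forall l, ~~ joined G' k l}.
  move=> l /(nthP u)[m]; rewrite size_take ip => mi; rewrite nth_take // => <-.
  by rewrite before_find.
(* If the next neighbour is the last vertex, it is adjacent to [u] on the cycle, and the arc between
   them does not give a chordless cycle through [k]. *)
case: p2 pE => [|v p2'] pE.
  by left; exists p1, y; rewrite -cats1.
right; set s := u :: rcons p1 y.
have ups : u :: p = s ++ v :: p2' by rewrite pE /= -cats1 -catA.
have [s2 Uc adj] := cG'; have Us : uniq (k :: s).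
  have: uniq (k :: u :: p) by rewrite cons_uniq kc.
  by rewrite ups -cat_cons cat_uniq => /andP[].
have cs : induced_cycle G' (k :: s).
  apply: induced_cycle_cons => //; first by rewrite /= size_rcons.
    move=> x0 a b /andP[ab bs]; have := adj x0 a b.
    rewrite ups !nth_cat bs (ltn_trans ab bs) size_cat ab ltn_addr //= => -> //.
    by rewrite -[RHS]orbF; congr (_ || _); move: bs; rewrite /= size_rcons; lia.
  move=> l; rewrite /s /= last_rcons inE mem_rcons inE.
  case: (eqVneq l u) => [->|_] /=; first by rewrite ku.
  case: (eqVneq l y) => [->|_] /=; first by rewrite ky.
  by move=> lp; apply/negbTE/p1n.
have sE : path.cycle (arrow G') (k :: s) -> arrow G' k u /\ arrow G' y k.
  by rewrite /s /= rcons_path last_rcons => /and3P[].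
case: (tame_cycle tB' cs) => /cycle_weights_gt0; rewrite weights_along_gt0.
  by move/sE => [ku' yk]; split=> //; exists y, p1, (v :: p2').
rewrite rev_cycle /s => /=; move: or'; rewrite /= pE.
case: (p1) => [|l p1'] /= /andP[ul _] /and3P[_ lu _].
  by rewrite (arrow_asym skB' ul) in lu.
by rewrite (arrow_asym skB' ul) in lu.
Qed.

(** From a neighbour [u] of [k], either the next neighbour along [c] is the predecessor of [u], or
    [k -> u] and that neighbour has an arrow to [k]. The second alternative cannot recur at the
    vertex reached, so there the first holds: [k] has just two neighbours on [c], and they are
    adjacent. *)
Lemma outside_neighbours c : k \notin c -> induced_cycle G' c ->
  path.cycle (arrow G') c ->
  (exists u0, {in c, forall v, joined G k v -> v = u0}) \/
  exists m w u q, [/\ rot m c = [:: w, u & q], arrow G' k w, arrow G' u k &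
    {in q, forall l, ~~ joined G' k l}].
Proof.
move=> kc cG' or'.
have few c' u0 : {in c', forall v, ~~ joined G' k v} ->
    {in u0 :: c', forall v, joined G k v -> v = u0}.
  move=> h v; rewrite inE => /orP[/eqP//|vc]; rewrite -joined_mutate //.
  by rewrite (negPf (h v vc)).
have [hasc|hasc] := boolP (has (joined G' k) c); last first.
  case: c hasc {kc cG' or'} => [|x p] hasc; first by left; exists k.
  left; exists x; apply: few => v vp; apply: contra hasc => kv.
  by apply/hasP; exists v; rewrite ?inE ?vp ?orbT.
have [u uc ku] := hasP hasc; have [m p mE] := rot_to uc.
have [hasp|hasp] := boolP (has (joined G' k) p); last first.
  left; exists u => v vc; apply: (few p); last by rewrite -mE mem_rot.
  by move=> l lp; apply: contra hasp => kl; apply/hasP; exists l.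
right; have kup : k \notin u :: p by rewrite -mE mem_rot.
have cGu : induced_cycle G' (u :: p) by rewrite -mE; apply: induced_cycle_rot.
have oru : path.cycle (arrow G') (u :: p) by rewrite -mE rot_cycle.
suff [m' [z [y [q [E zy kz ky qn]]]]] : exists m' z y q,
    [/\ rot m' (u :: p) = y :: rcons q z, arrow G' z y, joined G' k z,
        joined G' k y & {in q, forall l, ~~ joined G' k l}].
  have [l lE] := rot_rot_exists c m' m.
  have [l' lE'] := rot_rot_exists c (size (y :: q)) l.
  exists l', z, y, q; rewrite -lE' -lE mE E; have [] := outside_orientation zy kz ky.
  by split=> //; rewrite -rcons_cons -cats1 rot_size_cat.
have [[q [z [pE kz qn]]]|[ku' [y [p1 [p2 [pE yk]]]]]] :=
  next_neighbour kup cGu oru ku hasp.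
  exists 0%N, z, u, q; rewrite rot0 pE; split=> //.
  by move: oru; rewrite pE /= rcons_path last_rcons => /andP[].
pose m1 := size (u :: p1).
have rE : rot m1 (u :: p) = y :: (p2 ++ u :: p1).
  by rewrite pE -cat_cons rot_size_cat.
have [|||||[q [z [qE kz qn]]]|[ky _]] := @next_neighbour y (p2 ++ u :: p1).
- by rewrite -rE mem_rot.
- by rewrite -rE; apply: induced_cycle_rot.
- by rewrite -rE rot_cycle.
- by rewrite /joined yk orbT.
- by rewrite has_cat /= ku orbT.
- exists m1, z, y, q; rewrite rE qE; split=> //.
    have : path.cycle (arrow G') (rot m1 (u :: p)) by rewrite rot_cycle.
    by rewrite rE qE /= rcons_path last_rcons => /andP[].
  by rewrite /joined yk orbT.
by rewrite (arrow_asym skB' yk) in ky.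
Qed.

End MutateOutside.

(** * Cycles with two adjacent neighbours of the vertex of mutation *)

Section MutateAdjacent.
Local Open Scope group_scope.
Variables (n : nat) (H : groupType) (B : 'M[int]_n) (t : 'I_n -> H) (k : 'I_n).
Implicit Types (i j x y z : 'I_n) (c p q : seq 'I_n).
Local Notation G := (diagram_of B).
Local Notation G' := (diagram_of (mutate_matrix k B)).
Hypotheses (tB : tame B) (rf : reflection_family G t).
Local Notation t' := (mutate_reflections B t k).

Let skB : skew_symmetrisable B. Proof. by case: tB. Qed.
Let cox : coxeter_family G t. Proof. by case: rf. Qed.
Let tt := refl_invol cox.
Let tB' : tame (mutate_matrix k B). Proof. exact: tame_mutate. Qed.
Let skB' : skew_symmetrisable (mutate_matrix k B). Proof. by case: tB'. Qed.

Section Adjacent.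
Variables (w u : 'I_n) (q : seq 'I_n).
Hypotheses (kc : k \notin [:: w, u & q]) (cG' : induced_cycle G' [:: w, u & q])
  (or' : path.cycle (arrow G') [:: w, u & q]) (kw' : arrow G' k w)
  (uk' : arrow G' u k) (kq : {in q, forall l, ~~ joined G' k l}).

Let wk : arrow G w k. Proof. by rewrite -(arrow_mutate_l k tB). Qed.
Let ku : arrow G k u. Proof. by rewrite -(arrow_mutate_r k tB). Qed.
Let wu' : arrow G' w u. Proof. by move: or' => /= /andP[]. Qed.

Let q_gt0 : (0 < size q)%N. Proof. by have [] := cG'. Qed.

Let neq_k v : v \in [:: w, u & q] -> v != k.
Proof. by apply: contraTneq => ->. Qed.

Lemma adjacent_joined v : v \in [:: w, u & q] -> joined G k v = (v == w) || (v == u).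
Proof.
rewrite -joined_mutate // !inE; case: eqP => [-> _|_] /=; first by rewrite /joined kw'.
by case: eqP => [-> _|_] /=; [rewrite /joined uk' orbT | move=> /kq/negPf].
Qed.

Lemma adjacent_agree a b : a \in [:: w, u & q] -> b \in [:: w, u & q] ->
  ~~ ((a == w) && (b == u)) -> ~~ ((a == u) && (b == w)) -> G' a b = G a b.
Proof.
move=> ac bc ab ba; have [->|ne] := eqVneq a b.
  by rewrite (diagram_diag tB) (diagram_diag' k tB).
apply: mutate_diagram_disjoint; rewrite ?neq_k // !adjacent_joined //.
by move: ab ba ne; do 4!case: eqP => // ?; subst; rewrite ?eqxx.
Qed.

Let Uc : uniq [:: w, u & q]. Proof. by case: cG'. Qed.

(** Otherwise [G] has the arrow [u -> w] while the other arrows of the cycle are as in [G'], which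
    makes a chordless cycle that is not oriented. *)
Lemma adjacent_unjoined : G w u = 0%N /\ G u w = 0%N.
Proof.
have := mutate_diagram_passE tB' uk' kw'; rewrite mutate_matrixK // wu' => -[guw gwu].
split=> //; rewrite guw; case: and3P => // h.
have uw : arrow G u w by rewrite /arrow guw; case: and3P.
have [l [r qE]] : exists l r, q = l :: r.
  by case: (q) q_gt0 => // l r _; exists l, r.
have lc : l \in [:: w, u & q] by rewrite qE !inE eqxx !orbT.
have ul : arrow G u l.
  have := or'; rewrite qE /= => /and3P[_ + _].
  have [/negPf lw /negPf lu] : l != w /\ l != u.
    have := Uc; rewrite qE /= !inE !negb_or => /and3P[/and3P[_ + _] /andP[+ _] _].
    by rewrite ![_ == l]eq_sym.
  by rewrite /arrow adjacent_agree ?inE ?eqxx ?orbT //= ?lw ?lu ?andbF.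
have cG : induced_cycle G [:: w, u & q].
  apply: eq_induced_cycle cG' => a b ac bc.
  have [/andP[/eqP-> /eqP->]|ab] := boolP ((a == w) && (b == u)).
    by rewrite /joined wu' uw orbT.
  have [/andP[/eqP-> /eqP->]|ba] := boolP ((a == u) && (b == w)).
    by rewrite /joined wu' uw orbT.
  by rewrite /joined /arrow !adjacent_agree // andbC.
case: (tame_cycle tB cG) => /cycle_weights_gt0; rewrite weights_along_gt0.
  by rewrite /= {1}/arrow gwu.
by rewrite rev_cycle qE /= => /and3P[_ lu _]; rewrite (arrow_asym skB ul) in lu.
Qed.

Lemma adjacent_induced : induced_cycle G (k :: u :: rcons q w).
Proof.
have [gwu guw] := adjacent_unjoined.
have sub v : (v \in u :: rcons q w) = (v \in [:: w, u & q]).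
  by rewrite !inE mem_rcons inE orbCA.
have [s2 _ adj] := induced_cycle_rot1 cG'.
have U1 : uniq (u :: rcons q w) by have := Uc; rewrite -(rot_uniq 1) rot1_cons.
rewrite rot1_cons in s2 adj.
apply: induced_cycle_cons.
- by rewrite /= size_rcons.
- by rewrite cons_uniq sub kc.
- move=> x0 a b /andP[ab bs]; have as_ := ltn_trans ab bs.
  have ac : nth x0 (u :: rcons q w) a \in [:: w, u & q] by rewrite -sub mem_nth.
  have bc : nth x0 (u :: rcons q w) b \in [:: w, u & q] by rewrite -sub mem_nth.
  have nu d : (d < size (u :: rcons q w))%N ->
      (nth x0 (u :: rcons q w) d == u) = (d == 0%N).
    by move=> ds; rewrite -[X in _ == X]/(nth x0 (u :: rcons q w) 0) nth_uniq.
  have nw d : (d < size (u :: rcons q w))%N ->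
      (nth x0 (u :: rcons q w) d == w) = (d.+1 == size (u :: rcons q w)).
    move=> ds; have wE : w = nth x0 (u :: rcons q w) (size (rcons q w)).
      by rewrite nth_last /= last_rcons.
    by rewrite [X in _ == X]wE nth_uniq.
  have [/andP[/eqP a0 /eqP bE]|ne] := boolP ((a == 0%N) && (b.+1 == size (u :: rcons q w))).
    have -> : nth x0 (u :: rcons q w) a = u by rewrite a0.
    have -> : nth x0 (u :: rcons q w) b = w by apply/eqP; rewrite nw // bE.
    rewrite /joined /arrow gwu guw a0; move: bE; rewrite /= size_rcons => -[->].
    by case: (size q) q_gt0.
  have := adj x0 a b; rewrite ab bs (negPf ne) orbF => <- //.
  by rewrite /joined /arrow !adjacent_agree ?nu ?nw //; move: ne ab bs; clear; lia.
move=> l ls; rewrite adjacent_joined -?sub //= last_rcons.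
by rewrite orbC.
Qed.

Lemma adjacent_weights : weights_along G' [:: w, u & q] =
  (G w k * G k u)%N :: pairmap (fun_of_matrix G) u (rcons q w).
Proof.
have [E _] := contract_last tB adjacent_induced q_gt0 wk ku.
by rewrite /= E (contract_pairmap tB adjacent_induced q_gt0).
Qed.

Lemma adjacent_induced_head : induced_cycle G [:: w, k, u & q].
Proof.
have := induced_cycle_rot (size (k :: u :: rcons q w) - 1) adjacent_induced.
by rewrite -!rcons_cons -/(rotr _ _) rotr1_rcons.
Qed.

Lemma adjacent_oriented : path.cycle (arrow G) [:: w, k, u & q].
Proof.
have := or'; rewrite -!weights_along_gt0 adjacent_weights /= muln_gt0.
by case/andP=> /andP[-> ->] ->.
Qed.

(** In the relation at [w] of the cycle of [G] with [k] inserted, the palindrome is conjugated by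
    [t k]; moving this conjugation to the other side gives [t' w]. *)
Lemma adjacent_commuting : commuting_somewhere B t k [:: w, u & q].
Proof.
have t'w : t' w = t w ^ t k by rewrite /mutate_reflections wk.
have t'u : t' u = t u.
  by rewrite /mutate_reflections (arrow_asym skB ku).
have t'q l : l \in q -> t' l = t l.
  by move=> lq; apply: mutate_reflections_unjoined; rewrite -joined_mutate // kq.
have [cw|ncw] := boolP (commuting_weights (weights_along G [:: w, k, u & q])).
  exists 0%N; rewrite rot0; split.
    rewrite adjacent_weights; move: cw; rewrite /commuting_weights /=.
    move: q_gt0; case: (q) => // l r _ /=.
    by case/orP=> [/and3P[/eqP-> /eqP-> ->]//|->]; rewrite orbT.
  have := refl_cycle rf adjacent_induced_head adjacent_oriented cw.
  rewrite /commutes_around t'w palindrome_cons // => h.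
  rewrite (@eq_palindrome _ _ t' t); first exact/commuteJl.
  by move=> v; rewrite inE => /orP[/eqP->|/t'q].
(* Here the cycle of [G] has exponent 3 at [w]; its relation at [k] has exponent 2 and yields that
   of the triangle in [G'] based at [u]. *)
have E : weights_along G [:: w, k, u & q] = [:: 2; 1; 2; 1]%N.
  have [E|//] :=
    noncommuting_weights (oriented_weights tB adjacent_induced_head adjacent_oriented) ncw.
  have := congr1 size E; rewrite size_weights_along /= => -[qs].
  by have := q_gt0; rewrite qs.
have [_ [_ [_ [l [[<- <- <- qE] [gwk gku gul glw]]]]]] := weights_along4 E.
have lq : l \in q by rewrite qE mem_head.
exists 1%N; rewrite weights_along_rot adjacent_weights gwk gku qE /= gul glw.
split=> //; rewrite t'u t'w (t'q _ lq).
have lk : commute (t l) (t k).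
  by apply: (refl_unjoined cox); rewrite joined_sym -joined_mutate // kq.
have ulw : commute (t k) ((t w ^ t l) ^ t u).
  have := refl_cycle rf (induced_cycle_rot1 adjacent_induced_head).
  rewrite rot_cycle weights_along_rot E qE /=; apply=> //.
  by have := adjacent_oriented; rewrite qE.
rewrite conjg_comm; last exact: commute_sym.
apply/commuteJl => //.
rewrite -(refl_braid tB cox (arrow_weight tB gku)).
exact/commuteJl.
Qed.

End Adjacent.

Theorem mutate_reflection_family : reflection_family G' t'.
Proof.
split=> [|c cG' or' cw]; first exact: mutate_coxeter.
suff [m [cwm com]] : commuting_somewhere B t k c.
  have := @commutes_around_rot _ _ _ _ tB' (mutate_coxeter k tB rf) (size c - m)
    (rot m c) (induced_cycle_rot m cG').
  rewrite rot_cycle -(size_rot m c) -/(rotr m (rot m c)) rotK.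
  by move=> /(_ or' cwm cw com).
have [kc|kc] := boolP (k \in c).
  have [m p mE] := rot_to kc.
  have cGk : induced_cycle G' (k :: p) by rewrite -mE; apply: induced_cycle_rot.
  have ork : path.cycle (arrow G') (k :: p) by rewrite -mE rot_cycle.
  (* The first rotation brings [k] to the front, the second puts its predecessor [i] before it. *)
  apply: (@commuting_somewhere_rot _ _ _ _ _ m).
  apply: (@commuting_somewhere_rot _ _ _ _ _ (size (rot m c) - 1)).
  rewrite -/(rotr 1 (rot m c)) mE.
  move: cGk (induced_cycle_rot (size (k :: p) - 1) cGk) ork.
  rewrite -(rot_cycle (size (k :: p) - 1)) -/(rotr 1 (k :: p)).
  case/lastP: p mE => [|p i] mE [] // _ _ _; rewrite -rcons_cons rotr1_rcons.
  case: p mE => [|j q] mE; first by case.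
  move=> cGi ori; have [q0|q0] := posnP (size q).
    by have := through_triangle tB rf ori (size0nil q0); rewrite (size0nil q0).
  exact: through_long.
have [[u0 few]|[m [w [u [q [mE kw uk kq]]]]]] := outside_neighbours tB kc cG' or'.
  exists 0%N; rewrite rot0; split=> //.
  exact: (outside_few_neighbours tB rf kc few).
apply: (@commuting_somewhere_rot _ _ _ _ _ m); rewrite mE.
apply: adjacent_commuting => //; rewrite -mE ?mem_rot ?rot_cycle //.
exact: induced_cycle_rot.
Qed.

End MutateAdjacent.

(** * Isomorphisms between the groups W *)

Section Isomorphic.
Local Open Scope group_scope.

Lemma group_isomorphic_morph (G H : groupType) (f : G -> H) :
  {morph f : x y / x * y} -> bijective f -> group_isomorphic G H.
Proof.
move=> fM fb.
pose F : {multiplicative G -> H} := HB.pack f (isMultiplicative.Build G H f fM).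
by exists F.
Qed.

Lemma group_isomorphic_refl (G : groupType) : group_isomorphic G G.
Proof. by apply: (@group_isomorphic_morph _ _ id) => //; exists id. Qed.

Lemma group_isomorphic_sym (G H : groupType) :
  group_isomorphic G H -> group_isomorphic H G.
Proof.
move=> [f [g fK gK]]; apply: (@group_isomorphic_morph _ _ g); last by exists f.
exact: can2_gmulfM.
Qed.

Lemma group_isomorphic_trans (G H K : groupType) :
  group_isomorphic G H -> group_isomorphic H K -> group_isomorphic G K.
Proof.
move=> [f fb] [g gb]; apply: (@group_isomorphic_morph _ _ (g \o f)).
  by move=> x y /=; rewrite !gmulfM.
exact: bij_comp.
Qed.

End Isomorphic.

Section GroupMorphisms.
Local Open Scope group_scope.
Variables (G H : groupType) (f : G -> H).
Hypothesis fM : {morph f : x y / x * y}.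

Lemma morph_one : f 1 = 1.
Proof. by apply: (mulgI (f 1)); rewrite -fM !mulg1. Qed.

Lemma morph_inv x : f x^-1 = (f x)^-1.
Proof. by apply: (mulgI (f x)); rewrite -fM !mulgV morph_one. Qed.

Lemma morph_conj x y : f (x ^ y) = f x ^ f y.
Proof. by rewrite !conjgE !fM morph_inv. Qed.

End GroupMorphisms.

Section PresentedGroups.
Local Open Scope group_scope.
Variables (n : nat) (G : diagram n).

Definition W_word (w : word 'I_n) : W G := (\pi_(presented_group (W_relator G)) w)%qT.
Definition W_gen (i : 'I_n) : W G := W_word [:: (i, false)].

Lemma W_wordP (P : W G -> Prop) : (forall w, P (W_word w)) -> forall g, P g.
Proof. exact: presW. Qed.

Lemma W_word_cat u v : W_word (u ++ v) = W_word u * W_word v.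
Proof. exact/esym/pres_mulE. Qed.

Lemma W_wordE w : W_word w = eval_word W_gen w.
Proof.
elim: w => [//|[i b] w IH]; rewrite -cat1s W_word_cat IH /=; congr (_ * _).
case: b => //; exact: (esym (pres_invE (W_relator G) [:: (i, false)])).
Qed.

Lemma W_gen_relators : satisfies_relators G W_gen.
Proof.
move=> w Rw; rewrite -W_wordE; apply/eqP/presP.
by have := @PresRel _ _ [::] w [::] Rw; rewrite /= !cats0.
Qed.

Variables (H : groupType) (t : 'I_n -> H).
Hypothesis tR : satisfies_relators G t.

Definition W_hom (g : W G) : H :=
  eval_word t (repr (g : presented_group (W_relator G))).

Lemma eval_word_pres v w : pres_eq (W_relator G) v w -> eval_word t v = eval_word t w.
Proof.
elim=> {v w} [//|v w _ ->//|u v w _ -> _ ->//|u [i b] v|u r v Rr].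
  rewrite !eval_word_cat; congr (_ * _); rewrite /= mulgA.
  by case: b => /=; rewrite ?mulgV ?mulVg mul1g.
by rewrite !eval_word_cat (tR Rr) mul1g.
Qed.

Lemma W_homE w : W_hom (W_word w) = eval_word t w.
Proof. by apply: eval_word_pres; apply: pres_repr. Qed.

Lemma W_homM : {morph W_hom : g h / g * h}.
Proof.
move=> g h; elim/W_wordP: g => u; elim/W_wordP: h => v.
by rewrite -W_word_cat !W_homE eval_word_cat.
Qed.

Lemma W_hom_gen i : W_hom (W_gen i) = t i.
Proof. by rewrite W_homE /= mulg1. Qed.

End PresentedGroups.

Section MorphismsOutOfW.
Local Open Scope group_scope.

Lemma morph_W_word n (G : diagram n) (H : groupType) (f : W G -> H) :
  {morph f : x y / x * y} -> forall w, f (W_word G w) = eval_word (f \o @W_gen n G) w.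
Proof.
move=> fM w; elim: w => [|[i b] w IH]; first exact: (morph_one fM).
rewrite -cat1s W_word_cat fM IH /=; congr (_ * _); case: b => //.
by rewrite -(morph_inv fM) W_wordE /= mulg1.
Qed.

Lemma morph_W_eq n (G : diagram n) (H : groupType) (f g : W G -> H) :
  {morph f : x y / x * y} -> {morph g : x y / x * y} ->
  (forall i, f (W_gen G i) = g (W_gen G i)) -> f =1 g.
Proof.
move=> fM gM fg x; elim/W_wordP: x => w; rewrite !morph_W_word //.
by elim: w => //= -[i b] w ->; rewrite /= fg.
Qed.

(** Each neighbour of [k] is conjugated by exactly one of the two mutations, and the generators not
    joined to [k] commute with that at [k]. So both composites are conjugation by the generator at
    [k], an involution, which corrects [g] to an inverse of [f]. *)
Lemma mutate_W_isomorphic n (B : 'M[int]_n) (k : 'I_n) : tame B ->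
  group_isomorphic (W (diagram_of B)) (W (diagram_of (mutate_matrix k B))).
Proof.
have fam (B0 : 'M[int]_n) : tame B0 -> reflection_family (diagram_of B0) (@W_gen n (diagram_of B0)).
  by move=> tB0; apply/relators_reflection_family/W_gen_relators.
have back (B0 : 'M[int]_n) (tB0 : tame B0) :
    satisfies_relators (diagram_of (mutate_matrix k B0))
      (mutate_reflections B0 (@W_gen n (diagram_of B0)) k).
  apply: reflection_family_relators; first exact: tame_mutate.
  exact/mutate_reflection_family/fam.
move=> tB; set B1 := mutate_matrix k B.
have tB1 : tame B1 by apply: tame_mutate.
have B1K : mutate_matrix k B1 = B by apply: mutate_matrixK.
have hom (B0 B2 : 'M[int]_n) (tB0 : tame B0) : mutate_matrix k B0 = B2 ->
    {f : W (diagram_of B2) -> W (diagram_of B0) |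
      {morph f : x y / x * y} & forall i, f (W_gen _ i) =
        mutate_reflections B0 (@W_gen n (diagram_of B0)) k i}.
  move=> <-; exists (W_hom (mutate_reflections B0 (@W_gen n (diagram_of B0)) k)).
    exact/W_homM/back.
  exact/W_hom_gen/back.
have [f fM fg] := hom B B1 tB erefl; have [g gM gg] := hom B1 B tB1 B1K.
have comp (B0 B2 : 'M[int]_n) (tB0 : tame B0)
    (f0 : W (diagram_of B2) -> W (diagram_of B0))
    (g0 : W (diagram_of B0) -> W (diagram_of B2)) :
    mutate_matrix k B0 = B2 ->
    {morph f0 : x y / x * y} -> {morph g0 : x y / x * y} ->
    (forall i, f0 (W_gen _ i) = mutate_reflections B0 (@W_gen n (diagram_of B0)) k i) ->
    (forall i, g0 (W_gen _ i) = mutate_reflections B2 (@W_gen n (diagram_of B2)) k i) ->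
    forall x, f0 (g0 x) = x ^ W_gen (diagram_of B0) k.
  move=> E; case: B2 / E f0 g0 => f0 g0.
  move=> f0M g0M f0g g0g; apply: morph_W_eq.
  - by move=> x y; rewrite g0M f0M.
  - by move=> x y; rewrite conjMg.
  have [[cox _] [sk0 _]] := (fam _ tB0, tB0).
  move=> i; rewrite g0g {1}/mutate_reflections arrow_mutate_r //.
  have kE : f0 (W_gen _ k) = W_gen _ k by rewrite f0g mutate_reflections_k.
  case: ifPn => ki.
    rewrite (morph_conj f0M) kE f0g /mutate_reflections.
    by rewrite (arrow_asym sk0 ki).
  rewrite f0g /mutate_reflections; case: ifPn => // ik.
  by rewrite conj_commute //; apply: (refl_unjoined cox); rewrite /joined negb_or ik.
have fgE := comp B B1 tB f g erefl fM gM fg gg.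
have gfE := comp B1 B tB1 g f B1K gM fM gg fg.
apply: group_isomorphic_sym; apply: (group_isomorphic_morph fM).
have [cox _] := fam B tB; have ss := refl_invol cox k.
exists (fun x => g (x ^ W_gen _ k)) => [y|x].
  rewrite (morph_conj gM) gfE gg mutate_reflections_k // conj_invol //.
  by have [cox1 _] := fam B1 tB1; apply: (refl_invol cox1).
by rewrite fgE conj_invol.
Qed.

End MorphismsOutOfW.

(** * Relabelling the vertices *)

Section Relabelling.
Variables (n : nat) (G G1 : diagram n) (sigma : 'I_n -> 'I_n).
Hypotheses (sigma_inj : injective sigma)
  (G1E : forall i j, G1 i j = G (sigma i) (sigma j)).

Definition relabel_word (w : word 'I_n) : word 'I_n :=
  [seq (sigma l.1, l.2) | l <- w].

Lemma relabel_pow_word w m :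
  relabel_word (pow_word w m) = pow_word (relabel_word w) m.
Proof.
by rewrite /pow_word /relabel_word map_flatten; congr flatten; elim: m => //= m ->.
Qed.

Lemma relabel_gens c : relabel_word (gens c) = gens (map sigma c).
Proof. by rewrite /relabel_word /gens -!map_comp. Qed.

Lemma relabel_chordless c : chordless_cycle G1 c -> chordless_cycle G (map sigma c).
Proof.
case=> s2 Uc or adj; split; rewrite ?size_map ?map_inj_uniq //.
  rewrite cycle_map; apply: sub_cycle or => x y /=.
  by rewrite /arrow G1E.
move=> _ _ /mapP[x xc ->] /mapP[y yc ->] xy.
rewrite !next_map // !(inj_eq sigma_inj); apply: adj => //.
by move: xy; rewrite /joined /arrow !G1E.
Qed.

Lemma relabel_weight i j : edge_weight G (sigma i) (sigma j) = edge_weight G1 i j.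
Proof. by rewrite /edge_weight !G1E. Qed.

Lemma relabel_cycle_word c i :
  relabel_word (cycle_word c i) = cycle_word (map sigma c) (sigma i).
Proof.
rewrite /cycle_word relabel_gens index_map // -map_rot map_cat.
by rewrite -behead_map map_rev -behead_map.
Qed.

Lemma relabel_relator w : W_relator G1 w -> W_relator G (relabel_word w).
Proof.
case=> [i|i j ij|c i chc w1 ic|c i chc w2 ic]; rewrite relabel_pow_word.
- by rewrite relabel_gens; apply: R1.
- rewrite relabel_gens [coxeter_exponent _ _ _](_ : _ = coxeter_exponent G (sigma i) (sigma j)).
    by apply: R2; rewrite (inj_eq sigma_inj).
  by rewrite /coxeter_exponent relabel_weight.
- have [_ Uc _ _] := chc; rewrite relabel_cycle_word; apply: R3a; last exact: map_f.
    exact: relabel_chordless.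
  move=> _ /mapP[j jc ->]; rewrite next_map // relabel_weight; exact: w1.
have [_ Uc _ _] := chc; rewrite relabel_cycle_word -relabel_weight -prev_map //.
apply: R3b; [exact: relabel_chordless| |exact: map_f].
have [j jc w2'] := w2; exists (sigma j); first exact: map_f.
by rewrite next_map // relabel_weight.
Qed.

Lemma eval_relabel_word (H : groupType) (t : 'I_n -> H) w :
  eval_word t (relabel_word w) = eval_word (t \o sigma) w.
Proof. by elim: w => //= -[i b] w ->. Qed.

Lemma relabel_relators (H : groupType) (t : 'I_n -> H) :
  satisfies_relators G t -> satisfies_relators G1 (t \o sigma).
Proof. by move=> tR w /relabel_relator/tR; rewrite eval_relabel_word. Qed.

End Relabelling.

Lemma relabel_W_isomorphic n (G G1 : diagram n) (sigma : 'S_n) :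
  (forall i j, G1 i j = G (sigma i) (sigma j)) -> group_isomorphic (W G1) (W G).
Proof.
move=> G1E.
have GE i j : G i j = G1 ((sigma^-1)%g i) ((sigma^-1)%g j) by rewrite G1E !permKV.
have R1 := relabel_relators (perm_inj (s := sigma)) G1E (@W_gen_relators _ G).
have R2 := relabel_relators (perm_inj (s := sigma^-1%g)) GE (@W_gen_relators _ G1).
apply: (group_isomorphic_morph (W_homM R1)); exists (W_hom (@W_gen n G1 \o (sigma^-1)%g)).
  apply: morph_W_eq => // [x y|i]; first by rewrite (W_homM R1) (W_homM R2).
  by rewrite (W_hom_gen R1) /= (W_hom_gen R2) /= permK.
apply: morph_W_eq => // [x y|i]; first by rewrite (W_homM R2) (W_homM R1).
by rewrite (W_hom_gen R2) /= (W_hom_gen R1) /= permKV.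
Qed.

(** * Faithfulness of the reflection representation *)

Definition reflection_mx n (A : 'M[int]_n) (i : 'I_n) : 'M[rat]_n :=
  \matrix_(k, j) ((k == j)%:R - (k == i)%:R * (A i j)%:~R).

Definition simple_root n (i : 'I_n) : 'cV[rat]_n := delta_mx i 0.

Definition bond_order (w : int) : nat :=
  match w with
  | Posz 0 => 2 | Posz 1 => 3 | Posz 2 => 4 | Posz 3 => 6 | _ => 0
  end.

(** A generalised Cartan matrix all of whose rank two subsystems are finite. *)
Record cartan_like n (A : 'M[int]_n) : Prop := CartanLike {
  cartan_like_diag : forall i, A i i = 2;
  cartan_like_le0 : forall i j, i != j -> A i j <= 0;
  cartan_like_eq0 : forall i j, A i j = 0 -> A j i = 0;
  cartan_like_le3 : forall i j, i != j -> A i j * A j i <= 3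
}.

Lemma cartan_like_cases n (A : 'M[int]_n) i j : cartan_like A -> i != j ->
  exists p r : nat, [/\ A i j = - p%:Z, A j i = - r%:Z &
    (p, r) \in [:: (0, 0); (1, 1); (1, 2); (2, 1); (1, 3); (3, 1)]%N].
Proof.
move=> cA ij; have ji : j != i by rewrite eq_sym.
move: (cartan_like_le0 cA ij) (cartan_like_le0 cA ji) (cartan_like_le3 cA ij)
  (@cartan_like_eq0 _ _ cA i j) (@cartan_like_eq0 _ _ cA j i).
move: (A i j) (A j i) => [[|p]|p] [[|r]|r] //= _ _ pr eq0 eq0'.
- by exists 0%N, 0%N.
- by have := eq0 erefl.
- by have := eq0' erefl.
exists p.+1, r.+1; split=> //.
have {pr} : (p.+1 * r.+1 <= 3)%N by lia.
by case: p {eq0 eq0'} => [|[|[|p]]]; case: r => [|[|[|r]]] //; lia.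
Qed.

Section Reflections.
Variables (n : nat) (A : 'M[int]_n).
Hypothesis cA : cartan_like A.
Local Notation S := (reflection_mx A).
Local Notation alpha := (@simple_root n).

Lemma reflection_root i j : S i *m alpha j = alpha j - (A i j)%:~R *: alpha i.
Proof.
apply/colP => k; rewrite !mxE (bigD1 j) //= big1 => [|l lj]; last first.
  by rewrite !mxE (negPf lj) mulr0.
rewrite !mxE !eqxx !andbT mulr1 addr0; congr (_ - _).
by rewrite mulrC.
Qed.

(* The coordinates on alpha i and alpha j after applying q reflections to
   x alpha i + y alpha j, alternately at i and j and first at j if b holds. *)
Fixpoint alternate_coords (p r : int) (q : nat) (b : bool) (x y : int) : int * int :=
  if q is q'.+1 then
    if b then alternate_coords p r q' false x (r * x - y)
    else alternate_coords p r q' true (p * y - x) y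
  else (x, y).

(** Built from its last letter [x], since in a product acting on columns the last factor acts
    first. *)
Fixpoint alternating (T : Type) (x y : T) (q : nat) : seq T :=
  if q is q'.+1 then rcons (alternating y x q') x else [::].

Lemma alternate_coordsP i j (p r : int) q b x y : i != j ->
  A i j = - p -> A j i = - r ->
  let w := if b then alternating j i q else alternating i j q in
  let xy := alternate_coords p r q b x y in
  (\prod_(k <- w) S k) *m (x%:~R *: alpha i + y%:~R *: alpha j) =
  xy.1%:~R *: alpha i + xy.2%:~R *: alpha j.
Proof.
move=> ij Aij Aji.
have Sj x0 y0 : S j *m (x0%:~R *: alpha i + y0%:~R *: alpha j) =
    x0%:~R *: alpha i + (r * x0 - y0)%:~R *: alpha j.
  rewrite mulmxDr -!scalemxAr !reflection_root Aji (cartan_like_diag cA).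
  by apply/colP => k; rewrite !mxE !rmorphB !rmorphM !rmorphN /=; ring.
have Si x0 y0 : S i *m (x0%:~R *: alpha i + y0%:~R *: alpha j) =
    (p * y0 - x0)%:~R *: alpha i + y0%:~R *: alpha j.
  rewrite mulmxDr -!scalemxAr !reflection_root Aij (cartan_like_diag cA).
  by apply/colP => k; rewrite !mxE !rmorphB !rmorphM !rmorphN /=; ring.
elim: q b x y => [|q IH] b x y; first by case: b; rewrite /= big_nil mul1mx.
case: b; rewrite /= big_rcons /= -mulmxA.
  by rewrite Sj; apply: (IH false).
by rewrite Si; apply: (IH true).
Qed.

(** The rank two case of Tits' argument: alternating words shorter than the dihedral order keep the
    root positive, by evaluation in the six possible cases. *)
Lemma alternate_coords_ge0 i j q : i != j ->
  (q < bond_order (A i j * A j i))%N ->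
  exists x y : int, [/\ 0 <= x, 0 <= y &
    (\prod_(k <- alternating j i q) S k) *m alpha i =
    x%:~R *: alpha i + y%:~R *: alpha j].
Proof.
move=> ij; have [p [r [pE rE pr]]] := cartan_like_cases cA ij.
rewrite pE rE mulrNN => qm.
have E := @alternate_coordsP i j p r q true 1 0 ij pE rE.
exists (alternate_coords p r q true 1 0).1, (alternate_coords p r q true 1 0).2.
rewrite -E /= scale1r scale0r addr0.
suff : (0 <= (alternate_coords p r q true 1 0).1) && (0 <= (alternate_coords p r q true 1 0).2).
  by case/andP.
move: pr qm {E pE rE}; rewrite !inE.
by case/orP=> [|/orP[|/orP[|/orP[|/orP[]]]]] /eqP[-> ->];
  case: q => [|[|[|[|[|[|q]]]]]].
Qed.

End Reflections.

Section Alternating.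
Variables (T : eqType).
Implicit Types (x y : T) (u : seq T).

Lemma size_alternating x y q : size (alternating x y q) = q.
Proof. by elim: q x y => //= q IH x y; rewrite size_rcons IH. Qed.

Lemma alternating_split x y q m :
  exists2 u, size u = q & alternating x y (q + m) = u ++ alternating x y m.
Proof.
elim: m x y => [|m IH] x y.
  by exists (alternating x y q); rewrite ?size_alternating ?addn0 ?cats0.
have [u su E] := IH y x; exists u => //.
by rewrite addnS /= E rcons_cat.
Qed.

Lemma alternating_or_repeats x y u : all (fun z => (z == x) || (z == y)) u ->
  [\/ u = alternating x y (size u), u = alternating y x (size u) |
      exists u1 z u2, u = u1 ++ [:: z, z & u2]].
Proof.
elim/last_ind: u => [|u z IH]; first by move=> _; apply: Or31.
rewrite all_rcons size_rcons => /andP[zxy /IH]; have rep x' y' q :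
    u = alternating x' y' q.+1 -> z = x' ->
    exists u1 v u2, rcons u z = u1 ++ [:: v, v & u2].
  move=> /= -> ->; exists (alternating y' x' q), x', [::].
  by rewrite -!cats1 -catA.
case=> [uE|uE|[u1 [v [u2 uE]]]].
- case/orP: zxy => /eqP zE; last by apply: Or32; rewrite zE /= {1}uE.
  case: (posnP (size u)) => [/size0nil u0|u0]; first by apply: Or31; rewrite u0 zE.
  by apply: Or33; apply: (rep x y (size u).-1); rewrite ?prednK.
- case/orP: zxy => /eqP zE; first by apply: Or31; rewrite zE /= {1}uE.
  case: (posnP (size u)) => [/size0nil u0|u0]; first by apply: Or32; rewrite u0 zE.
  by apply: Or33; apply: (rep y x (size u).-1); rewrite ?prednK.
by apply: Or33; exists u1, v, (rcons u2 z); rewrite uE rcons_cat.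
Qed.

End Alternating.

(* Tits' argument: if multiplying g by s i on the right does not shorten it then
   g maps the i-th simple root to a nonnegative combination of simple roots. *)
Section Tits.
Local Open Scope group_scope.
Variables (n : nat) (A : 'M[int]_n) (H : groupType) (s : 'I_n -> H).
Variable rho : H -> 'M[rat]_n.
Hypotheses (cA : cartan_like A) (ss : forall i, s i * s i = 1)
  (coxeter : forall i j, i != j -> (s i * s j) ^+ bond_order (A i j * A j i)%R = 1)
  (gen : forall g, exists w, g = \prod_(i <- w) s i)
  (rho1 : rho 1 = 1%:M) (rhoM : forall g h, rho (g * h) = rho g *m rho h)
  (rho_gen : forall i, rho (s i) = reflection_mx A i).
Implicit Types (g h : H) (i j : 'I_n) (w : seq 'I_n).

Let word_size g m : bool := `[< (exists2 w, g = \prod_(i <- w) s i & size w = m) >].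

Let word_sizeP g : exists m, word_size g m.
Proof. by have [w gE] := gen g; exists (size w); apply/asboolP; exists w. Qed.

Definition word_length g : nat := ex_minn (word_sizeP g).

Lemma word_lengthP g : exists2 w, g = \prod_(i <- w) s i & size w = word_length g.
Proof. by rewrite /word_length; case: ex_minnP => m /asboolP. Qed.

Lemma word_length_le w : (word_length (\prod_(i <- w) s i) <= size w)%N.
Proof.
rewrite /word_length; case: ex_minnP => m _; apply.
by apply/asboolP; exists w.
Qed.

Lemma word_lengthM g w :
  (word_length (g * \prod_(i <- w) s i) <= word_length g + size w)%N.
Proof.
have [u gE <-] := word_lengthP g.
by rewrite {1}gE -big_cat -size_cat; apply: word_length_le.
Qed.

Lemma prod_rcons w i : \prod_(k <- rcons w i) s k = (\prod_(k <- w) s k) * s i.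
Proof. by rewrite -cats1 big_cat big_seq1. Qed.

Lemma rho_prod w : rho (\prod_(i <- w) s i) = (\prod_(i <- w) reflection_mx A i)%R.
Proof.
elim: w => [|i w IH]; first by rewrite !big_nil rho1.
by rewrite !big_cons rhoM rho_gen IH.
Qed.

(** Positivity says that the default order 0 does not occur, so that the alternating words have a
    last letter. *)
Lemma braid_alternating i j : i != j ->
  let m := bond_order (A i j * A j i)%R in
  (0 < m)%N /\
  \prod_(k <- alternating j i m) s k = \prod_(k <- alternating i j m) s k.
Proof.
move=> ij; have := coxeter ij.
have [p [r [-> -> pr]]] := cartan_like_cases cA ij; rewrite mulrNN.
have even m : (s i * s j) ^+ (m + m) = 1 -> (s i * s j) ^+ m = (s j * s i) ^+ m.
  rewrite expgnDr => /mulg1_eq <-.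
  by rewrite -expVgn invgM !(involV (ss _)).
move: pr; rewrite !inE.
case/orP=> [|/orP[|/orP[|/orP[|/orP[]]]]] /eqP[-> ->] /= E; split=> //;
  rewrite !big_cons !big_nil !mulg1.
- by have := even 1%N E; rewrite !expg1.
- by have := braid3 (ss i) (ss j) E; rewrite !conjgE !(involV (ss _)) => ->.
- by have := even 2%N E; rewrite !expg2 !mulgA.
- by have := even 2%N E; rewrite !expg2 !mulgA.
- by have := even 3%N E; rewrite !expgS expg0 !mulg1 !mulgA.
by have := even 3%N E; rewrite !expgS expg0 !mulg1 !mulgA.
Qed.

Definition nonnegative (v : 'cV[rat]_n) : Prop := forall k, (0 <= v k 0)%R.

Lemma nonnegative_comb (x y : int) u v : (0 <= x)%R -> (0 <= y)%R ->
  nonnegative u -> nonnegative v -> nonnegative (x%:~R *: u + y%:~R *: v)%R.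
Proof.
by move=> x0 y0 u0 v0 k; rewrite !mxE addr_ge0 // mulr_ge0 // ler0z.
Qed.

Lemma nonnegative_root g i : (word_length g <= word_length (g * s i))%N ->
  nonnegative (rho g *m simple_root i).
Proof.
have [m] := ubnP (word_length g); elim: m g i => // m IH g i; rewrite ltnS => gm gi.
have [w0 gE w0s] := word_lengthP g.
case/lastP: w0 gE w0s => [|w0 j] gE w0s.
  by rewrite gE big_nil rho1 mul1mx => k; rewrite !mxE; case: (_ && _).
rewrite size_rcons in w0s.
have ij : i != j.
  apply/eqP => ij; move: gi; rewrite gE prod_rcons -mulgA -ij ss mulg1.
  rewrite -prod_rcons ij -gE -w0s => /leq_trans/(_ (word_length_le w0)).
  by rewrite ltnn.
(* Factor [g] as [v] times a nonempty word in [s i], [s j] with lengths adding up, and [v] as short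
   as possible. Then neither [s i] nor [s j] shortens [v], and the induction hypothesis applies to
   both simple roots. *)
pose Q p := `[< (exists v u, [/\ g = v * \prod_(k <- u) s k, word_length v = p,
   (0 < size u)%N, all (fun z => (z == i) || (z == j)) u &
   (word_length v + size u <= word_length g)%N]) >].
have exQ : exists p, Q p.
  exists (word_length (\prod_(k <- w0) s k)); apply/asboolP.
  exists (\prod_(k <- w0) s k), [:: j]; rewrite big_seq1 -prod_rcons; split=> //=.
    by rewrite eqxx orbT.
  by rewrite -w0s addn1 ltnS; apply: word_length_le.
have [p /asboolP[v [u [gvu vp u0 uij vu]]] pmin] := ex_minnP exQ.
have up x : (x == i) || (x == j) -> (word_length v <= word_length (v * s x))%N.
  move=> xij; rewrite leqNgt; apply/negP => lt.
  have : (p <= word_length (v * s x))%N.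
    apply: pmin; apply/asboolP; exists (v * s x), (x :: u); split=> //=.
    - by rewrite big_cons -mulgA [s x * (s x * _)]mulgA ss mul1g.
    - by rewrite xij.
    - by apply: leq_trans vu; rewrite addnS -addSn leq_add2r.
  by rewrite -vp leqNgt lt.
have vg : (word_length v < word_length g)%N.
  by apply: leq_trans vu; rewrite -addn1 leq_add2l.
have vi : nonnegative (rho v *m simple_root i).
  by apply: IH; [apply: leq_trans vg gm | apply: up; rewrite eqxx].
have vj : nonnegative (rho v *m simple_root j).
  by apply: IH; [apply: leq_trans vg gm | apply: up; rewrite eqxx orbT].
have short w : g = v * \prod_(k <- w) s k -> (size u <= size w)%N.
  move=> E; rewrite -(leq_add2l (word_length v)); apply: leq_trans vu _.
  by rewrite E; apply: word_lengthM.
have short_i w : g * s i = v * \prod_(k <- w) s k -> (size u <= size w)%N.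
  move=> E; rewrite -(leq_add2l (word_length v)); apply: leq_trans vu _.
  by apply: leq_trans gi _; rewrite E; apply: word_lengthM.
have no_end_i w : g = v * \prod_(k <- rcons w i) s k -> (size u <= size w)%N.
  move=> E; apply: short_i; rewrite E prod_rcons -!mulgA ss mulg1 //.
(* A repeated letter would shorten [g], and a final [i] would make [g * s i] shorter than [g]. So
   [u] alternates and ends in [j]; at the dihedral order the braid relation would let it end in
   [i]. *)
case: (alternating_or_repeats uij) => [uE|uE|[u1 [z [u2 uE]]]]; last first.
- have := short (u1 ++ u2); rewrite gvu uE !big_cat !big_cons /= [s z * (s z * _)]mulgA ss mul1g.
  by move=> /(_ erefl); rewrite !size_cat /= !addnS ltnNge leqnSn.
- have qm : (size u < bond_order (A i j * A j i)%R)%N.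
    rewrite ltnNge; apply/negP => mq.
    have [m0 br] := braid_alternating ij.
    have [u1 su1 u1E] := alternating_split j i (size u - bond_order (A i j * A j i)%R)
      (bond_order (A i j * A j i)%R).
    rewrite subnK // -uE in u1E.
    move: m0 br u1E su1; case: (bond_order _) mq => // m' mq _ br u1E su1.
    have := no_end_i (u1 ++ alternating j i m').
    rewrite gvu {1}u1E big_cat br /= !prod_rcons big_cat /= !mulgA => /(_ erefl).
    by rewrite size_cat su1 size_alternating; lia.
  have [x [y [x0 y0 E]]] := alternate_coords_ge0 cA ij qm.
  rewrite gvu uE rhoM rho_prod -mulmxA E mulmxDr -!scalemxAr.
  exact: nonnegative_comb.
case: (size u) u0 uE => // q _ uE.
have := no_end_i (alternating j i q); rewrite gvu uE => /(_ erefl).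
by rewrite /= size_rcons !size_alternating ltnn.
Qed.

(** If a reduced word of [g] ended in [i], then [g * s i] would send the i-th simple root to a
    nonnegative vector; but it acts as [s i] and sends it to its negative. *)
Theorem tits_faithful g : rho g = 1%:M -> g = 1.
Proof.
move=> g1; have [w gE sw] := word_lengthP g.
case/lastP: w gE sw => [|w i] gE sw; first by rewrite gE big_nil.
have wi : g = (\prod_(k <- w) s k) * s i by rewrite gE prod_rcons.
have : nonnegative (rho (\prod_(k <- w) s k) *m simple_root i).
  have h : (word_length (\prod_(k <- w) s k) <= word_length g)%N.
    by rewrite -sw size_rcons (leq_trans (word_length_le w)).
  by apply: nonnegative_root; rewrite wi in h.
have -> : rho (\prod_(k <- w) s k) = reflection_mx A i.
  have -> : \prod_(k <- w) s k = g * s i by rewrite wi -mulgA ss mulg1.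
  by rewrite rhoM g1 mul1mx rho_gen.
move/(_ i); rewrite reflection_root (cartan_like_diag cA) !mxE !eqxx /=.
by rewrite mulr1.
Qed.

End Tits.

Section ReflectionOrders.
Variables (n : nat) (A : 'M[int]_n).
Hypothesis cA : cartan_like A.
Local Notation S := (reflection_mx A).
Local Notation alpha := (@simple_root n).

Lemma reflection_mx_order i j : i != j ->
  (S i * S j) ^+ bond_order (A i j * A j i) = 1.
Proof.
move=> ij; have [p [r [pE rE pr]]] := cartan_like_cases cA ij.
rewrite pE rE mulrNN; set m := bond_order _.
apply/matrixP => l k; set M := _ ^+ m.
suff E : M *m alpha k = alpha k.
  have -> : M l k = (M *m alpha k) l 0 by rewrite -colE mxE.
  by rewrite E !mxE eqxx andbT.
(* The orbit of [alpha k] stays in the plane through it spanned by [alpha i] and [alpha j], where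
   both reflections act by affine formulas with [f] and [h] as parameters. *)
pose f : rat := (A i k)%:~R; pose h : rat := (A j k)%:~R.
pose st (x y : rat) := alpha k + x *: alpha i + y *: alpha j.
have Sj x y : S j *m st x y = st x (r%:R * x - y - h).
  rewrite !mulmxDr -!scalemxAr !reflection_root rE (cartan_like_diag cA).
  by apply/colP => a; rewrite !mxE rmorphN /=; ring.
have Si x y : S i *m st x y = st (p%:R * y - x - f) y.
  rewrite !mulmxDr -!scalemxAr !reflection_root pE (cartan_like_diag cA).
  by apply/colP => a; rewrite !mxE rmorphN /=; ring.
have st0 : alpha k = st 0 0 by rewrite /st !scale0r !addr0.
have step x y m' : (S i * S j) ^+ m'.+1 *m st x y =
    (S i * S j) ^+ m' *m st (p%:R * (r%:R * x - y - h) - x - f) (r%:R * x - y - h).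
  by rewrite exprSr -mulmxA -mulmxA Sj Si.
rewrite /M st0 /m; move: pr step; rewrite !inE.
case/orP=> [|/orP[|/orP[|/orP[|/orP[]]]]] /eqP[-> ->] /= step;
  rewrite !step expr0 mul1mx; congr (st _ _); ring.
Qed.

End ReflectionOrders.

(** * Dynkin diagrams *)

Section Acyclic.

(* Each vertex is joined to at most one smaller vertex, so that a Dynkin diagram
   has no cycles. *)
Lemma connected_cartan_parent (t : connected_dynkin) (i i' j : 'I_(connected_rank t)) :
  (i < j)%N -> (i' < j)%N ->
  connected_cartan t i j != 0 -> connected_cartan t i' j != 0 -> i = i'.
Proof.
move=> ij i'j; rewrite !mxE !ifN; last 2 first.
- by apply: contraTneq i'j => ->; rewrite ltnn.
- by apply: contraTneq ij => ->; rewrite ltnn.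
rewrite !oppr_eq0 !eqz_nat => a b; apply/val_inj.
have := ltn_ord i; have := ltn_ord i'; have := ltn_ord j; move: ij i'j a b.
case: t i i' j => [n n1|n n1|n n1|n n1|n n1||] /= [i hi] [i' hi'] [j hj] /=;
  rewrite /branch /chain; do ?case: ifP; lia.
Qed.

Lemma cartan_parent (D : dynkin) (i i' j : 'I_(dynkin_rank D)) :
  (i < j)%N -> (i' < j)%N ->
  cartan_matrix D i j != 0 -> cartan_matrix D i' j != 0 -> i = i'.
Proof.
elim: D i i' j => [|t D IH] /=; first by case.
move=> i i' j; rewrite -(splitK i) -(splitK i') -(splitK j).
case: (split j) => j0; case: (split i) => i0; case: (split i') => i0' /=.
- rewrite !block_mxEul => a b c d; congr (lshift _ _).
  exact: connected_cartan_parent c d.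
- by move=> _; rewrite ltnNge (leq_trans (ltnW (ltn_ord j0))) ?leq_addr.
- by rewrite ltnNge (leq_trans (ltnW (ltn_ord j0))) ?leq_addr.
- by rewrite ltnNge (leq_trans (ltnW (ltn_ord j0))) ?leq_addr.
- by rewrite block_mxEur mxE eqxx.
- by rewrite block_mxEur mxE eqxx.
- by rewrite !(block_mxEur, mxE) eqxx.
rewrite !ltn_add2l !block_mxEdr => a b c d; congr (rshift _ _).
exact: IH c d.
Qed.

End Acyclic.

Section DynkinGroup.
Variables (n : nat) (B : 'M[int]_n) (D : dynkin).
Variables (sigma : 'I_(dynkin_rank D) -> 'I_n) (tau : 'I_n -> 'I_(dynkin_rank D)).
Hypotheses (tB : tame B) (sigmaK : cancel sigma tau) (tauK : cancel tau sigma)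
  (cartanE : forall i j,
     cartan_counterpart B (sigma i) (sigma j) = cartan_matrix D i j).
Local Notation G := (diagram_of B).
Local Notation A := (cartan_matrix D).

Let skB : skew_symmetrisable B. Proof. by case: tB. Qed.

Lemma cartan_entry i j : i != j -> A i j = - `|B (sigma i) (sigma j)|.
Proof. by move=> ij; rewrite -cartanE mxE (inj_eq (can_inj sigmaK)) (negPf ij). Qed.

Lemma cartan_weight i j : i != j ->
  A i j * A j i = (edge_weight G (sigma i) (sigma j))%:Z.
Proof.
move=> ij; rewrite !cartan_entry // 1?eq_sym // mulrNN edge_weightE //.
by rewrite abszM PoszM !abszE.
Qed.

Lemma cartan_matrix_cartan_like : cartan_like A.
Proof.
split=> [i|i j ij|i j|i j ij].
- exact: cartan_diag.
- by rewrite cartan_entry // oppr_le0.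
- have [->|ij] := eqVneq i j; first by [].
  rewrite !cartan_entry // 1?eq_sym // => /eqP; rewrite oppr_eq0 normr_eq0.
  by rewrite (skew_eq0 skB) => /eqP->; rewrite normr0 oppr0.
by rewrite cartan_weight // lez_nat tame_le3.
Qed.

Lemma cartan_exponent i j : i != j ->
  coxeter_exponent G (sigma i) (sigma j) = bond_order (A i j * A j i).
Proof.
by move=> ij; rewrite cartan_weight.
Qed.

Lemma cartan_joined i j : joined G (sigma i) (sigma j) -> A i j != 0.
Proof.
rewrite joinedE // => Bij.
have ij : i != j by apply: contraNneq Bij => ->; rewrite (skew_diag skB).
by rewrite cartan_entry // oppr_eq0 normr_eq0.
Qed.

(** The vertex of the cycle with the largest number in [D] would have two distinct smaller
    neighbours. *)
Lemma dynkin_acyclic c : ~ induced_cycle G c.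
Proof.
move=> cG; have [s2 _ _] := cG.
have [x0 xc0] : exists x, x \in c by case: c s2 {cG} => // x p _; exists x; rewrite mem_head.
pose x := [arg max_(y > x0 | y \in c) nat_of_ord (tau y)]%N.
have [xc xmax] : x \in c /\ forall y, y \in c -> (tau y <= tau x)%N.
  by rewrite /x; case: arg_maxnP.
have [m p mE] := rot_to xc.
have cp : induced_cycle G (x :: p) by rewrite -mE; apply: induced_cycle_rot.
have [/= s2' /andP[xp Up] _] := cp.
have below y : y \in p -> joined G x y -> (tau y < tau x)%N /\ A (tau y) (tau x) != 0.
  move=> yp xy; split; last by apply: cartan_joined; rewrite !tauK joined_sym.
  rewrite ltn_neqAle xmax ?andbT; last by rewrite -(mem_rot m) mE inE yp orbT.
  apply: contraNneq xp => /val_inj/(can_inj tauK) <- //.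
have hp : head x p \in p by case: (p) s2' => // y q _; rewrite mem_head.
have lp : last x p \in p by case: (p) s2' => // y q _; rewrite /= mem_last.
have [|h1 h2] := below (head x p) hp.
  by rewrite (induced_cycle_joined cp hp) eqxx.
have [|l1 l2] := below (last x p) lp.
  by rewrite (induced_cycle_joined cp lp) eqxx orbT.
have /(can_inj tauK) := cartan_parent h1 l1 h2 l2.
case: (p) s2' Up => // y [|z q] //= _ /andP[yq _] E.
by rewrite E mem_last in yq.
Qed.

Definition dynkin_reflection (x : 'I_n) : reflection_group D :=
  exist _ (simple_reflection (tau x)) (asboolT (RefGen (tau x))).
Local Notation t := dynkin_reflection.

Lemma val_reflectionX (M : reflection_group D) m : val (M ^+ m)%g = (val M ^+ m)%R.
Proof. by elim: m => // m IH; rewrite expgS exprS -IH. Qed.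

Lemma dynkin_relators : satisfies_relators G t.
Proof.
apply: reflection_family_relators => //; split; last first.
  by move=> c /dynkin_acyclic.
split=> [x|x y xy]; first by apply: val_inj; rewrite /= simple_reflectionK.
apply: val_inj; rewrite val_reflectionX /=.
have txy : tau x != tau y by rewrite (can_eq tauK).
rewrite -(tauK x) -(tauK y) cartan_exponent // !tauK.
exact: (reflection_mx_order cartan_matrix_cartan_like txy).
Qed.

Local Notation F := (@W_hom n G (reflection_group D) t).

Lemma dynkin_surjective (M : reflection_group D) : exists g, F g = M.
Proof.
have homM := W_homM dynkin_relators.
suff h M0 : in_reflection_group M0 -> exists g, val (F g) = M0.
  by have [g gE] := h _ (asboolW (valP M)); exists g; apply: val_inj.
elim=> [i||M1 M2 _ [g1 <-] _ [g2 <-]|M1 _ [g1 <-]].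
- by exists (W_gen G (sigma i)); rewrite (W_hom_gen dynkin_relators) /= sigmaK.
- by exists 1%g; rewrite (morph_one homM).
- by exists (g1 * g2)%g; rewrite homM.
by exists g1^-1%g; rewrite (morph_inv homM).
Qed.

Lemma dynkin_injective : injective (F).
Proof.
have homM := W_homM dynkin_relators.
suff ker g : F g = 1%g -> g = 1%g.
  move=> g h gh; apply/eqP; rewrite -divg_eq1; apply/eqP/ker.
  by rewrite homM (morph_inv homM) gh mulgV.
move=> g1; have rf := relators_reflection_family tB (@W_gen_relators _ G).
have [[ss cox] _] := rf.
apply: (@tits_faithful _ A (W G) (fun i => W_gen G (sigma i))
  (fun g => val (F g))).
- exact: cartan_matrix_cartan_like.
- by move=> i; apply: ss.
- move=> i j ij; rewrite -cartan_exponent //; apply: cox.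
  by rewrite (inj_eq (can_inj sigmaK)).
- move=> g'; elim/W_wordP: g' => w; rewrite W_wordE.
  exists [seq tau l.1 | l <- w]; rewrite big_map.
  elim: w => [|[x b] w IH]; first by rewrite big_nil.
  rewrite big_cons /= IH tauK; congr (_ * _)%g.
  by case: b => //; rewrite (involV (ss x)).
- by rewrite (morph_one homM).
- by move=> g' h; rewrite homM.
- by move=> i; rewrite (W_hom_gen dynkin_relators) /= sigmaK.
by rewrite g1.
Qed.

Theorem dynkin_W_isomorphic : group_isomorphic (W G) (reflection_group D).
Proof.
apply: (group_isomorphic_morph (W_homM dynkin_relators)).
have inv M : {g | F g = M} by apply/cid/dynkin_surjective.
exists (fun M => sval (inv M)) => [g|M]; last exact: svalP (inv M).
by apply: dynkin_injective; apply: svalP (inv _).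
Qed.

End DynkinGroup.

(** * From tame matrices to the seeds of a cluster algebra *)

Section Seeds.
Variables (n : nat) (s0 : seed n).
Hypotheses (seed0 : is_seed s0) (fin0 : finite_type s0).

Lemma finite_type_tame : tame (exchange s0).
Proof. by split; [case: seed0 | apply: finite_type_two_finite]. Qed.

Lemma mutations_W_isomorphic (B : 'M[int]_n) ks : tame B ->
  group_isomorphic (W (diagram_of B)) (W (diagram_of (mutations B ks))).
Proof.
elim: ks B => [|k ks IH] B tB; first exact: group_isomorphic_refl.
apply: group_isomorphic_trans (IH _ (tame_mutate k tB)).
exact: mutate_W_isomorphic.
Qed.

Lemma seed_exchange s : seed_of s0 s -> exists ks (sigma : 'S_n),
  forall i j, exchange s i j = mutations (exchange s0) ks (sigma i) (sigma j).
Proof.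
move=> [ks [sigma ->]]; exists ks, sigma => i j.
by rewrite mxE exchange_foldl.
Qed.

Lemma seed_W_isomorphic s : seed_of s0 s ->
  group_isomorphic (W (diagram_of (exchange s))) (W (diagram_of (exchange s0))).
Proof.
move=> /seed_exchange[ks [sigma sE]].
apply: (@group_isomorphic_trans _ (W (diagram_of (mutations (exchange s0) ks)))).
  by apply: (relabel_W_isomorphic (sigma := sigma)) => i j; rewrite !mxE !sE.
exact/group_isomorphic_sym/mutations_W_isomorphic/finite_type_tame.
Qed.

Lemma seed_dynkin_isomorphic D : dynkin_diagram_of s0 D ->
  group_isomorphic (W (diagram_of (exchange s0))) (reflection_group D).
Proof.
move=> [s [/seed_exchange[ks [sigma sE]] [f [[g fK gK] cE]]]].
apply: group_isomorphic_trans (mutations_W_isomorphic ks finite_type_tame) _.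
apply: (@dynkin_W_isomorphic _ _ _ (sigma \o f) (g \o (sigma^-1)%g)).
- exact/tame_mutations/finite_type_tame.
- by move=> i; rewrite /= permK fK.
- by move=> i; rewrite /= gK permKV.
by move=> i j; rewrite -cE !mxE sE (inj_eq perm_inj).
Qed.

End Seeds.

Theorem theorem5p4 :
  (forall (n : nat) (G G' : diagram n) (k : 'I_n),
      finite_type_diagram G -> diagram_mutation k G G' ->
      group_isomorphic (W G) (W G')) /\
  (forall (n : nat) (s0 : seed n),
      is_seed s0 -> finite_type s0 ->
      (forall s s' : seed n, seed_of s0 s -> seed_of s0 s' ->
         group_isomorphic (W (diagram_of (exchange s)))
                          (W (diagram_of (exchange s')))) /\
      (forall D : dynkin, dynkin_diagram_of s0 D ->
         forall s : seed n, seed_of s0 s ->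
           group_isomorphic (W (diagram_of (exchange s)))
                            (reflection_group D))).
Proof.
split=> [n G G' k [s [sd GE fs]] [B [skB GB ->]]|n s0 sd0 fin0].
  rewrite GB; apply: mutate_W_isomorphic.
  by apply: (tame_eq (finite_type_tame sd fs) skB); rewrite -GE.
split=> [s s' ss ss'|D DD s ss].
  apply: group_isomorphic_trans (seed_W_isomorphic sd0 fin0 ss) _.
  exact/group_isomorphic_sym/seed_W_isomorphic.
apply: group_isomorphic_trans (seed_W_isomorphic sd0 fin0 ss) _.
exact: seed_dynkin_isomorphic.
Qed.
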